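(* Let $\alpha\in(0,1)$ and consider the de Finetti model. Assume that $Y$ is real. For $\omega\in\mathbb{R}^{q-1}$ let $\widehat g_\omega$ be the transform, taken term by term in the series, of the limit Gaussian field $g^\infty_{\mathfrak m_+}$: $$\widehat g_\omega=\int_{\mathbb{R}^{q-1}}e^{i\omega\cdot\mathfrak m_+}g^\infty_{\mathfrak m_+}\,d\mathfrak m_+,\qquad g^\infty_{\mathfrak m_+}=\varphi(\mathfrak m_+;q)\sum_{l\in\mathbb{N}^{q-1}}\mathbb{E}\Big[\prod_{k=1}^{q-1}Y_{1/2}[k]^{l[k]}\Big]\sqrt{\prod_{j=1}^{q-1}l[j]!}\;Q_l(\mathfrak m;(\theta_k);\infty)\,\gamma_l .$$ Then $$\widehat g_\omega=\mathbb{E}\big[e^{i\mathfrak M_+\cdot\omega}\big]\;\mathbb{E}_{Y_{1/2}}\Bigg\{\sum_{l\in\mathbb{N}^{q-1}}\Big(\frac iq\Big)^{|l|}\prod_{k=1}^{q-1}\frac{\Big(Y_{1/2}[k]\sum_{j=1}^{q-1}\omega[j]\theta_k^j\Big)^{l[k]}}{\sqrt{l[k]!}}\;\gamma_l\Bigg\},$$ where $\mathbb{E}_{Y_{1/2}}$ is expectation over $Y_{1/2}$ only. This is a zero mean complex Gaussian field, and for $\omega,\psi\in\mathbb{R}^{q-1}$ $$\mathrm{Cov}\big(\widehat g_\omega,\widehat g_\psi\big)=\mathbb{E}\big[\widehat g_\omega\overline{\widehat g_\psi}\big]=\mathbb{E}\big[e^{i\mathfrak M_+\cdot\omega}\big]\,\mathbb{E}\big[e^{-i\mathfrak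 M_+\cdot\psi}\big]\;\mathbb{E}\Bigg[\exp\Big\{\frac{1}{q^2}\sum_{k=1}^{q-1}Y[k]\sum_{a,b=1}^{q-1}\omega[a]\psi[b]\,\theta_k^a\theta_k^{-b}\Big\}\Bigg],$$ where $$\mathbb{E}\big[e^{i\mathfrak M_+\cdot\omega}\big]=\exp\Big\{-\frac{1}{2q}\sum_{a,b=1}^{q-1}\Big(\delta_{ab}-\frac1q\Big)\omega[a]\omega[b]\Big\}.$$
   Context: Let $q\ge2$, $\theta_k=e^{2\pi ik/q}$, $\mathbb{N}=\{0,1,2,\ldots\}$, and for $l\in\mathbb{N}^{q-1}$ let $|l|=\sum_kl[k]$. $(\gamma_l)_{l\in\mathbb{N}^{q-1}}$ are i.i.d. standard Gaussian random variables, independent of $Y_{1/2}$. $\mathfrak M=(\mathfrak M[0],\ldots,\mathfrak M[q-1])$ is multivariate normal with zero means and $\mathrm{Cov}(\mathfrak M[a],\mathfrak M[b])=\frac1q(\delta_{ab}-\frac1q)$; $\mathfrak M_+=(\mathfrak M[1],\ldots,\mathfrak M[q-1])$ has density $$\varphi(\mathfrak m_+;q)=\frac{q^{q/2}}{(2\pi)^{(q-1)/2}}\exp\Big\{-\frac q2\sum_{a,b=1}^{q-1}(\delta_{ab}+1)\mathfrak m[a]\mathfrak m[b]\Big\}.$$ Given $\mathfrak m_+=(\mathfrak m[1],\ldots,\mathfrak m[q-1])$, $\mathfrak m=(\mathfrak m[0],\mathfrak m_+)$ with $\mathfrak m[0]=-\sum_{j\ge1}\mathfrak m[j]$. $Q_l(\mathfrak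 m;(\theta_k);\infty)$ is the coefficient of $w_1^{l[1]}\cdots w_{q-1}^{l[q-1]}$ in $$\exp\Big\{-\frac{1}{2q}\sum_{j=0}^{q-1}\Big(\sum_{k=1}^{q-1}w_k\theta_k^j\Big)^2+\sum_{j=0}^{q-1}\mathfrak m[j]\sum_{k=1}^{q-1}w_k\theta_k^j\Big\}.$$ De Finetti model: $\mu$ is a probability measure on the set of probability distributions $p=(p[0],\ldots,p[q-1])$ on $\{0,\ldots,q-1\}$; $\xi[k]=\sum_{j=0}^{q-1}\theta_1^{kj}p[j]$, and $\nu$ is the law of $\xi$ when $p\sim\mu$. Let $(\xi_b)_{b\ge1}$ be i.i.d. with law $\nu$. For $\phi>0$ let $T_{\alpha,\phi}$ be independent of $(\xi_b)$ with $\mathbb{P}(T_{\alpha,\phi}=t)=(1-\alpha)^\phi\alpha^t\frac{\phi(\phi+1)\cdots(\phi+t-1)}{t!}$, $t=0,1,2,\ldots$. Then $Y[k]=\prod_{b=1}^{T_{\alpha,1}}\xi_b[k]$ and $Y_{1/2}[k]=\prod_{b=1}^{T_{\alpha,1/2}}\xi_b[k]$, $k=1,\ldots,q-1$ (empty products equal to $1$). Equivalently, these are products of points in $(q-1)$-dimensional point processes with joint probability generating functionals $\big(1+\frac{\alpha}{1-\alpha}\int(1-\prod_{k=1}^{q-1}f_k(\xi[k]))\nu(d\xi)\big)^{-\phi}$ with $\phi=1$ and $\phi=\frac12$. ''$Y$ is real'' means that $Y[1],\ldots,Y[q-1]$ are almost surely real (equivalently, $\xi[1],\ldots,\xi[q-1]$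 are real $\nu$-almost surely). *)

(* Defs.v *)
From HB Require Import structures.
From mathcomp Require Import all_boot all_order all_algebra.
From mathcomp Require Import -(notations) mpoly.
From mathcomp Require Import all_classical all_reals all_analysis.
From mathcomp Require Import complex.

Set Implicit Arguments.
Unset Strict Implicit.
Unset Printing Implicit Defensive.
Import Order.TTheory GRing.Theory Num.Theory.
Import numFieldNormedType.Exports.

Local Open Scope classical_set_scope.
Local Open Scope ring_scope.
Local Open Scope complex_scope.

Section complex_analysis.
Context {R : realType}.

Definition cexp (z : R[i]) : R[i] :=
  (expR (complex.Re z) * cos (complex.Im z))
  +i* (expR (complex.Re z) * sin (complex.Im z)).

Definition theta (q k : nat) : R[i] := cexp (2%:R * pi * k%:R / q%:R)*i.

Section integral.
Context d (T : measurableType d) (mu : {measure set T -> \bar R}).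

Definition cintegrable (f : T -> R[i]) : Prop :=
  mu.-integrable setT (fun x => (complex.Re (f x))%:E) /\
  mu.-integrable setT (fun x => (complex.Im (f x))%:E).

Definition cintegral (f : T -> R[i]) : R[i] :=
  (\int[mu]_x complex.Re (f x)) +i* (\int[mu]_x complex.Im (f x)).

End integral.

Section sum.
Context {I : choiceType}.

Definition csummable (f : I -> R[i]) : Prop :=
  summable [set: I] (fun i => (complex.Re (f i))%:E) /\
  summable [set: I] (fun i => (complex.Im (f i))%:E).

(* Unconditional sum; meaningful when f is summable. *)
Definition rsum (f : I -> R) : R :=
  fine (\esum_(i in [set: I]) ((EFin \o f)^\+)%E i)
  - fine (\esum_(i in [set: I]) ((EFin \o f)^\-)%E i).

Definition csum (f : I -> R[i]) : R[i] :=
  rsum (fun i => complex.Re (f i)) +i* rsum (fun i => complex.Im (f i)).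

End sum.

End complex_analysis.

Section complex_measurable.
Context {R : realType}.
HB.instance Definition _ := isPointed.Build R[i] 0.
Let f1 : R[i] -> R := @complex.Re R.
Let f2 : R[i] -> R := @complex.Im R.

Let complex_set0 : g_sigma_preimageU f1 f2 (set0 : set R[i]).
Proof. exact: sigma_algebra0. Qed.

Let complex_setC (A : set R[i]) :
  g_sigma_preimageU f1 f2 A -> g_sigma_preimageU f1 f2 (~` A).
Proof. exact: sigma_algebraC. Qed.

Let complex_bigcup (F : (set R[i])^nat) :
  (forall i, g_sigma_preimageU f1 f2 (F i)) ->
  g_sigma_preimageU f1 f2 (\bigcup_i (F i)).
Proof. exact: sigma_algebra_bigcup. Qed.

(* The Borel sigma-algebra of the plane: generated by Re and Im. *)
HB.instance Definition _ := @isMeasurable.Build default_measure_display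
  R[i] (g_sigma_preimageU f1 f2) complex_set0 complex_setC complex_bigcup.

End complex_measurable.

Section lebesgue_tuple.
Context {R : realType}.

Section step.
Variables (n : nat) (m : {sigma_finite_measure set (n.-tuple R) -> \bar R}).

Let cons2 (x : measurableTypeR R * n.-tuple R) : n.+1.-tuple R :=
  [the n.+1.-tuple R of x.1 :: x.2].

Let mcons2 : measurable_fun setT cons2.
Proof. exact: measurable_cons. Qed.

Let leb : {sigma_finite_measure set (measurableTypeR R) -> \bar R} :=
  [the {sigma_finite_measure set (measurableTypeR R) -> \bar R} of
    @lebesgue_measure R].

Definition lebesgue_tuple_step : set (n.+1.-tuple R) -> \bar R :=
  pushforward (leb \x m)%E cons2.

Let step0 : lebesgue_tuple_step set0 = 0%E.
Proof. by rewrite /lebesgue_tuple_step /pushforward preimage_set0 measure0. Qed.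

Let step_ge0 A : (0 <= lebesgue_tuple_step A)%E.
Proof. exact: measure_ge0. Qed.

Let step_sigma_additive : semi_sigma_additive lebesgue_tuple_step.
Proof.
exact: (@measure_semi_sigma_additive _ _ _ (pushforward (leb \x m)%E cons2)).
Qed.

HB.instance Definition _ := isMeasure.Build _ _ _ lebesgue_tuple_step
  step0 step_ge0 step_sigma_additive.

Let step_sigma_finite : sigma_finite setT lebesgue_tuple_step.
Proof.
pose uncons (t : n.+1.-tuple R) : measurableTypeR R * n.-tuple R :=
  (thead t, [tuple of behead t]).
have munc : measurable_fun setT uncons.
  apply: measurable_fun_pair; first exact: measurable_tnth.
  exact: measurable_behead.
have consK : cancel cons2 uncons.
  by move=> [x t]; rewrite /uncons /cons2 theadE; congr pair; exact/val_inj.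
have /sigma_finiteP[F [TF ndF Foo]] := sigma_finiteT leb.
have /sigma_finiteP[G [TG ndG Goo]] := sigma_finiteT m.
exists (fun k => uncons @^-1` (F k `*` G k)).
  rewrite -preimage_bigcup (_ : \bigcup_k _ = setT) ?preimage_setT//.
  apply/seteqP; split=> // -[x t] _.
  have [i _ Fx] : (\bigcup_i F i) x by rewrite -TF.
  have [j _ Gt] : (\bigcup_j G j) t by rewrite -TG.
  exists (maxn i j) => //; split => /=.
  - by move: x Fx; exact/subsetPset/ndF/leq_maxl.
  - by move: t Gt; exact/subsetPset/ndG/leq_maxr.
move=> k; have [mF Fk] := Foo k; have [mG Gk] := Goo k; split.
  by rewrite -[X in measurable X]setTI; apply: munc => //; exact: measurableX.
rewrite /lebesgue_tuple_step /pushforward (_ : cons2 @^-1` _ = F k `*` G k).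
  by rewrite product_measure1E// lte_mul_pinfty// ge0_fin_numE.
by apply/funext => y; rewrite /preimage /mkset consK.
Qed.

HB.instance Definition _ := Measure_isSigmaFinite.Build _ _ _
  lebesgue_tuple_step step_sigma_finite.

End step.

(* Lebesgue measure on R^n: iterated product, moved to tuples by cons. *)
Fixpoint lebesgue_tuple (n : nat) :
    {sigma_finite_measure set (n.-tuple R) -> \bar R} :=
  match n with
  | 0 => [the {sigma_finite_measure set (0.-tuple R) -> \bar R} of
           dirac ([tuple] : 0.-tuple R)]
  | n'.+1 => [the {sigma_finite_measure set (n'.+1.-tuple R) -> \bar R} of
           lebesgue_tuple_step (lebesgue_tuple n')]
  end.

End lebesgue_tuple.

Section formal_exponential.
Context {R : realType} {n : nat}.

(* Coefficient of w_1^(l_1) ... w_n^(l_n) in exp(p(w)), for p without constant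
   term: p ^+ i then only has monomials of degree at least i, so that the powers
   beyond the total degree of l do not contribute (exp_coef_stable). *)
Definition exp_coef (p : mpoly n R[i]) (l : n.-tuple nat) : R[i] :=
  mcoeff (Multinom l)
    (\sum_(i < (mdeg (Multinom l)).+1) i`!%:R^-1 *: p ^+ i).

Lemma mcoeff_exprn_lt (p : mpoly n R[i]) (i : nat) (m : multinom n) :
  mcoeff mnm0 p = 0 -> (mdeg m < i)%N -> mcoeff m (p ^+ i) = 0.
Proof.
move=> p0; elim: i m => // i IH m mi.
rewrite exprS mcoeffM big1// => k /eqP mk.
have [k0|k0] := eqVneq (mdeg (bmnm k.1)) 0%N.
  by move/eqP: k0; rewrite mdeg_eq0 => /eqP ->; rewrite p0 mul0r.
rewrite (IH (bmnm k.2)) ?mulr0//.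
have mE : mdeg m = (mdeg (bmnm k.1) + mdeg (bmnm k.2))%N by rewrite {1}mk mdegD.
have aux (u v w : nat) : u = (v + w)%N -> v != 0%N -> (u < i.+1)%N -> (w < i)%N.
  move=> ->; case: v => // v _; rewrite addSn ltnS.
  exact/leq_ltn_trans/leq_addl.
exact: aux mE k0 mi.
Qed.

Lemma exp_coef_stable (p : mpoly n R[i]) (l : n.-tuple nat) (N : nat) :
  mcoeff mnm0 p = 0 -> (mdeg (Multinom l) < N)%N ->
  mcoeff (Multinom l) (\sum_(i < N) i`!%:R^-1 *: p ^+ i) = exp_coef p l.
Proof.
move=> p0 lN; rewrite /exp_coef.
rewrite (big_ord_widen N (fun i => i`!%:R^-1 *: p ^+ i) lN) !raddf_sum/=.
rewrite [LHS](bigID (fun i : 'I_N => i < (mdeg (Multinom l)).+1)%N)/=.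
rewrite [X in _ + X]big1 ?addr0// => i; rewrite -leqNgt => li.
by rewrite mcoeffZ mcoeff_exprn_lt ?mulr0.
Qed.

End formal_exponential.

Section probability_notions.
Context {R : realType} {d : measure_display} {T : measurableType d}.
Variable P : probability T R.

(* Mean m, standard deviation s. The case s = 0 is separate because
   normal_prob m 0 is not the Dirac measure at m. *)
Definition gaussian_law (m s : R) : set R -> \bar R :=
  if s == 0 then \d_m else normal_prob m s.

Definition gaussian (X : T -> R) : Prop :=
  measurable_fun setT X /\
  exists m s : R, 0 <= s /\
    forall A, measurable A -> pushforward P X A = gaussian_law m s A.

Definition jointly_gaussian (I : Type) (X : I -> T -> R) : Prop :=
  forall (s : seq I) (a : I -> R),
    gaussian (fun x => \sum_(i <- s) a i * X i x).

(* Real and imaginary parts are jointly Gaussian; no circular symmetry. *)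
Definition complex_gaussian_field (I : Type) (Z : I -> T -> R[i]) : Prop :=
  jointly_gaussian (fun (i : I + I) (x : T) =>
    match i with
    | inl i => complex.Re (Z i x)
    | inr i => complex.Im (Z i x)
    end).

Definition ccovariance (X Y : T -> R[i]) : R[i] :=
  cintegral P (fun x =>
    (X x - cintegral P X) * conjc (Y x - cintegral P Y)).

Definition has_law d' (T' : measurableType d') (X : {RV P >-> T'})
    (nu : set T' -> \bar R) : Prop :=
  forall A, measurable A -> distribution P X A = nu A.

Definition mutually_independent d' (T' : measurableType d') (I : eqType)
    (X : I -> {RV P >-> T'}) : Prop :=
  forall (s : seq I) (A : I -> set T'), uniq s -> (forall i, measurable (A i)) ->
    P (\bigcap_(i in [set` s]) X i @^-1` A i) =
    (\prod_(i <- s) P (X i @^-1` A i))%E.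

Definition iid d' (T' : measurableType d') (I : eqType)
    (X : I -> {RV P >-> T'}) (nu : set T' -> \bar R) : Prop :=
  (forall i, has_law (X i) nu) /\ mutually_independent X.

Definition sigma_gen d' (T' : measurableType d') (I : Type)
    (X : I -> T -> T') : set (set T) :=
  <<s \bigcup_i preimage_set_system setT (X i) measurable >>.

Definition independent (F G : set (set T)) : Prop :=
  forall A B, F A -> G B -> P (A `&` B) = (P A * P B)%E.

End probability_notions.

(* A point of R^(q-1) or C^(q-1) with coordinates 1, ..., q-1 is a
   (q-1)-tuple, and k : 'I_q.-1 stands for the coordinate k.+1. *)
Section model.
Context {R : realType} (q : nat).

Definition dot (v w : q.-1.-tuple R) : R :=
  \sum_(j < q.-1) tnth v j * tnth w j.

Definition simplex : set (q.-tuple R) :=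
  [set p | (forall j, 0 <= tnth p j) /\ \sum_(j < q) tnth p j = 1].

Definition xi_of (p : q.-tuple R) : q.-1.-tuple R[i] :=
  [tuple \sum_(j < q) theta q 1 ^+ (k.+1 * j) * (tnth p j)%:C | k < q.-1].

Definition nu_of (mu : probability (q.-tuple R) R) :
    set (q.-1.-tuple R[i]) -> \bar R :=
  pushforward mu xi_of.

Definition phi_density (m : q.-1.-tuple R) : R :=
  q%:R `^ (q%:R / 2) / (2 * pi) `^ (q.-1%:R / 2) *
  expR (- (q%:R / 2) *
    \sum_(a < q.-1) \sum_(b < q.-1) ((a == b)%:R + 1) * tnth m a * tnth m b).

(* The vector (m[0], m[1], ..., m[q-1]) with m[0] = - (m[1] + ... + m[q-1]). *)
Definition full (m : q.-1.-tuple R) (j : nat) : R :=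
  if j is i.+1 then nth 0 m i else - \sum_(i < q.-1) tnth m i.

Definition Q_exponent (m : q.-1.-tuple R) : mpoly q.-1 R[i] :=
  let S (j : nat) : mpoly q.-1 R[i] :=
    \sum_(k < q.-1) theta q k.+1 ^+ j *: mpolyX R[i] (mnm1 k) in
  - (2 * q%:R)^-1 *: \sum_(j < q) S j ^+ 2
  + \sum_(j < q) (full m j)%:C *: S j.

Lemma mcoeff0_Q_exponent (m : q.-1.-tuple R) :
  mcoeff mnm0 (Q_exponent m) = 0.
Proof.
have S0 (j : nat) : mcoeff mnm0
    (\sum_(k < q.-1) theta q k.+1 ^+ j *: mpolyX R[i] (mnm1 k)) = 0.
  rewrite raddf_sum/= big1// => k _; rewrite mcoeffZ mcoeffX.
  by rewrite -mdeg_eq0 mdeg1 mulr0.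
rewrite /Q_exponent mcoeffD mcoeffZ !raddf_sum/= !big1 ?mulr0 ?addr0// => j _.
  by rewrite mcoeffZ S0 mulr0.
by rewrite mcoeff_exprn_lt ?mdeg0.
Qed.

Definition Q (l : q.-1.-tuple nat) (m : q.-1.-tuple R) : R[i] :=
  exp_coef (Q_exponent m) l.

Definition negbin_pmf (alpha phi : R) (t : nat) : R :=
  (1 - alpha) `^ phi * alpha ^+ t * (\prod_(i < t) (phi + i%:R)) / t`!%:R.

Section random.
Context {d : measure_display} {T : measurableType d} (P : probability T R).

Definition negbin (N : {RV P >-> nat}) (alpha phi : R) : Prop :=
  forall t : nat, P (N @^-1` [set t]) = (negbin_pmf alpha phi t)%:E.

Definition point_product (xi : nat -> {RV P >-> q.-1.-tuple R[i]})
    (N : {RV P >-> nat}) (k : 'I_q.-1) (x : T) : R[i] :=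
  \prod_(b < N x) tnth (xi b x) k.

Variables (Y : 'I_q.-1 -> T -> R[i]) (gamma : q.-1.-tuple nat -> T -> R).

(* The limit field at m is the series over l of g_term l m; ghat is its Fourier
   transform, taken term by term. *)
Definition g_term (l : q.-1.-tuple nat) (m : q.-1.-tuple R) (x : T) : R[i] :=
  (phi_density m)%:C *
  (cintegral P (fun y => \prod_(k < q.-1) Y k y ^+ tnth l k) *
   (Num.sqrt (\prod_(j < q.-1) (tnth l j)`!%:R))%:C *
   Q l m * (gamma l x)%:C).

Definition ghat_term (w : q.-1.-tuple R) (l : q.-1.-tuple nat) (x : T) : R[i] :=
  cintegral (lebesgue_tuple q.-1)
    (fun m => cexp (dot w m)*i * g_term l m x).

Definition ghat (w : q.-1.-tuple R) (x : T) : R[i] :=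
  csum (fun l => ghat_term w l x).

End random.

(* The term of index l of the series under the expectation over Y_{1/2}: y is a
   value of Y_{1/2} and g a realization of gamma, so that integrating over y
   alone, with g frozen, is the expectation over Y_{1/2} only. *)
Definition series_term (w : q.-1.-tuple R) (y : 'I_q.-1 -> R[i])
    (g : q.-1.-tuple nat -> R) (l : q.-1.-tuple nat) : R[i] :=
  (1*i / q%:R) ^+ (\sum_(k < q.-1) tnth l k) *
  (\prod_(k < q.-1)
     ((y k * \sum_(j < q.-1) (tnth w j)%:C * theta q k.+1 ^+ j.+1) ^+ tnth l k
      / (Num.sqrt (tnth l k)`!%:R)%:C)) *
  (g l)%:C.

End model.

(* Main.v *)
(* The coefficient of the series for the transform is computed exactly. Write
   L_s f for the Lebesgue integral of f(m) phi(m) exp(s.m), for complex s, so that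
   L_s 1 = exp(s^T Sigma s / 2) with Sigma the covariance of M_+. The polynomials
   Q_l satisfy the recurrence obtained by differentiating their generating
   function in w_k, and multiplication by the linear form in that recurrence is
   the derivative of L_s in s along a fixed direction. Induction on |l| then
   gives L_s Q_l = L_s 1 * prod_k kappa_k(s)^l_k / l_k!, with kappa linear in s.

   With s = i w the transform becomes a series sum_l a_l(w) gamma_l whose
   deterministic coefficients are summable, because |E Y_{1/2}^l| <= 1 and
   sum_l prod_k C^l_k / sqrt(l_k!) is finite. Hence it is a centred Gaussian
   field with covariance sum_l a_l(w) conj(a_l(v)). Since
   (1 - alpha z)^(-1/2) squares to (1 - alpha z)^(-1), the square of E Y_{1/2}^l
   is E Y^l; as these moments are real, the covariance series sums, under the
   expectation over Y, to the stated exponential. Reality of Y is inherited by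
   xi by conditioning on T_{alpha,1} = 1. *)
Require Import Defs.
From HB Require Import structures.
From mathcomp Require Import all_boot all_order all_algebra.
From mathcomp Require Import -(notations) mpoly.
From mathcomp Require Import all_classical all_reals all_analysis.
From mathcomp Require Import complex.
From mathcomp Require Import ring lra measurable_realfun.
Set Implicit Arguments.
Unset Strict Implicit.
Unset Printing Implicit Defensive.
Import Order.TTheory GRing.Theory Num.Theory.
Import numFieldNormedType.Exports.
Import ComplexField.
Local Open Scope classical_set_scope.
Local Open Scope ring_scope.
Local Open Scope complex_scope.

(** The exponent of the generating function of [Q] is a linear form in m minus half its variance:
    the powers of a nontrivial root of unity sum to zero, so the term -1/q of the covariance drops
    out. The [Q_l] are thus Wick polynomials, which is why the quadratic terms of their recurrence
    cancel exactly against those created by differentiating the closed form. Gaussianity of an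
    infinite series is obtained from characteristic functions: those of the partial sums converge by
    dominated convergence, and the law is recovered from the limit by Gaussian smoothing. The
    moments of the field are then read off the standard normal law. Reality of Y matters because the
    covariance contains |E Y_{1/2}^l|^2, whereas the negative binomial identity computes the square
    without conjugation. Bounds and reality of xi hold only almost surely, so truncated products,
    real and bounded at every sample point, stand in for the random products in all independence and
    interchange arguments. *)

Local Notation cRe := (@complex.Re _).
Local Notation cIm := (@complex.Im _).
Local Notation normc := Normc.normc.

(** * Complex functions and their integrals *)

Section complex_basics.
Context {R : realType}.
Implicit Types (z w : R[i]) (x y r : R).

Lemma complex_ext z w : cRe z = cRe w -> cIm z = cIm w -> z = w.
Proof. by case: z => a b; case: w => c e /= -> ->. Qed.

Lemma cReD z w : cRe (z + w) = cRe z + cRe w. Proof. by case: z; case: w. Qed.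
Lemma cImD z w : cIm (z + w) = cIm z + cIm w. Proof. by case: z; case: w. Qed.
Lemma cReN z : cRe (- z) = - cRe z. Proof. by case: z. Qed.
Lemma cImN z : cIm (- z) = - cIm z. Proof. by case: z. Qed.
Lemma cReB z w : cRe (z - w) = cRe z - cRe w. Proof. by rewrite cReD cReN. Qed.
Lemma cImB z w : cIm (z - w) = cIm z - cIm w. Proof. by rewrite cImD cImN. Qed.

Lemma cReM z w : cRe (z * w) = cRe z * cRe w - cIm z * cIm w.
Proof. by case: z; case: w. Qed.

Lemma cImM z w : cIm (z * w) = cRe z * cIm w + cIm z * cRe w.
Proof. by case: z => a b; case: w. Qed.

Lemma cReMr x z : cRe (x%:C * z) = x * cRe z.
Proof. by rewrite cReM/= mul0r subr0. Qed.

Lemma cImMr x z : cIm (x%:C * z) = x * cIm z.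
Proof. by rewrite cImM/= mul0r addr0. Qed.

Lemma cRe_sum I (s : seq I) (P : pred I) (F : I -> R[i]) :
  cRe (\sum_(i <- s | P i) F i) = \sum_(i <- s | P i) cRe (F i).
Proof. by elim/big_rec2: _ => // i a b _ <-; rewrite cReD. Qed.

Lemma cIm_sum I (s : seq I) (P : pred I) (F : I -> R[i]) :
  cIm (\sum_(i <- s | P i) F i) = \sum_(i <- s | P i) cIm (F i).
Proof. by elim/big_rec2: _ => // i a b _ <-; rewrite cImD. Qed.

Lemma cRe_nat n : cRe (n%:R : R[i]) = n%:R.
Proof. by elim: n => // n IH; rewrite -[n.+1]addn1 !natrD cReD IH. Qed.

Lemma cIm_nat n : cIm (n%:R : R[i]) = 0.
Proof. by elim: n => // n IH; rewrite -[n.+1]addn1 !natrD cImD IH addr0. Qed.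

Lemma natrC n : (n%:R : R)%:C = n%:R :> R[i].
Proof. by rewrite rmorph_nat. Qed.

Lemma normc_ge0 z : 0 <= normc z.
Proof. by case: z => a b; exact: sqrtr_ge0. Qed.

Lemma normcX z n : normc (z ^+ n) = normc z ^+ n.
Proof. by elim: n => [|n IH]; rewrite ?expr0 ?Normc.normc1// !exprS Normc.normcM IH. Qed.

Lemma normc_prod I (s : seq I) (P : pred I) (F : I -> R[i]) :
  normc (\prod_(i <- s | P i) F i) = \prod_(i <- s | P i) normc (F i).
Proof.
elim/big_rec2: _ => [|i a b _ <-]; first exact: Normc.normc1.
exact: Normc.normcM.
Qed.

Lemma normc_real x : normc x%:C = `|x|.
Proof. by rewrite /= expr0n/= addr0 sqrtr_sqr. Qed.

Lemma normc_nat n : normc (n%:R : R[i]) = n%:R.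
Proof. by rewrite -natrC normc_real normr_nat. Qed.

Lemma normcD z w : normc (z + w) <= normc z + normc w.
Proof. exact: le_normcD. Qed.

Lemma normc_opp z : normc (- z) = normc z.
Proof. by case: z => a b /=; rewrite !sqrrN. Qed.

Lemma normcB z w : normc (z - w) <= normc z + normc w.
Proof. by rewrite -(normc_opp w) normcD. Qed.

Lemma normc_sum I (s : seq I) (P : pred I) (F : I -> R[i]) :
  normc (\sum_(i <- s | P i) F i) <= \sum_(i <- s | P i) normc (F i).
Proof.
elim/big_rec2: _ => [|i a b _ ab]; first by rewrite Normc.normc0.
by rewrite (le_trans (normcD _ _))// lerD2l.
Qed.

Lemma ler_cRe_normc z : `|cRe z| <= normc z.
Proof.
by case: z => a b /=; rewrite -sqrtr_sqr ler_wsqrtr// lerDl sqr_ge0.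
Qed.

Lemma ler_cIm_normc z : `|cIm z| <= normc z.
Proof.
by case: z => a b /=; rewrite -sqrtr_sqr ler_wsqrtr// lerDr sqr_ge0.
Qed.

Lemma normc_le z : normc z <= `|cRe z| + `|cIm z|.
Proof.
case: z => a b /=; rewrite -[leRHS]ger0_norm ?addr_ge0// -sqrtr_sqr ler_wsqrtr//.
rewrite sqrrD !real_normK ?num_real// lerD2r lerDl mulrn_wge0// mulr_ge0//.
Qed.

Lemma normc_cos_sin r x : 0 <= r -> normc ((r * cos x) +i* (r * sin x)) = r.
Proof.
move=> r0 /=; rewrite !exprMn -mulrDr cos2Dsin2 mulr1 sqrtr_sqr ger0_norm//.
Qed.

Lemma normc_cexp z : normc (cexp z) = expR (cRe z).
Proof. by rewrite normc_cos_sin// expR_ge0. Qed.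

Lemma cexpD z w : cexp (z + w) = cexp z * cexp w.
Proof.
apply: complex_ext; rewrite ?cReM ?cImM /cexp/= cReD cImD expRD ?cosD ?sinD; ring.
Qed.

Lemma cexp0 : cexp (0 : R[i]) = 1.
Proof. by rewrite /cexp/= expR0 cos0 sin0 mulr1 mulr0. Qed.

Lemma cexp_real x : cexp x%:C = (expR x)%:C.
Proof. by rewrite /cexp/= cos0 sin0 mulr1 mulr0. Qed.

Lemma cexpN z : cexp (- z) = (cexp z)^-1.
Proof.
have H : cexp z * cexp (- z) = 1 by rewrite -cexpD subrr cexp0.
have z0 : cexp z != 0.
  by apply/eqP => e; move: H; rewrite e mul0r => /esym/eqP; rewrite oner_eq0.
by apply: (mulfI z0); rewrite H divff.
Qed.

Lemma cexp_neq0 z : cexp z != 0.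
Proof.
apply/eqP => e; have : normc (cexp z) = 0 by rewrite e Normc.normc0.
by rewrite normc_cexp => /eqP; rewrite gt_eqF// expR_gt0.
Qed.

Lemma cexp_sum I (s : seq I) (P : pred I) (F : I -> R[i]) :
  cexp (\sum_(i <- s | P i) F i) = \prod_(i <- s | P i) cexp (F i).
Proof.
elim/big_rec2: _ => [|i a b _ <-]; first exact: cexp0.
exact: cexpD.
Qed.

Lemma cexpX z n : cexp z ^+ n = cexp (n%:R * z).
Proof.
elim: n => [|n IH]; first by rewrite mul0r cexp0.
by rewrite exprS IH -cexpD -[n.+1]add1n natrD mulrDl mul1r.
Qed.

Lemma conj_cexp z : (cexp z)^* = cexp z^*.
Proof. by case: z => a b; rewrite /cexp/= cosN sinN mulrN. Qed.

(** For x >= 0 this is 1 - x <= exp(-x) multiplied by exp x; for x < 0 the left-hand side is already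
    at most -x. *)
Lemma expR_sub1_le x : `|expR x - 1| <= `|x| * expR `|x|.
Proof.
have aux (y : R) : 0 <= y -> expR y - 1 <= y * expR y.
  move=> y0; have := expR_ge1Dx (- y).
  rewrite expRN => h; rewrite -subr_ge0.
  have ey : 0 < expR y := expR_gt0 y.
  have : expR y * (1 - y) <= expR y * (expR y)^-1 by rewrite ler_pM2l.
  by rewrite divff ?gt_eqF// => h2; lra.
have [x0|x0] := leP 0 x.
  rewrite ger0_norm ?subr_ge0 ?(ger0_norm x0) ?aux//.
  by rewrite -expR0 ler_expR.
rewrite ltr0_norm ?subr_lt0 -?expR0 ?ltr_expR// (ltr0_norm x0) opprB expR0.
have h1 := expR_ge1Dx x.
apply: (@le_trans _ _ (- x)); first by lra.
rewrite ler_peMr ?oppr_ge0 1?ltW// -expR0 ltr_expR; lra.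
Qed.


(** For x >= 0, exp x - 1 - x <= x (exp x - 1), to which the first-order bound applies. For x < 0,
    multiplication by 1 - x >= 1 and exp x (1 - x) <= 1 give the bound x^2. *)
Lemma expR_sub1D_le x : `|expR x - 1 - x| <= x ^+ 2 * expR `|x|.
Proof.
have e1 := expR_ge1Dx x.
rewrite ger0_norm; last by lra.
have [x0|x0] := leP 0 x.
  rewrite ger0_norm//; have := expR_sub1_le x.
  rewrite ger0_norm ?(ger0_norm x0); last by lra.
  move=> h; have e0 := expR_gt0 x.
  have h2 : x * (expR x - 1) <= x * (x * expR x) by rewrite ler_wpM2l.
  have := expR_ge1Dx (- x); rewrite expRN => h3.
  have h4 : expR x * (1 - x) <= 1.
    by rewrite -[leRHS](divff (lt0r_neq0 e0)) ler_pM2l.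
  by rewrite expr2 -mulrA; lra.
have := expR_ge1Dx (- x); rewrite expRN => h.
have xp : 0 < 1 - x by lra.
have e0 := expR_gt0 x.
have h2 : expR x * (1 - x) <= 1.
  by rewrite -[leRHS](divff (lt0r_neq0 e0)) ler_pM2l.
have h3 : (expR x - 1 - x) * (1 - x) <= x ^+ 2.
  by rewrite 2!mulrBl; lra.
have h4 : x ^+ 2 <= x ^+ 2 * expR `|x|.
  by rewrite ler_peMr ?sqr_ge0// -expR0 ler_expR.
apply: le_trans h4; apply: le_trans h3.
by rewrite ler_peMr; lra.
Qed.

Lemma mvt_bound (f df : R -> R) (K x : R) : (forall y, is_derive y 1 f (df y)) ->
  (forall y, `|y| <= `|x| -> `|df y| <= K) -> `|f x - f 0| <= `|x| * K.
Proof.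
move=> dfE dfK.
have cf (y z : R) : {within `[y, z], continuous f}.
  apply: continuous_subspaceT => u.
  by apply: differentiable_continuous; apply/derivable1_diffP; apply: ex_derive.
have [x0|x0] := leP 0 x.
  have [c] := MVT_segment x0 (fun y _ => dfE y) (cf _ _).
  rewrite in_itv/= => /andP[c0 cx] ->.
  rewrite subr0 normrM mulrC ler_wpM2l// dfK//.
  by rewrite !ger0_norm.
have [c] := MVT_segment (ltW x0) (fun y _ => dfE y) (cf _ _).
rewrite in_itv/= => /andP[c0 cx] e.
rewrite distrC e sub0r normrM mulrC normrN ler_wpM2l// dfK//.
by rewrite !ler0_norm ?lerN2// ltW.
Qed.

Lemma norm_sin_le x : `|sin x| <= `|x|.
Proof.
have := @mvt_bound sin cos 1 x (fun y => is_derive_sin y).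
by rewrite sin0 subr0 mulr1; apply=> y _; exact: cos_max.
Qed.

Lemma norm_cos_sub1_le x : `|cos x - 1| <= `|x|.
Proof.
have := @mvt_bound cos (fun y => - sin y) 1 x (fun y => is_derive_cos y).
by rewrite cos0 mulr1; apply=> y _; rewrite normrN sin_max.
Qed.

(** The mean value bound again, now with K = |x|, since the derivative is controlled by
    [norm_sin_le]. *)
Lemma norm_cos_sub1_le2 x : `|cos x - 1| <= `|x| ^+ 2.
Proof.
have := @mvt_bound cos (fun y => - sin y) `|x| x (fun y => is_derive_cos y).
rewrite cos0 -expr2; apply=> y yx; rewrite normrN.
exact: le_trans (norm_sin_le _) yx.
Qed.

Lemma norm_sin_sub_le2 x : `|sin x - x| <= `|x| ^+ 2.
Proof.
have := @mvt_bound (fun y => sin y - y) (fun y => cos y - 1) `|x| x.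
rewrite sin0 !subr0 -expr2; apply=> y yx; exact: le_trans (norm_cos_sub1_le _) yx.
Qed.

(** Real and imaginary parts each contribute two errors of size r^2 exp r, one from the
    trigonometric factor and one from the exponential factor; hence the constant 4. *)
Lemma normc_cexp_sub1D_le z :
  normc (cexp z - 1 - z) <= 4 * (normc z ^+ 2 * expR (normc z)).
Proof.
set r := normc z; have r0 : 0 <= r := normc_ge0 z.
have xr := ler_cRe_normc z; have yr := ler_cIm_normc z.
rewrite (le_trans (normc_le _))// !cReB !cImB /= -/r.
set x := cRe z in xr *; set y := cIm z in yr *.
have ex : expR x <= expR r by rewrite ler_expR (le_trans (ler_norm _)).
have eax : expR `|x| <= expR r by rewrite ler_expR.
have ex0 := expR_ge0 x; have ex1 := expR_ge0 `|x|.
have er : 0 <= expR r := expR_ge0 r.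
have y2 : `|y| ^+ 2 <= r ^+ 2 by rewrite lerXn2r ?nnegrE.
have x2 : x ^+ 2 <= r ^+ 2 by rewrite -[leLHS]real_normK ?num_real// lerXn2r ?nnegrE.
have A : `|expR x * cos y - 1 - x| <= r ^+ 2 * expR r + r ^+ 2 * expR r.
  rewrite (_ : _ - x = expR x * (cos y - 1) + (expR x - 1 - x)); last by ring.
  rewrite (le_trans (ler_normD _ _))// lerD//.
    rewrite normrM mulrC (ger0_norm ex0) ler_pM//.
    exact: le_trans (norm_cos_sub1_le2 _) y2.
  apply: le_trans (expR_sub1D_le x) _.
  by rewrite ler_pM// sqr_ge0.
have B : `|expR x * sin y - 0 - y| <= r ^+ 2 * expR r + r ^+ 2 * expR r.
  rewrite (_ : _ - y = expR x * (sin y - y) + y * (expR x - 1)); last by ring.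
  rewrite (le_trans (ler_normD _ _))// lerD//.
    rewrite normrM mulrC (ger0_norm ex0) ler_pM//.
    exact: le_trans (norm_sin_sub_le2 _) y2.
  rewrite normrM expr2 -mulrA ler_pM//.
  apply: le_trans (expR_sub1_le x) _.
  by rewrite ler_pM.
lra.
Qed.

(* First-order expansion at 0 with a quadratic remainder: it makes products and
   parameter integrals differentiable with explicit bounds, without topology on
   [R[i]]. *)
Definition ex2 (f : R -> R[i]) (a b : R[i]) := exists C : R, forall t : R,
  `|t| <= 1 -> normc (f t - a - t%:C * b) <= C * t ^+ 2.

Lemma ex2_lin a b : ex2 (fun t => a + t%:C * b) a b.
Proof.
exists 0 => t _.
by rewrite (_ : _ - _ = 0) ?Normc.normc0 ?mul0r//; ring.
Qed.

Lemma ex2_ext f g a b : f =1 g -> ex2 f a b -> ex2 g a b.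
Proof. by move=> fg; rewrite (funext fg). Qed.

Lemma ex2_val f a b : ex2 f a b -> f 0 = a.
Proof.
move=> [C /(_ 0)]; rewrite normr0 ler01 expr0n/= mulr0 mul0r subr0 => /(_ erefl).
move=> h; apply/eqP; rewrite -subr_eq0; apply/eqP.
by apply: Normc.eq0_normc; apply/eqP; rewrite eq_le h normc_ge0.
Qed.

(** The two expansions give |b - b'| <= (C + C') t for every t in ]0, 1]. This is the tool that
    equates a derivative taken under the integral sign with the derivative of a closed formula. *)
Lemma ex2_uniq f a b a' b' : ex2 f a b -> ex2 f a' b' -> b = b'.
Proof.
move=> h h'; have e := ex2_val h; rewrite (ex2_val h') in e; subst a'.
move: h h' => [C hC] [C' hC'].
apply/eqP; rewrite -subr_eq0; apply/eqP/Normc.eq0_normc/eqP.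
rewrite eq_le normc_ge0 andbT.
have key (t : R) : 0 < t -> t <= 1 -> normc (b - b') <= (C + C') * t.
  move=> t0 t1.
  have tn : `|t| <= 1 by rewrite gtr0_norm.
  have := lerD (hC _ tn) (hC' _ tn).
  rewrite -mulrDl => /(le_trans (normcB _ _)) h.
  have : normc (t%:C * (b - b')) <= (C + C') * t ^+ 2.
    rewrite -normc_opp; apply: le_trans h.
    rewrite le_eqVlt; apply/orP; left; apply/eqP; congr normc; ring.
  by rewrite Normc.normcM normc_real gtr0_norm// expr2 mulrA [leRHS]mulrC ler_pM2l.
rewrite leNgt; apply/negP => n0.
(* A positive replacement for C + C', so that t = n / (2 S) is admissible; at this t the bound would
   read n <= n / 2. *)
pose S := Num.max (C + C') 1.
have S0 : 0 < S by rewrite lt_max ltr01 orbT.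
pose n := normc (b - b').
have := key (Num.min 1 (n / (2 * S))).
rewrite lt_min ltr01/= divr_gt0 ?mulr_gt0// => /(_ isT).
rewrite ge_min lexx/= => /(_ isT); apply/negP; rewrite -ltNge.
apply: (@le_lt_trans _ _ (S * (n / (2 * S)))).
  apply: (@le_trans _ _ (S * Num.min 1 (n / (2 * S)))).
    by rewrite ler_wpM2r ?le_max ?lexx// le_min ler01/= divr_ge0 ?mulr_ge0 ?ltW.
  by rewrite ler_pM2l// ge_min lexx orbT.
rewrite (_ : S * _ = n / 2) ?/n; [lra|by field; rewrite gt_eqF].
Qed.

Lemma ex2M f g a b a' b' : ex2 f a b -> ex2 g a' b' ->
  ex2 (fun t => f t * g t) (a * a') (a * b' + b * a').
Proof.
move=> [C hC] [C' hC'].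
exists (C * (normc a' + normc b' + C') + (normc a + normc b) * C' + normc b * normc b').
move=> t t1.
have C0 : 0 <= C.
  have := hC 1; rewrite normr1 lexx expr1n mulr1 => /(_ isT).
  exact: le_trans (normc_ge0 _).
have C'0 : 0 <= C'.
  have := hC' 1; rewrite normr1 lexx expr1n mulr1 => /(_ isT).
  exact: le_trans (normc_ge0 _).
have t2 : t ^+ 2 <= 1 by rewrite -[leLHS]ger0_norm ?sqr_ge0// normrX exprn_ile1.
set u := f t - a - t%:C * b; set v := g t - a' - t%:C * b'.
have hu : normc u <= C * t ^+ 2 := hC _ t1.
have hv : normc v <= C' * t ^+ 2 := hC' _ t1.
(* All terms of order two or more, grouped so that each carries a remainder u or v or the factor
   t^2; the constant of the statement is the sum of the three bounds, with t^2 <= 1 absorbing the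
   remainder left inside the first factor. *)
rewrite (_ : _ - _ = u * (a' + t%:C * b' + v) + (a + t%:C * b) * v
  + t%:C ^+ 2 * (b * b')); last by rewrite /u /v; ring.
have lin (c e : R[i]) : normc (c + t%:C * e) <= normc c + normc e.
  rewrite (le_trans (normcD _ _))// lerD2l Normc.normcM normc_real.
  by rewrite ler_piMl ?normc_ge0.
rewrite (le_trans (normcD _ _))// [leRHS]mulrDl lerD//; last first.
  rewrite !Normc.normcM normc_real -expr2 real_normK ?num_real// mulrC//.
rewrite (le_trans (normcD _ _))// [leRHS]mulrDl lerD//.
  rewrite Normc.normcM [leRHS]mulrAC ler_pM ?normc_ge0//.
  rewrite (le_trans (normcD _ _))// lerD//.
  by rewrite (le_trans hv)// ler_piMr.
by rewrite Normc.normcM -[leRHS]mulrA ler_pM ?normc_ge0.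
Qed.

Lemma ex2_cst a : ex2 (fun=> a) a 0.
Proof. by have := ex2_lin a 0; apply: ex2_ext => t; rewrite mulr0 addr0. Qed.

Lemma ex2Ml c f a b : ex2 f a b -> ex2 (fun t => c * f t) (c * a) (c * b).
Proof. by move=> /(ex2M (ex2_cst c)); rewrite mul0r addr0. Qed.

Lemma ex2X n f a b : ex2 f a b ->
  ex2 (fun t => f t ^+ n) (a ^+ n) (n%:R * a ^+ n.-1 * b).
Proof.
move=> h; elim: n => [|n IH].
  by rewrite mul0r mul0r; apply: ex2_cst.
have := ex2M h IH; rewrite -exprS [X in ex2 _ _ X](_ : _ = n.+1%:R * a ^+ n * b).
  by apply: ex2_ext => t; rewrite exprS.
case: n {IH} => [|n]; first by rewrite !expr0; ring.
by rewrite /= -[n.+2]addn1 natrD exprS; ring.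
Qed.

Lemma ex2_prod (I : finType) (f : I -> R -> R[i]) (a b : I -> R[i]) :
  (forall i, ex2 (f i) (a i) (b i)) ->
  ex2 (fun t => \prod_i f i t) (\prod_i a i)
    (\sum_i b i * \prod_(j | j != i) a j).
Proof.
move=> h.
(* Without repetition in the list, the condition j != i removes exactly the factor that is
   differentiated. *)
have gen (s : seq I) : uniq s -> ex2 (fun t => \prod_(i <- s) f i t) (\prod_(i <- s) a i)
    (\sum_(i <- s) b i * \prod_(j <- s | j != i) a j).
  elim: s => [|i s IH]; first by rewrite !big_nil => _; apply: ex2_ext (ex2_cst _) => t; rewrite big_nil.
  rewrite /= => /andP[iNs us]; have := ex2M (h i) (IH us).
  rewrite !big_cons eqxx/=.
  set B := (X in ex2 _ _ X -> _); set B' := (X in _ -> ex2 _ _ X).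
  suff -> : B = B' by apply: ex2_ext => t; rewrite big_cons.
  rewrite /B /B' addrC; congr (_ + _).
    congr (_ * _); rewrite [in RHS]big_seq_cond [LHS]big_seq; apply: eq_bigl => j.
    by case: (eqVneq j i) => [->|]; rewrite ?andbT// (negbTE iNs).
  rewrite mulr_sumr big_seq [RHS]big_seq; apply: eq_bigr => j js.
  rewrite big_cons; case: eqP => [e|_]/=; first by rewrite e js in iNs.
  by rewrite mulrCA.
by apply: gen; rewrite index_enum_uniq.
Qed.

(** A quadratic term in the exponent does not affect the first order. It is allowed because shifting
    the parameter of a Gaussian transform by t produces exactly an exponent linear plus quadratic in
    t. *)
Lemma ex2_cexp z w : ex2 (fun t => cexp (t%:C * z + t%:C ^+ 2 * w)) 1 z.
Proof.
exists (4 * ((normc z + normc w) ^+ 2 * expR (normc z + normc w)) + normc w).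
move=> t t1.
set u := t%:C * z + t%:C ^+ 2 * w.
have un : normc u <= `|t| * (normc z + normc w).
  rewrite (le_trans (normcD _ _))// !Normc.normcM normc_real -expr2 mulrDr.
  by rewrite lerD2l ler_wpM2r ?normc_ge0// expr2 ler_piMl.
have s0 : 0 <= normc z + normc w by rewrite addr_ge0 ?normc_ge0.
rewrite (_ : _ - _ = (cexp u - 1 - u) + t%:C ^+ 2 * w); last by rewrite /u; ring.
rewrite (le_trans (normcD _ _))// mulrDl lerD//; last first.
  by rewrite !Normc.normcM normc_real -expr2 real_normK ?num_real// mulrC.
apply: le_trans (normc_cexp_sub1D_le u) _.
rewrite -[leRHS]mulrA ler_wpM2l// [leRHS]mulrAC ler_pM ?expR_ge0 ?sqr_ge0//.
  rewrite -[t ^+ 2]real_normK ?num_real// -exprMn lerXn2r ?nnegrE ?normc_ge0//.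
    by rewrite mulr_ge0.
  by rewrite mulrC.
by rewrite ler_expR (le_trans un)// ler_piMl.
Qed.

End complex_basics.

Section complex_measurable.
Context {R : realType} {d : measure_display} {T : measurableType d}.
Implicit Types (f g : T -> R[i]).

(** The sigma-algebra of [R[i]] is generated by preimages under the two coordinates, and generation
    commutes with pulling back along f. *)
Lemma measurable_complexP f : measurable_fun setT f <->
  measurable_fun setT (cRe \o f) /\ measurable_fun setT (cIm \o f).
Proof.
apply: (@iff_trans _ (g_sigma_preimageU (cRe \o f) (cIm \o f) `<=` measurable)).
- rewrite g_sigma_preimageU_comp; split=> [mf A [C HC <-]|f12]; first exact: mf.
  by move=> _ A mA; apply: f12; exists A.
- split => [h12|[mf1 mf2]].
    split => _ A mA; apply: h12; apply: sub_sigma_algebra;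
    by [left; exists A|right; exists A].
  apply: smallest_sub; first exact: sigma_algebra_measurable.
  by rewrite subUset; split=> [|] A [C mC <-]; [exact: mf1|exact: mf2].
Qed.

Lemma measurable_cRe f : measurable_fun setT f ->
  measurable_fun setT (fun x => cRe (f x)).
Proof. by move=> /measurable_complexP[]. Qed.

Lemma measurable_cIm f : measurable_fun setT f ->
  measurable_fun setT (fun x => cIm (f x)).
Proof. by move=> /measurable_complexP[]. Qed.

Lemma measurable_cD f g : measurable_fun setT f -> measurable_fun setT g ->
  measurable_fun setT (fun x => f x + g x).
Proof.
move=> mf mg; apply/measurable_complexP; split.
  apply: (eq_measurable_fun (fun x => cRe (f x) + cRe (g x))).
    by move=> x _; rewrite /= cReD.
  by apply: measurable_funD; exact: measurable_cRe.
apply: (eq_measurable_fun (fun x => cIm (f x) + cIm (g x))).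
  by move=> x _; rewrite /= cImD.
by apply: measurable_funD; exact: measurable_cIm.
Qed.

Lemma measurable_cM f g : measurable_fun setT f -> measurable_fun setT g ->
  measurable_fun setT (fun x => f x * g x).
Proof.
move=> mf mg; apply/measurable_complexP; split.
  apply: (eq_measurable_fun
    (fun x => cRe (f x) * cRe (g x) - cIm (f x) * cIm (g x))).
    by move=> x _; rewrite /= cReM.
  by apply: measurable_funB; apply: measurable_funM;
    solve [exact: measurable_cRe|exact: measurable_cIm].
apply: (eq_measurable_fun
  (fun x => cRe (f x) * cIm (g x) + cIm (f x) * cRe (g x))).
  by move=> x _; rewrite /= cImM.
by apply: measurable_funD; apply: measurable_funM;
  solve [exact: measurable_cRe|exact: measurable_cIm].
Qed.

Lemma measurable_cX n f : measurable_fun setT f ->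
  measurable_fun setT (fun x => f x ^+ n).
Proof.
move=> mf; elim: n => [|n IH]; first exact: measurable_cst.
by under eq_fun do rewrite exprS; exact: measurable_cM.
Qed.

Lemma measurable_csum I (s : seq I) (P : pred I) (F : I -> T -> R[i]) :
  (forall i, measurable_fun setT (F i)) ->
  measurable_fun setT (fun x => \sum_(i <- s | P i) F i x).
Proof.
move=> mF; elim: s => [|i s IH].
  by under eq_fun do rewrite big_nil; exact: measurable_cst.
under eq_fun do rewrite big_cons.
by case: (P i) => //; exact: measurable_cD.
Qed.

Lemma measurable_cprod I (s : seq I) (P : pred I) (F : I -> T -> R[i]) :
  (forall i, measurable_fun setT (F i)) ->
  measurable_fun setT (fun x => \prod_(i <- s | P i) F i x).
Proof.
move=> mF; elim: s => [|i s IH].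
  by under eq_fun do rewrite big_nil; exact: measurable_cst.
under eq_fun do rewrite big_cons.
by case: (P i) => //; exact: measurable_cM.
Qed.

Lemma measurable_realC (h : T -> R) : measurable_fun setT h ->
  measurable_fun setT (fun x => (h x)%:C).
Proof.
by move=> mh; apply/measurable_complexP; split => //=; exact: measurable_cst.
Qed.

Lemma measurable_imag (h : T -> R) : measurable_fun setT h ->
  measurable_fun setT (fun x => (h x)*i).
Proof.
by move=> mh; apply/measurable_complexP; split => //=; exact: measurable_cst.
Qed.

Lemma measurable_cexp f : measurable_fun setT f ->
  measurable_fun setT (fun x => cexp (f x)).
Proof.
move=> mf; have mRe := measurable_cRe mf; have mIm := measurable_cIm mf.
apply/measurable_complexP; split; apply: measurable_funM => /=;
  solve [exact: measurableT_comp
    |by apply: measurableT_comp => //; apply: continuous_measurable_fun;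
       [exact: continuous_cos|exact: continuous_sin]
    |by apply: measurableT_comp => //; apply: continuous_measurable_fun;
       exact: continuous_sin|by apply: measurableT_comp => //; apply: continuous_measurable_fun;
       exact: continuous_cos].
Qed.

Lemma measurable_normc f : measurable_fun setT f ->
  measurable_fun setT (fun x => normc (f x)).
Proof.
move=> mf; apply: (eq_measurable_fun
    (fun x => Num.sqrt (cRe (f x) ^+ 2 + cIm (f x) ^+ 2))).
  by move=> x _; case: (f x).
apply: (measurableT_comp (continuous_measurable_fun (@sqrt_continuous R))).
by apply: measurable_funD; apply: measurable_funX;
  [exact: measurable_cRe|exact: measurable_cIm].
Qed.

End complex_measurable.

(** * Linearity, domination and differentiation of complex integrals *)

Section cintegral_theory.
Context {R : realType} {d : measure_display} {T : measurableType d}.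
Variable mu : {measure set T -> \bar R}.
Implicit Types (f g : T -> R[i]) (h : T -> R).

Lemma cintegrable_le f h : measurable_fun setT f ->
  mu.-integrable setT (EFin \o h) ->
  (forall x, normc (f x) <= h x) -> cintegrable mu f.
Proof.
move=> mf ih fh; split; apply: le_integrable ih => //=.
- by apply/measurable_EFinP; exact: measurable_cRe.
- move=> x _; rewrite lee_fin (le_trans (ler_cRe_normc _))//.
  exact: le_trans (fh x) (ler_norm _).
- by apply/measurable_EFinP; exact: measurable_cIm.
- move=> x _; rewrite lee_fin (le_trans (ler_cIm_normc _))//.
  exact: le_trans (fh x) (ler_norm _).
Qed.

Lemma cintegrable_measurable f : cintegrable mu f -> measurable_fun setT f.
Proof.
case=> iR iI; apply/measurable_complexP; split.
  exact/measurable_EFinP/(measurable_int _ iR).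
exact/measurable_EFinP/(measurable_int _ iI).
Qed.

Lemma cintegrable_normc f : cintegrable mu f ->
  mu.-integrable setT (fun x => (normc (f x))%:E).
Proof.
move=> icf; have mf := cintegrable_measurable icf; case: icf => iR iI.
apply: (@le_integrable _ _ _ mu setT measurableT _
  (fun x => (`|cRe (f x)| + `|cIm (f x)|)%:E)).
- by apply/measurable_EFinP; exact: measurable_normc.
- move=> x _; rewrite /= lee_fin ger0_norm ?normc_ge0//.
  by rewrite ger0_norm ?addr_ge0// normc_le.
- under eq_fun do rewrite EFinD; apply: integrableD => //.
    exact: (integrable_norm iR).
  exact: (integrable_norm iI).
Qed.

Lemma eq_cintegrable f g : f =1 g -> cintegrable mu f -> cintegrable mu g.
Proof. by move=> fg; rewrite (funext fg). Qed.

Lemma eq_cintegral f g : f =1 g -> cintegral mu f = cintegral mu g.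
Proof. by move=> fg; rewrite (funext fg). Qed.

Lemma cintegrableD f g : cintegrable mu f -> cintegrable mu g ->
  cintegrable mu (fun x => f x + g x).
Proof.
move=> [fR fI] [gR gI]; split.
  by under eq_fun do rewrite cReD EFinD; exact: integrableD.
by under eq_fun do rewrite cImD EFinD; exact: integrableD.
Qed.

Lemma cintegrableZl c f : cintegrable mu f -> cintegrable mu (fun x => c * f x).
Proof.
move=> [fR fI]; split.
  under eq_fun do rewrite cReM EFinB !EFinM.
  by apply: integrableB => //; exact: integrableZl.
under eq_fun do rewrite cImM EFinD !EFinM.
by apply: integrableD => //; exact: integrableZl.
Qed.

Lemma cintegralD f g : cintegrable mu f -> cintegrable mu g ->
  cintegral mu (fun x => f x + g x) = cintegral mu f + cintegral mu g.
Proof.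
move=> [fR fI] [gR gI]; apply: complex_ext; rewrite ?cReD ?cImD /=.
  rewrite -RintegralD//; apply: eq_Rintegral => x _; exact: cReD.
rewrite -RintegralD//; apply: eq_Rintegral => x _; exact: cImD.
Qed.

Lemma cintegralZl c f : cintegrable mu f ->
  cintegral mu (fun x => c * f x) = c * cintegral mu f.
Proof.
move=> [fR fI]; apply: complex_ext; rewrite ?cReM ?cImM /=.
  rewrite -!RintegralZl// -RintegralB//; first last.
    exact: (@integrableZl _ _ _ mu setT measurableT (cIm c) _ fI).
    exact: (@integrableZl _ _ _ mu setT measurableT (cRe c) _ fR).
  by apply: eq_Rintegral => x _; exact: cReM.
rewrite -!RintegralZl// -RintegralD//; first last.
  exact: (@integrableZl _ _ _ mu setT measurableT (cIm c) _ fR).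
  exact: (@integrableZl _ _ _ mu setT measurableT (cRe c) _ fI).
by apply: eq_Rintegral => x _; exact: cImM.
Qed.

Lemma cintegrableB f g : cintegrable mu f -> cintegrable mu g ->
  cintegrable mu (fun x => f x - g x).
Proof.
move=> fi gi; under eq_fun do rewrite -mulN1r.
by apply: cintegrableD => //; exact: cintegrableZl.
Qed.

Lemma cintegralB f g : cintegrable mu f -> cintegrable mu g ->
  cintegral mu (fun x => f x - g x) = cintegral mu f - cintegral mu g.
Proof.
move=> fi gi; rewrite -mulN1r -cintegralZl// -cintegralD//.
  by apply: eq_cintegral => x; rewrite mulN1r.
exact: cintegrableZl.
Qed.

Lemma cintegrable_cst0 : cintegrable mu (fun=> 0).
Proof. by split => /=; exact: integrable0. Qed.

Lemma cintegral_cst0 : cintegral mu (fun=> 0) = 0 :> R[i].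
Proof.
by apply: complex_ext; rewrite /= /Rintegral integral0.
Qed.

Lemma cintegrable_sum I (s : seq I) (F : I -> T -> R[i]) :
  (forall i, cintegrable mu (F i)) ->
  cintegrable mu (fun x => \sum_(i <- s) F i x).
Proof.
move=> iF; elim: s => [|i s IH].
  by under eq_fun do rewrite big_nil; exact: cintegrable_cst0.
by under eq_fun do rewrite big_cons; exact: cintegrableD.
Qed.

Lemma cintegral_sum I (s : seq I) (F : I -> T -> R[i]) :
  (forall i, cintegrable mu (F i)) ->
  cintegral mu (fun x => \sum_(i <- s) F i x) = \sum_(i <- s) cintegral mu (F i).
Proof.
move=> iF; elim: s => [|i s IH].
  by under eq_cintegral do rewrite big_nil; rewrite big_nil cintegral_cst0.
under eq_cintegral do rewrite big_cons.
by rewrite cintegralD// ?IH ?big_cons//; exact: cintegrable_sum.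
Qed.

(** The factor 2 comes from bounding real and imaginary parts separately. *)
Lemma normc_cintegral_le f h : measurable_fun setT f ->
  mu.-integrable setT (EFin \o h) ->
  (forall x, normc (f x) <= h x) ->
  normc (cintegral mu f) <= 2 * \int[mu]_x h x.
Proof.
move=> mf ih fh; have [iR iI] := cintegrable_le mf ih fh.
rewrite (le_trans (normc_le _))//= mulr_natl mulr2n lerD//.
  rewrite (le_trans (le_normr_Rintegral _ iR))//; apply: le_Rintegral => //.
    exact: (integrable_norm iR).
  by move=> x _; exact: le_trans (ler_cRe_normc _) (fh x).
rewrite (le_trans (le_normr_Rintegral _ iI))//; apply: le_Rintegral => //.
  exact: (integrable_norm iI).
by move=> x _; exact: le_trans (ler_cIm_normc _) (fh x).
Qed.

(** Differentiation under the integral sign. The integrand of the remainder is at most 4 t^2 |f|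
    |A|^2 exp |A|, and |A| <= exp |A| turns this into 4 t^2 |f| exp (3 |A|); this is the origin of
    the 3 in the domination hypothesis. *)
Lemma ex2_cintegral (f A : T -> R[i]) h : measurable_fun setT f ->
  measurable_fun setT A -> mu.-integrable setT (EFin \o h) ->
  (forall x, normc (f x) * expR (3 * normc (A x)) <= h x) ->
  ex2 (fun t => cintegral mu (fun x => f x * cexp (t%:C * A x)))
    (cintegral mu f) (cintegral mu (fun x => f x * A x)).
Proof.
move=> mf mA ih fh.
have eA x : 0 <= normc (A x) := normc_ge0 _.
have fle x : normc (f x) <= h x.
  apply: le_trans (fh x); rewrite ler_peMr ?normc_ge0// -expR0 ler_expR.
  by rewrite mulr_ge0.
have Ale x : normc (A x) <= expR (normc (A x)).
  by have := expR_ge1Dx (normc (A x)); lra.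
have e3 x : expR (3 * normc (A x)) = expR (normc (A x)) ^+ 2 * expR (normc (A x)).
  by rewrite expr2 -!expRD; congr expR; ring.
have e1 x : 1 <= expR (normc (A x)) by rewrite -expR0 ler_expR.
have e0 x := expR_ge0 (normc (A x)).
have fA x : normc (f x * A x) <= h x.
  apply: le_trans (fh x); rewrite Normc.normcM ler_wpM2l ?normc_ge0//.
  by rewrite e3 (le_trans (Ale x))// ler_peMl// exprn_ege1.
have fe t x : `|t| <= 1 -> normc (f x * cexp (t%:C * A x)) <= h x.
  move=> t1; apply: le_trans (fh x); rewrite Normc.normcM ler_wpM2l ?normc_ge0//.
  rewrite normc_cexp ler_expR cReMr (le_trans (ler_norm _))// normrM.
  apply: le_trans (_ : normc (A x) <= _); last by have := eA x; lra.
  apply: le_trans (_ : 1 * normc (A x) <= _); last by rewrite mul1r.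
  by rewrite ler_pM// ler_cRe_normc.
have mfA : measurable_fun setT (fun x => f x * A x) by exact: measurable_cM.
have mt (t : R) : measurable_fun setT (fun x => t%:C * A x).
  by apply: measurable_cM => //; exact: measurable_cst.
have mfe t : measurable_fun setT (fun x => f x * cexp (t%:C * A x)).
  by apply: measurable_cM => //; apply: measurable_cexp.
have if0 := cintegrable_le mf ih fle.
have ifA := cintegrable_le mfA ih fA.
exists (2 * (4 * \int[mu]_x h x)) => t t1.
have ift := cintegrable_le (mfe t) ih (fun x => fe t x t1).
have -> : cintegral mu (fun x => f x * cexp (t%:C * A x)) - cintegral mu f -
    t%:C * cintegral mu (fun x => f x * A x) =
    cintegral mu (fun x => f x * (cexp (t%:C * A x) - 1 - t%:C * A x)).
  rewrite -cintegralZl// -!cintegralB//; first last.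
  - exact: cintegrableZl.
  - exact: cintegrableB.
  by apply: eq_cintegral => x; ring.
have ih' : mu.-integrable setT (EFin \o (fun x => (4 * t ^+ 2) * h x)).
  exact: (@integrableZl _ _ _ mu setT measurableT (4 * t ^+ 2) _ ih).
rewrite (le_trans (normc_cintegral_le _ ih' _))//.
- apply: measurable_cM => //; apply: measurable_cD.
    apply: measurable_cD; first exact: measurable_cexp.
    exact: measurable_cst.
  by under eq_fun do rewrite -mulNr -rmorphN; exact: mt.
- move=> x; rewrite Normc.normcM.
  apply: le_trans (ler_wpM2l (normc_ge0 _) (normc_cexp_sub1D_le _)) _.
  rewrite mulrCA -mulrA ler_wpM2l//.
  apply: (@le_trans _ _ (t ^+ 2 * (normc (f x) * expR (3 * normc (A x))))); last first.
    by rewrite ler_wpM2l ?sqr_ge0// fh.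
  rewrite [leRHS]mulrCA ler_wpM2l ?normc_ge0// Normc.normcM normc_real exprMn.
  rewrite real_normK ?num_real// -mulrA ler_wpM2l ?sqr_ge0// e3 ler_pM//.
  - by rewrite sqr_ge0.
  - by rewrite lerXn2r ?nnegrE// (le_trans (eA x)).
  - by rewrite ler_expR ler_piMl.
- by rewrite RintegralZl// le_eqVlt; apply/orP; left; apply/eqP; ring.
Qed.

End cintegral_theory.

(** * Gaussian integrals with complex parameters *)

Section lebesgue_affine.
Context {R : realType}.
Local Notation leb := (@lebesgue_measure R).

Let affine (c a : R) : measurableTypeR R -> measurableTypeR R := fun x => c * x + a.

Let measurable_affine c a : measurable_fun setT (affine c a).
Proof. by apply: measurable_funD => //; apply: measurable_funM. Qed.

Let preimage_affine_itv (c a u v : R) : 0 < c ->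
  affine c a @^-1` `]u, v] = `]((u - a) / c), ((v - a) / c)]%classic.
Proof.
move=> c0; apply/seteqP; split => x; rewrite /affine/= !in_itv/=.
  by rewrite ltr_pdivrMr// ler_pdivlMr// ltrBlDr lerBrDr [x * c]mulrC.
by rewrite ltr_pdivrMr// ler_pdivlMr// ltrBlDr lerBrDr [x * c]mulrC.
Qed.

(** By uniqueness of Lebesgue measure it suffices to compare lengths of the intervals ]u, v]. *)
Lemma lebesgue_measure_affine (c a : R) (A : set (measurableTypeR R)) :
  0 < c -> measurable A -> (c%:E * leb (affine c a @^-1` A))%E = leb A.
Proof.
move=> c0 mA; pose k := NngNum (ltW c0).
have := @lebesgue_measure_unique R (mscale k (pushforward leb (affine c a))).
move=> H; have {}H := H (measurable_affine c a) _ A mA.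
apply/esym; etransitivity; last by []; apply: H => _ [[u v]] _ <-.
change (leb `]u, v] = c%:E * leb (affine c a @^-1` `]u, v]))%E.
rewrite (preimage_affine_itv a u v c0).
rewrite !lebesgue_measure_itv/= !lte_fin.
rewrite ltr_pM2r ?invr_gt0// ltrBlDr subrK.
case: ifPn => [_|_]; last by rewrite mule0.
by rewrite -!EFinD -EFinM; congr EFin; field; rewrite gt_eqF.
Qed.

Lemma ge0_integral_affine (c a : R) (f : R -> \bar R) : 0 < c ->
  measurable_fun setT f -> (forall x, 0 <= f x)%E ->
  (c%:E * \int[leb]_x f (c * (x : R) + a)%R = \int[leb]_x f x)%E.
Proof.
move=> c0 mf f0; pose k := NngNum (ltW c0).
have maff := measurable_affine c a.
have e := @ge0_integral_pushforward _ _ _ _ R (affine c a) maff leb setT f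
  measurableT mf (fun y _ => f0 y).
transitivity (c%:E * \int[leb]_(x in affine c a @^-1` setT) (f \o affine c a) x)%E.
  by rewrite preimage_setT.
rewrite -e -(ge0_integral_mscale _ measurableT k)//.
apply: eq_measure_integral => A mA _.
by rewrite /mscale/= /pushforward; exact: lebesgue_measure_affine.
Qed.

Lemma integral_shift (a : R) (f : R -> \bar R) :
  measurable_fun setT f -> (\int[leb]_x f ((x : R) + a)%R = \int[leb]_x f x)%E.
Proof.
move=> mf.
have aux (g : R -> \bar R) : measurable_fun setT g -> (forall x, 0 <= g x)%E ->
    (\int[leb]_x g ((x : R) + a)%R = \int[leb]_x g x)%E.
  move=> mg g0; rewrite -(@ge0_integral_affine 1 a g)// mul1e.
  by apply: eq_integral => x _; rewrite mul1r.
rewrite integralE [RHS]integralE; congr (_ - _)%E.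
  transitivity (\int[leb]_x (f^\+ ((x : R) + a)%R))%E.
    by apply: eq_integral => x _; rewrite ?funeposE ?funenegE.
  by apply: aux => //; exact: measurable_funepos.
transitivity (\int[leb]_x (f^\- ((x : R) + a)%R))%E.
    by apply: eq_integral => x _; rewrite ?funeposE ?funenegE.
by apply: aux => //; exact: measurable_funeneg.
Qed.

Lemma cintegral_shift (a : R) (f : R -> R[i]) : measurable_fun setT f ->
  cintegral leb (fun x => f (x + a)) = cintegral leb f.
Proof.
move=> mf; apply: complex_ext => /=; congr fine.
  rewrite -(@integral_shift a (fun x => (cRe (f x))%:E))//.
  exact/measurable_EFinP/measurable_cRe.
rewrite -(@integral_shift a (fun x => (cIm (f x))%:E))//.
exact/measurable_EFinP/measurable_cIm.
Qed.

End lebesgue_affine.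

(** Passage from the quadratic bounds of [ex2] to a genuine real derivative, needed to conclude that
    a function with vanishing derivative is constant. *)
Lemma is_derive0_sqr (R : realType) (f : R -> R) (v C : R) :
  (forall t, `|t| <= 1 -> `|f (v + t) - f v| <= C * t ^+ 2) ->
  is_derive v (1 : R) f 0.
Proof.
move=> H.
have L : h^-1 *: (f (h *: (1 : R) + v) - f v) @[h --> 0^'] --> (0 : R).
  apply/cvgrPdist_le => e e0; near=> h.
  have h0 : h != 0 by near: h; exact: nbhs_dnbhs_neq.
  have h1 : `|h| <= 1.
    by near: h; exact: dnbhs0_le.
  have h2 : `|h| <= e / (`|C| + 1).
    near: h; apply: dnbhs0_le.
    by rewrite divr_gt0// ltr_pwDr.
  rewrite sub0r normrN /GRing.scale/= mulr1 normrM normfV [h + v]addrC.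
  have hp : 0 < `|h| by rewrite normr_gt0.
  rewrite ler_pdivrMl//; apply: (le_trans (H _ h1)).
  rewrite -[h ^+ 2]real_normK ?num_real// expr2 mulrCA ler_pM2l//.
  rewrite ler_pdivlMr ?ltr_pwDr// in h2.
  rewrite mulrC; apply: le_trans h2.
  by rewrite ler_wpM2l// (le_trans (ler_norm _))// lerDl.
apply: DeriveDef; first by apply/cvg_ex; exists 0.
exact: cvg_lim.
Unshelve. all: by end_near.
Qed.

Section gauss1.
Context {R : realType}.
Local Notation leb := (@lebesgue_measure R).

Definition gaussF (a : R) (s : R[i]) (x : R) : R[i] :=
  cexp (s * x%:C - (a / 2 * x ^+ 2)%:C).

Lemma measurable_gaussF a s : measurable_fun setT (gaussF a s).
Proof.
apply: measurable_cexp; apply: measurable_cD.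
  apply: measurable_cM; first exact: measurable_cst.
  exact: measurable_realC.
under eq_fun do rewrite -rmorphN.
apply: measurable_realC; apply: measurable_funN.
by apply: measurable_funM => //; apply: measurable_funX.
Qed.

Lemma integrable_gauss (a C : R) : 0 < a ->
  leb.-integrable setT (fun x => (expR (C * `|x| - a / 2 * x ^+ 2))%:E).
Proof.
move=> a0.
(* Half of the quadratic decay absorbs the linear term: the bound K - a x^2 / 4 exceeds C |x| - a
   x^2 / 2 by the square a (|x| / 2 - C / a)^2. *)
pose K := C ^+ 2 / a.
have i0 : leb.-integrable setT (fun x => (expR K * (expR (- (a / 4) * x ^+ 2)))%:E).
  under eq_fun do rewrite EFinM; apply: integrableZl => //.
  (* The standard deviation for which the normal density is proportional to exp (- a x^2 / 4). *)
  pose s := Num.sqrt (2 / a).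
  have s0 : 0 < s by rewrite sqrtr_gt0 divr_gt0.
  have := integrable_normal_pdf 0 s.
  rewrite normal_pdfE ?gt_eqF// => /(integrableZl measurableT (normal_peak s)^-1).
  apply: eq_integrable => // x _.
  rewrite -EFinM mulrA mulVf ?gt_eqF ?normal_peak_gt0 ?gt_eqF// mul1r.
  congr (expR _)%:E; rewrite subr0 sqr_sqrtr ?divr_ge0// ?ltW//.
  by field; rewrite gt_eqF.
apply: le_integrable i0 => //.
  apply/measurable_EFinP; apply: measurableT_comp => //.
  apply: measurable_funB; first by apply: measurable_funM => //; apply: measurableT_comp.
  by apply: measurable_funM => //; apply: measurable_funX.
move=> x _; rewrite /= lee_fin ger0_norm ?expR_ge0// [leRHS]ger0_norm ?mulr_ge0 ?expR_ge0//.
rewrite -expRD ler_expR /K.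
rewrite -subr_ge0 (_ : _ - _ = a * (`|x| / 2 - C / a) ^+ 2).
  by rewrite mulr_ge0 ?sqr_ge0// ltW.
by rewrite -[x ^+ 2]real_normK ?num_real//; field; rewrite gt_eqF.
Qed.

Lemma normc_gaussF_le a s x : normc (gaussF a s x) <= expR (normc s * `|x| - a / 2 * x ^+ 2).
Proof.
rewrite normc_cexp ler_expR cReB/= lerD2r cReM/= mulr0 subr0.
by rewrite (le_trans (ler_norm _))// normrM ler_wpM2r// ler_cRe_normc.
Qed.

Lemma cintegrable_gaussF a s : 0 < a -> cintegrable leb (gaussF a s).
Proof.
move=> a0; apply: cintegrable_le (integrable_gauss (normc s) a0) _.
  exact: measurable_gaussF.
exact: normc_gaussF_le.
Qed.

Lemma cintegral_gauss0 a : 0 < a ->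
  cintegral leb (gaussF a 0) = (Num.sqrt (2 * pi / a))%:C.
Proof.
move=> a0; pose s := Num.sqrt a^-1.
have s0 : 0 < s by rewrite sqrtr_gt0 invr_gt0.
apply: complex_ext => /=; last first.
  rewrite /Rintegral (eq_integral (fun=> 0)) ?integral0// => x _.
  by rewrite /= !mul0r addr0 subr0 sin0 mulr0.
rewrite /Rintegral.
have := integral_normal_pdf 0 s; rewrite normal_pdfE ?gt_eqF// => h.
have -> : (\int[leb]_x (cRe (gaussF a 0 x))%:E = (normal_peak s)^-1%:E)%E.
  transitivity ((normal_peak s)^-1%:E * \int[leb]_x (normal_peak s * normal_fun 0 s x)%:E)%E; last by rewrite h mule1.
  rewrite -integralZl//; last first.
    by have := integrable_normal_pdf 0 s; rewrite normal_pdfE ?gt_eqF.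
  apply: eq_integral => x _.
  rewrite -EFinM mulrA mulVf ?gt_eqF ?normal_peak_gt0 ?gt_eqF// mul1r; congr EFin.
  rewrite /gaussF /= !mul0r addr0 !subr0 cos0 mulr1 sub0r /normal_fun.
  congr expR; rewrite subr0 sqr_sqrtr ?invr_ge0// ?ltW//.
  by field; rewrite gt_eqF.
rewrite /= /normal_peak invrK sqr_sqrtr ?invr_ge0 ?ltW//.
by congr Num.sqrt; field; rewrite gt_eqF.
Qed.

(** Completing the square is a translation by h / a, legitimate because h is real; imaginary shifts
    are handled by differentiation in [cintegral_gauss]. *)
Lemma cintegral_gauss_shift a s (h : R) : 0 < a ->
  cintegral leb (gaussF a (s + h%:C)) =
  cexp (s * (h / a)%:C + (h ^+ 2 / (2 * a))%:C) * cintegral leb (gaussF a s).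
Proof.
move=> a0.
rewrite -(@cintegral_shift _ (h / a)); last exact: measurable_gaussF.
rewrite -cintegralZl; last exact: cintegrable_gaussF.
apply: eq_cintegral => x; rewrite /gaussF -cexpD; congr cexp.
case: s => u v; apply: complex_ext; rewrite /= ; field; rewrite gt_eqF//.
Qed.

(** No contour integral is involved. The derivative of F in a direction z is z times [F1]; real
    translations determine [F1], hence the derivative in the imaginary direction as well, and a
    second use of real translations reduces everything to the value at 0. *)
Lemma cintegral_gauss a s : 0 < a ->
  cintegral leb (gaussF a s) =
  (Num.sqrt (2 * pi / a))%:C * cexp (s ^+ 2 * (2 * a)^-1%:C).
Proof.
move=> a0; move: s.
pose F (z : R[i]) := cintegral leb (gaussF a z).
pose F1 (z : R[i]) := cintegral leb (fun x : R => gaussF a z x * x%:C).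
have ex2F (s z : R[i]) : ex2 (fun t => F (s + t%:C * z)) (F s) (z * F1 s).
  have := @ex2_cintegral R _ _ leb (gaussF a s) (fun x => z * x%:C) _
    (measurable_gaussF a s) _ (integrable_gauss (normc s + 3 * normc z) a0) _.
  have -> : cintegral leb (fun x => gaussF a s x * (z * x%:C)) = z * F1 s.
    rewrite -cintegralZl; first by apply: eq_cintegral => x; rewrite mulrCA.
    apply: cintegrable_le (integrable_gauss (normc s + 1) a0) _.
      by apply: measurable_cM; [exact: measurable_gaussF|exact: measurable_realC].
    move=> x; rewrite Normc.normcM normc_real.
    apply: (@le_trans _ _ (expR (normc s * `|x| - a / 2 * x ^+ 2) * expR `|x|)).
      rewrite ler_pM ?normc_ge0 ?normc_gaussF_le//.
      by have := expR_ge1Dx `|x|; lra.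
    by rewrite -expRD ler_expR le_eqVlt; apply/orP; left; apply/eqP; ring.
  move=> H; apply: (ex2_ext _ (H _ _)); first last.
  - move=> x; rewrite Normc.normcM normc_real.
    apply: le_trans (ler_wpM2r (expR_ge0 _) (normc_gaussF_le _ _ _)) _.
    by rewrite -expRD ler_expR le_eqVlt; apply/orP; left; apply/eqP; ring.
  - by apply: measurable_cM; [exact: measurable_cst|exact: measurable_realC].
  - move=> t; apply: eq_cintegral => x; rewrite /gaussF -cexpD; congr cexp; ring.
(* In the direction 1 the shift formula gives F in closed form, so uniqueness of the expansion
   identifies [F1]. *)
have F1E (s : R[i]) : F1 s = s * (a^-1)%:C * F s.
  have h1 := ex2F s 1; rewrite mul1r in h1.
  apply: ex2_uniq h1 _.
  have h2 := ex2M (ex2_cexp (s * (a^-1)%:C) ((2 * a)^-1)%:C) (ex2_cst (F s)).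
  rewrite mul1r mulr0 add0r in h2; apply: ex2_ext h2 => t.
  rewrite mulr1 /F cintegral_gauss_shift//; congr (cexp _ * _).
  rewrite -!rmorphXn/= !rmorphM/=; ring.
(* [F (u + i v) exp (- (u + i v)^2 / 2a)] does not depend on [v]. *)
pose G z := F z * cexp (- (z ^+ 2 * (2 * a)^-1%:C)).
have ex2G u v : ex2 (fun t => G (u +i* (v + t))) (G (u +i* v)) 0.
  have h1 := ex2F (u +i* v) 'i%C.
  have h2 := ex2M (ex2_cst (cexp (- ((u +i* v) ^+ 2 * (2 * a)^-1%:C))))
    (ex2_cexp (- (u +i* v) * 'i%C * a^-1%:C) ((2 * a)^-1)%:C).
  have := ex2M h1 h2; rewrite mulr1 [X in ex2 _ _ X](_ : _ = 0).
    apply: ex2_ext => t; rewrite /G -cexpD.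
    congr (F _ * cexp _).
      by apply: complex_ext; rewrite /=; ring.
    by apply: complex_ext; rewrite /=; field; rewrite gt_eqF.
  by rewrite mul0r addr0 F1E; ring.
have dR (u v : R) : is_derive v (1 : R) (fun y => cRe (G (u +i* y))) 0.
  have [C hC] := ex2G u v; apply: (is_derive0_sqr (C := C)) => t /hC.
  by rewrite mulr0 subr0 -cReB; apply: le_trans; exact: ler_cRe_normc.
have dI (u v : R) : is_derive v (1 : R) (fun y => cIm (G (u +i* y))) 0.
  have [C hC] := ex2G u v; apply: (is_derive0_sqr (C := C)) => t /hC.
  by rewrite mulr0 subr0 -cImB; apply: le_trans; exact: ler_cIm_normc.
have GE u v : G (u +i* v) = G (u +i* 0).
  apply: complex_ext.
    exact: (@is_derive_0_is_cst _ (fun y => cRe (G (u +i* y)))).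
  exact: (@is_derive_0_is_cst _ (fun y => cIm (G (u +i* y)))).
have Gr u : G (u +i* 0) = F 0.
  rewrite /G -/(u%:C) -[u%:C]add0r {1}/F cintegral_gauss_shift// mul0r !add0r.
  rewrite mulrAC -cexpD [cexp _](_ : _ = 1) ?mul1r//.
  rewrite -rmorphXn -rmorphM -rmorphN -rmorphD cexp_real.
  by rewrite /= subrr expR0.
move=> s; have : G s = F 0 by case: s => u v; rewrite GE Gr.
rewrite /G cexpN /F cintegral_gauss0// => <-.
by rewrite -mulrA mulVf ?mulr1// cexp_neq0.
Qed.

End gauss1.

Section complex_fubini.
Context {R : realType} d1 d2 (T1 : measurableType d1) (T2 : measurableType d2).
Variables (m1 : {sigma_finite_measure set T1 -> \bar R})
  (m2 : {sigma_finite_measure set T2 -> \bar R}).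

Lemma cintegral_fubini2 (f : T1 * T2 -> R[i]) :
  cintegrable (m1 \x m2)%E f ->
  (forall y, cintegrable m1 (fun x => f (x, y))) ->
  cintegral (m1 \x m2)%E f = cintegral m2 (fun y => cintegral m1 (fun x => f (x, y))).
Proof.
move=> [fR fI] fy; apply: complex_ext => /=.
  rewrite /Rintegral -integral21_prod_meas1//; congr fine.
  apply: eq_integral => y _; rewrite /fubini_G fineK//.
  by apply: integrable_fin_num => //; exact: (fy y).1.
rewrite /Rintegral -integral21_prod_meas1//; congr fine.
apply: eq_integral => y _; rewrite /fubini_G fineK//.
by apply: integrable_fin_num => //; exact: (fy y).2.
Qed.

End complex_fubini.

(** * Peeling one coordinate off Lebesgue integrals over tuples *)

Section lebesgue_tuple_integral.
Context {R : realType}.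
Local Notation leb := (@lebesgue_measure R).
Local Notation lebt := (@lebesgue_tuple R).

Let cons2 n (x : measurableTypeR R * n.-tuple R) : n.+1.-tuple R :=
  [the n.+1.-tuple R of x.1 :: x.2].

Let mcons2 n : measurable_fun setT (@cons2 n).
Proof. exact: measurable_cons. Qed.

Let lebS : {sigma_finite_measure set (measurableTypeR R) -> \bar R} :=
  [the {sigma_finite_measure set (measurableTypeR R) -> \bar R} of leb].

Lemma ge0_integral_lebesgue_tupleS n (g : n.+1.-tuple R -> \bar R) :
  measurable_fun setT g -> (forall m, 0 <= g m)%E ->
  (\int[lebt n.+1]_m g m = \int[leb]_x \int[lebt n]_t g (cons_tuple (x : R) t))%E.
Proof.
move=> mg g0.
have e := @ge0_integral_pushforward _ _ _ _ R (@cons2 n) (@mcons2 n)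
  (lebS \x lebt n)%E setT g measurableT mg (fun y _ => g0 y).
transitivity (\int[lebS \x lebt n]_(x in @cons2 n @^-1` setT) (g \o @cons2 n) x)%E.
  exact: e.
rewrite preimage_setT fubini_tonelli1//; first exact: measurableT_comp (@mcons2 n).
by move=> x; exact: g0.
Qed.

Lemma cintegrable_tupleS n (f : n.+1.-tuple R -> R[i]) :
  cintegrable (lebt n.+1) f -> cintegrable (lebS \x lebt n)%E (f \o @cons2 n).
Proof.
move=> cf; have mf := cintegrable_measurable cf.
have aux (g : n.+1.-tuple R -> R) : measurable_fun setT g ->
    (lebt n.+1).-integrable setT (EFin \o g) ->
    (lebS \x lebt n)%E.-integrable setT (EFin \o (g \o @cons2 n)).
  move=> mg /integrableP[_ gi]; apply/integrableP; split.
    apply/measurable_EFinP; exact: measurableT_comp (@mcons2 n).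
  apply: le_lt_trans gi.
  have e := @ge0_integral_pushforward _ _ _ _ R (@cons2 n) (@mcons2 n)
    (lebS \x lebt n)%E setT (fun m => `|(g m)%:E|)%E measurableT.
  rewrite le_eqVlt; apply/orP; left; apply/eqP; apply/esym.
  etransitivity; first apply: e => //.
    apply: measurableT_comp => //; exact/measurable_EFinP.
  by rewrite preimage_setT.
case: cf => fR fI; split.
  apply: (aux (fun m => cRe (f m))) fR; exact: measurable_cRe.
apply: (aux (fun m => cIm (f m))) fI; exact: measurable_cIm.
Qed.

Lemma cintegral_tupleS n (f : n.+1.-tuple R -> R[i]) :
  cintegrable (lebt n.+1) f ->
  cintegral (lebt n.+1) f = cintegral (lebS \x lebt n)%E (f \o @cons2 n).
Proof.
move=> cf; have mf := cintegrable_measurable cf.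
have [gR gI] := cintegrable_tupleS cf.
have aux (g : n.+1.-tuple R -> R) : measurable_fun setT g ->
    (lebS \x lebt n)%E.-integrable setT (EFin \o (g \o @cons2 n)) ->
    \int[lebt n.+1]_m g m = \int[(lebS \x lebt n)%E]_z g (cons2 z).
  move=> mg ig; congr fine.
  have e := @integral_pushforward _ _ _ _ R (@cons2 n) (@mcons2 n)
    (lebS \x lebt n)%E setT (EFin \o g).
  etransitivity; first apply: e => //.
    exact/measurable_EFinP.
  by rewrite preimage_setT.
apply: complex_ext; [apply: (aux (fun m => cRe (f m)))|apply: (aux (fun m => cIm (f m)))] => //.
  exact: measurable_cRe.
exact: measurable_cIm.
Qed.

Lemma cintegral_lebesgue_tupleS n (f : n.+1.-tuple R -> R[i]) :
  cintegrable (lebt n.+1) f ->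
  (forall t, cintegrable leb (fun x : R => f (cons_tuple x t))) ->
  cintegral (lebt n.+1) f =
  cintegral (lebt n) (fun t => cintegral leb (fun x : R => f (cons_tuple x t))).
Proof.
move=> fi fx; rewrite cintegral_tupleS// cintegral_fubini2//.
exact: cintegrable_tupleS.
Qed.

End lebesgue_tuple_integral.

Section gauss_tuple.
Context {R : realType}.
Local Notation leb := (@lebesgue_measure R).
Local Notation lebt := (@lebesgue_tuple R).

(** Common majorant of the Gaussian integrands: a product over the coordinates, so its integrability
    follows from the one-variable case by Tonelli. *)
Definition gdom n (a C : R) (m : n.-tuple R) : R :=
  expR (\sum_(i < n) (C * `|tnth m i| - a / 2 * tnth m i ^+ 2)).

Lemma measurable_gdom n a C : measurable_fun setT (@gdom n a C).
Proof.
apply: measurableT_comp => //; apply: measurable_sum => i.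
have mt := @measurable_tnth _ R n i.
apply: measurable_funB; apply: measurable_funM => //.
  by apply: measurableT_comp.
by apply: measurable_funX.
Qed.

Lemma gdom_cons n a C (x : R) (t : n.-tuple R) :
  gdom a C (cons_tuple x t) = expR (C * `|x| - a / 2 * x ^+ 2) * gdom a C t.
Proof.
rewrite /gdom big_ord_recl expRD; congr (expR _ * expR _).
by apply: eq_bigr => i _; rewrite tnthS.
Qed.

Lemma integrable_gdom n (a C : R) : 0 < a ->
  (lebt n).-integrable setT (EFin \o @gdom n a C).
Proof.
move=> a0; 
have mgn k : measurable_fun setT (fun m => (`|@gdom k a C m|)%:E).
  apply/measurable_EFinP; apply: measurableT_comp => //; exact: measurable_gdom.
have mg k : measurable_fun setT (EFin \o @gdom k a C).
  by apply/measurable_EFinP; exact: measurable_gdom.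
elim: n => [|n IH]; first (apply/integrableP; split; first exact: mg).
  rewrite integral_dirac ?diracT ?mul1e ?ltry//.
  exact: measurableT_comp (mg 0%N).
apply/integrableP; split; first exact: mg.
rewrite ge0_integral_lebesgue_tupleS//.
have /integrableP[m1 h1] := IH; have /integrableP[m2 h2] := integrable_gauss C a0.
set J := (\int[lebt n]_t `|(gdom a C t)%:E|)%E in h1.
have -> : (\int[leb]_x \int[lebt n]_t `|(EFin \o gdom a C) (cons_tuple (x : R) t)| =
    \int[leb]_x ((expR (C * `|x| - a / 2 * x ^+ 2))%:E * J))%E.
  apply: eq_integral => x _; rewrite -ge0_integralZl//; last exact: mgn.
  apply: eq_integral => t _.
  by rewrite /= gdom_cons normrM EFinM ger0_norm ?expR_ge0.
rewrite ge0_integralZr//; last exact: integral_ge0.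
apply: lte_mul_pinfty => //.
  by apply: integral_ge0.
rewrite ge0_fin_numE; last by apply: integral_ge0.
apply: le_lt_trans h2; rewrite le_eqVlt; apply/orP; left; apply/eqP.
by apply: eq_integral => x _; rewrite gee0_abs ?lee_fin ?expR_ge0.
Qed.

(* The exponent is -(a/2) m^T (1 + lam J) m with J the all-ones matrix; this
   shape is stable under integrating out one coordinate, lam = 1 being that of
   [phi_density]. *)
Definition gform n (a lam : R) (s : 'I_n -> R[i]) (m : n.-tuple R) : R[i] :=
  cexp (\sum_i s i * (tnth m i)%:C -
    (a / 2 * (\sum_i tnth m i ^+ 2 + lam * (\sum_i tnth m i) ^+ 2))%:C).

Lemma measurable_gform n a lam s : measurable_fun setT (@gform n a lam s).
Proof.
have mt := @measurable_tnth _ R n.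
apply: measurable_cexp; apply: measurable_cD.
  apply: measurable_csum => i; apply: measurable_cM; first exact: measurable_cst.
  by apply: measurable_realC.
under eq_fun do rewrite -rmorphN.
apply: measurable_realC; apply: measurable_funN; apply: measurable_funM => //.
apply: measurable_funD.
  by apply: measurable_sum => i; exact: measurable_funX.
by apply: measurable_funM => //; apply: measurable_funX; exact: measurable_sum.
Qed.

Lemma normc_gform_le n a lam s (m : n.-tuple R) : 0 < a -> 0 <= lam ->
  normc (gform a lam s m) <= gdom a (\sum_i normc (s i)) m.
Proof.
move=> a0 l0; rewrite normc_cexp ler_expR cReB cRe_sum /= sumrB lerB//.
  apply: ler_sum => i _; rewrite cReM/= mulr0 subr0.
  rewrite (le_trans (ler_norm _))// normrM ler_wpM2r// (le_trans (ler_cRe_normc _))//.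
  by rewrite (bigD1 i)//= lerDl sumr_ge0// => j _; exact: normc_ge0.
by rewrite -mulr_sumr ler_wpM2l ?divr_ge0 ?(ltW a0)// lerDl mulr_ge0// sqr_ge0.
Qed.

Lemma cintegrable_gform n a lam s : 0 < a -> 0 <= lam ->
  cintegrable (lebt n) (gform a lam s).
Proof.
move=> a0 l0; apply: cintegrable_le (integrable_gdom n (\sum_i normc (s i)) a0) _.
  exact: measurable_gform.
by move=> m; exact: normc_gform_le.
Qed.

(** Expanding lam (x + S)^2, the cross term is linear in x and joins the parameter of the first
    coordinate, while lam x^2 changes its coefficient to a (1 + lam). *)
Lemma gform_cons n a lam s (x : R) (t : n.-tuple R) : 0 < a -> 0 <= lam ->
  let S := \sum_i tnth t i in
  gform a lam s (cons_tuple x t) =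
  gaussF (a * (1 + lam)) (s ord0 - (a * lam * S)%:C) x *
  gform a lam (s \o lift ord0) t.
Proof.
move=> a0 l0 S; rewrite /gform /gaussF -cexpD; congr cexp.
rewrite !big_ord_recl !tnth0/=.
under eq_bigr do rewrite tnthS.
under [X in _ - (_ * ((_ + X) + _))%:C]eq_bigr do rewrite tnthS.
under [X in _ - (_ * (_ + _ * (_ + X) ^+ 2))%:C]eq_bigr do rewrite tnthS.
rewrite -/S; set W := \sum_i s _ * _; set V := \sum_i _ ^+ 2.
by case: (s ord0) W => [u v] [w1 w2]; apply: complex_ext; rewrite /=; field.
Qed.

(** Integrating out the first coordinate creates (s_0 - a lam S)^2 / (2 a (1 + lam)). Its S^2 term
    replaces lam by lam - lam^2 / (1 + lam) = lam / (1 + lam), and its cross term shifts the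
    remaining parameters. *)
Lemma cintegral_gformS n a lam s : 0 < a -> 0 <= lam ->
  cintegral (lebt n.+1) (gform a lam s) =
  (Num.sqrt (2 * pi / (a * (1 + lam))))%:C *
  cexp (s ord0 ^+ 2 * (2 * (a * (1 + lam)))^-1%:C) *
  cintegral (lebt n) (gform a (lam / (1 + lam))
    (fun i => s (lift ord0 i) - s ord0 * (lam / (1 + lam))%:C)).
Proof.
move=> a0 l0.
have b0 : 0 < a * (1 + lam) by rewrite mulr_gt0// ltr_pwDl.
have slE t : (fun x : R => gform a lam s (cons_tuple x t)) = (fun x : R =>
    gform a lam (s \o lift ord0) t *
    gaussF (a * (1 + lam)) (s ord0 - (a * lam * \sum_i tnth t i)%:C) x).
  by apply/funext => x; rewrite mulrC -gform_cons.
rewrite cintegral_lebesgue_tupleS; first last.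
- by move=> t; rewrite slE; apply: cintegrableZl; exact: cintegrable_gaussF.
- exact: cintegrable_gform.
rewrite -cintegralZl; last first.
  by apply: cintegrable_gform => //; rewrite divr_ge0// addr_ge0.
apply: eq_cintegral => t; rewrite slE.
rewrite cintegralZl; last exact: cintegrable_gaussF.
rewrite cintegral_gauss// mulrCA -[RHS]mulrA; congr (_ * _).
rewrite /gform -!cexpD; congr cexp.
under [in RHS]eq_bigr do rewrite mulrBl -mulrA -rmorphM/=.
rewrite sumrB -mulr_sumr -raddf_sum -mulr_sumr /=.
set S := \sum_i tnth t i; set V := \sum_i _ ^+ 2.
set W := \sum_i s _ * _.
have l1 : 1 + lam != 0 by rewrite gt_eqF// ltr_pwDl.
by case: (s ord0) W => [u v] [w1 w2]; apply: complex_ext; rewrite /=; field;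
  rewrite l1 gt_eqF.
Qed.

Lemma cintegral_cst1 d (T : measurableType d) (m : {measure set T -> \bar R}) (c : R[i]) :
  m setT = 1%E -> cintegral m (fun=> c) = c.
Proof.
by move=> m1; apply: complex_ext; rewrite /= /Rintegral integral_cst// m1 mule1.
Qed.

(** 1 + n lam is the determinant of I + lam J, and I - lam / (1 + n lam) J is its inverse (J the
    all-ones matrix). The induction follows the factorization 1 + (n + 1) lam = (1 + lam) (1 + n lam
    / (1 + lam)). *)
Lemma cintegral_gform n a lam s : 0 < a -> 0 <= lam ->
  cintegral (lebt n) (gform a lam s) =
  ((2 * pi / a) `^ (n%:R / 2) / Num.sqrt (1 + n%:R * lam))%:C *
  cexp ((2 * a)^-1%:C * (\sum_i s i ^+ 2 -
     (lam / (1 + n%:R * lam))%:C * (\sum_i s i) ^+ 2)).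
Proof.
move=> a0; elim: n lam s => [|n IH] lam s l0.
  rewrite !big_ord0 expr0n/= !mul0r powRr0 addr0 sqrtr1 divr1 mulr0 subr0 mulr0 cexp0 mulr1.
  have gE : (fun t => gform a lam s t) = (fun=> 1).
    by apply/funext => t; rewrite /gform !big_ord0 expr0n /= !mulr0 addr0 mulr0 subr0 cexp0.
  rewrite (_ : gform a lam s = fun=> 1) //.

  by rewrite cintegral_cst1//; exact: diracT.
rewrite cintegral_gformS//.
rewrite IH; last by rewrite divr_ge0// addr_ge0.
have l1 : 0 < 1 + lam by rewrite ltr_pwDl.
have ln : 0 < 1 + n%:R * (lam / (1 + lam)).
  by rewrite ltr_pwDl// mulr_ge0// divr_ge0// ltW.
have ln1 : 0 < 1 + n.+1%:R * lam by rewrite ltr_pwDl// mulr_ge0.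
rewrite [LHS](_ : _ = ((Num.sqrt (2 * pi / (a * (1 + lam)))) *
  ((2 * pi / a) `^ (n%:R / 2) / Num.sqrt (1 + n%:R * (lam / (1 + lam)))))%:C *
  (cexp (s ord0 ^+ 2 * (2 * (a * (1 + lam)))^-1%:C) * cexp ((2 * a)^-1%:C *
    (\sum_i (s (lift ord0 i) - s ord0 * (lam / (1 + lam))%:C) ^+ 2 -
     (lam / (1 + lam) / (1 + n%:R * (lam / (1 + lam))))%:C *
     (\sum_i (s (lift ord0 i) - s ord0 * (lam / (1 + lam))%:C)) ^+ 2)))); last first.
  by rewrite rmorphM/=; ring.
congr (_%:C * _).
  have P0 : 0 < 2 * pi / a by rewrite divr_gt0 ?mulr_gt0 ?pi_gt0.
  have -> : n.+1%:R / 2 = 2^-1 + n%:R / 2 :> R by rewrite -natr1; field.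
  rewrite powRD; last by rewrite gt_eqF ?implybT.
  rewrite powR12_sqrt ?ltW//.
  have -> : 2 * pi / (a * (1 + lam)) = 2 * pi / a * (1 + lam)^-1.
    by rewrite invfM mulrA.
  rewrite sqrtrM ?ltW// sqrtrV ?ltW//.
  have -> : 1 + n.+1%:R * lam = (1 + lam) * (1 + n%:R * (lam / (1 + lam))).
    by rewrite -natr1; field; rewrite gt_eqF.
  rewrite (sqrtrM _ (ltW l1)) invfM; ring.
rewrite -cexpD; congr cexp.
rewrite !big_ord_recl.
set T := \sum_(i < n) s (lift ord0 i).
set Q := \sum_(i < n) s (lift ord0 i) ^+ 2.
have -> : \sum_(i < n) (s (lift ord0 i) - s ord0 * (lam / (1 + lam))%:C) =
    T - n%:R * (s ord0 * (lam / (1 + lam))%:C).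
  by rewrite sumrB sumr_const card_ord mulr_natl.
have -> : \sum_(i < n) (s (lift ord0 i) - s ord0 * (lam / (1 + lam))%:C) ^+ 2 =
    Q - 2 * (s ord0 * (lam / (1 + lam))%:C) * T +
    n%:R * (s ord0 * (lam / (1 + lam))%:C) ^+ 2.
  under eq_bigr do rewrite sqrrB.
  rewrite big_split sumrB/= sumr_const card_ord; congr (_ - _ + _); last first.
    by rewrite mulr_natl.
  by rewrite mulr_sumr; apply: eq_bigr => i _; ring.
rewrite -!natrC -[n.+1%:R]natr1.
have n1 : 1 + lam + n%:R * lam != 0.
  by rewrite gt_eqF// ltr_pwDl ?ltr_pwDl// mulr_ge0.
have n2 : 1 + (n%:R + 1) * lam != 0 by rewrite natr1 gt_eqF.
have n3 : 1 + lam != 0 by rewrite gt_eqF.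
have na : a != 0 by rewrite gt_eqF.
case: (s ord0) T Q => [u v] [t1 t2] [q1 q2]; apply: complex_ext; rewrite /=; field;
  by rewrite n3 na ?n1 ?n2.
Qed.

End gauss_tuple.

(** * The polynomials Q *)

Section formal_exponential_recurrence.
Context {R : realType} {n : nat}.
Implicit Types (p : mpoly n R[i]) (m : multinom n).

Definition exp_trunc (N : nat) p : mpoly n R[i] := \sum_(i < N) i`!%:R^-1 *: p ^+ i.

(** [exp_coef] indexed by multinomials, where unit vectors can be added and subtracted as the
    recurrence demands. *)
Definition ecoef p m : R[i] := mcoeff m (exp_trunc (mdeg m).+1 p).

Lemma ecoef_stable p m N : mcoeff mnm0 p = 0 -> (mdeg m < N)%N ->
  mcoeff m (exp_trunc N p) = ecoef p m.
Proof. by case: m => l p0 lN; exact: exp_coef_stable. Qed.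

Lemma ecoef0 p : mcoeff mnm0 p = 0 -> ecoef p mnm0 = 1.
Proof.
move=> p0; rewrite /ecoef mdeg0 /exp_trunc big_ord1 fact0 invr1 scale1r expr0.
by rewrite mcoeff1 eqxx.
Qed.

Lemma mderivXn (k : 'I_n) p i : mderiv k (p ^+ i) = i%:R *: (mderiv k p * p ^+ i.-1).
Proof.
elim: i => [|i IH]; first by rewrite expr0 -mpolyC1 mderivC scale0r.
rewrite exprS mderivM IH /= -natr1 scalerDl scale1r addrC; congr (_ + _).
case: i {IH} => [|i]; first by rewrite !scale0r mulr0.
by rewrite -scalerAr mulrCA -exprS.
Qed.

Lemma mderiv_exp_trunc (k : 'I_n) p N :
  mderiv k (exp_trunc N.+1 p) = mderiv k p * exp_trunc N p.
Proof.
rewrite /exp_trunc raddf_sum/= big_ord_recl /= mderivZ mderivXn scale0r scaler0 add0r.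
rewrite mulr_sumr; apply: eq_bigr => i _; rewrite mderivZ mderivXn /= scalerA.
rewrite -scalerAr; congr (_ *: _).
rewrite factS natrM invfM mulrC mulrA divff ?mul1r//.
by rewrite pnatr_eq0.
Qed.

Lemma mcoeffXM (k : 'I_n) p m : mcoeff m (mpolyX R[i] (mnm1 k) * p) =
  if (0 < m k)%N then mcoeff (mnm_sub m (mnm1 k)) p else 0.
Proof.
case: ifPn => [m0|]; last first.
  rewrite -eqn0Ngt => /eqP m0; rewrite mcoeffM big1// => -[i j] /= /eqP e.
  rewrite mcoeffX; case: eqP => [ie|]; last by rewrite mul0r.
  have := congr1 (fun z : multinom n => z k) e.
  by rewrite m0 mnmDE -ie mnm1E eqxx.
rewrite mulrC -{1}(@submK _ (mnm1 k) m).
  by rewrite addmC mcoeffMX.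
by apply/mnm_lepP => l; rewrite mnm1E; case: eqP => // <-.
Qed.

(* Comparison of coefficients in d_k exp(p) = (d_k p) exp(p). *)
Lemma ecoef_rec p (k : 'I_n) (beta : 'I_n -> R[i]) (A : R[i]) m :
  mcoeff mnm0 p = 0 ->
  mderiv k p = \sum_(j < n) beta j *: mpolyX R[i] (mnm1 j) + mpolyC n A ->
  (m k).+1%:R * ecoef p (mnm_add m (mnm1 k)) =
  A * ecoef p m +
  \sum_(j < n) beta j * (if (0 < m j)%N then ecoef p (mnm_sub m (mnm1 j)) else 0).
Proof.
move=> p0 dp.
have e1 : mdeg (mnm_add m (mnm1 k)) = (mdeg m).+1 by rewrite mdegD mdeg1 addn1.
rewrite mulr_natl.
(* Differentiation lowers the truncation order by one: starting at degree plus two leaves degree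
   plus one, which is what the coefficient at m uses and is enough for the lower coefficients by
   stability. *)
have -> : ecoef p (mnm_add m (mnm1 k)) *+ (m k).+1 =
    mcoeff m (mderiv k (exp_trunc (mdeg m).+2 p)).
  by rewrite mcoeff_deriv /ecoef e1.
rewrite mderiv_exp_trunc dp mulrDl mcoeffD mcoeffCM addrC; congr (_ + _).
rewrite mulr_suml raddf_sum/=; apply: eq_bigr => j _.
rewrite -scalerAl mcoeffZ mcoeffXM; case: ifPn => // mj.
rewrite ecoef_stable//.
by rewrite ltnS mdegB.
Qed.

End formal_exponential_recurrence.

(** * Sums over roots of unity *)

Section theta_theory.
Context {R : realType} (q : nat).
Hypothesis q_gt0 : (0 < q)%N.

Lemma thetaX (k j : nat) : theta q k ^+ j = cexp ((2 * pi * (k * j)%:R / q%:R) *i) :> R[i].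
Proof.
rewrite /theta cexpX; congr cexp; apply: complex_ext.
  by rewrite cReM/= cRe_nat cIm_nat !(mulr0, mul0r) subr0.
rewrite cImM/= cRe_nat cIm_nat mul0r addr0 natrM; ring.
Qed.

Lemma theta_sum (k : nat) : (0 < k < q)%N -> \sum_(j < q) theta q k ^+ j = 0 :> R[i].
Proof.
move=> /andP[k0 kq].
have q0 : (q%:R : R) != 0 by rewrite pnatr_eq0 -lt0n.
(* The real part is cos x = 1 - 2 sin (x / 2)^2, and 0 < k < q puts x / 2 strictly between 0 and pi,
   where sin is positive. *)
have t1 : theta q k != 1 :> R[i].
  apply/eqP => /(congr1 (@complex.Re R)); rewrite /theta/= expR0 mul1r.
  set x := _ / _ => c1.
  have x0 : 0 < x / 2 < pi.
    have p0 := pi_gt0 R; rewrite /x !divr_gt0 ?mulr_gt0 ?ltr0n//=.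
    rewrite ltr_pdivrMr// ltr_pdivrMr ?ltr0n// [ltRHS]mulrAC [2 * pi]mulrC.
    by rewrite [pi * q%:R * 2]mulrAC ltr_pM2l ?mulr_gt0// ltr_nat.
  have s0 := sin_gt0_pi x0.
  have : cos x = 1 - (sin (x / 2)) ^+ 2 *+ 2.
    have -> : x = (x / 2) *+ 2 by rewrite -mulr_natr; field.
    rewrite cos_mulr2n -[in RHS](mulr_natr (x / 2)) mulfK// sin2cos2 mulrnBl; ring.
  rewrite c1 => /eqP; rewrite eq_sym subr_eq addrC -subr_eq subrr eq_sym.
  by rewrite mulrn_eq0/= sqrf_eq0 gt_eqF.
have : (theta q k - 1) * \sum_(j < q) theta q k ^+ j = 0 :> R[i].
  rewrite -subrX1 thetaX natrM mulrA mulfK//.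
  rewrite (_ : cexp _ = 1) ?subrr//.
  have -> : (2 * pi * k%:R)*i = k%:R * (2 * pi)*i :> R[i].
    apply: complex_ext; first by rewrite cReM/= cRe_nat cIm_nat; ring.
    by rewrite cImM/= cRe_nat cIm_nat; ring.
  rewrite -cexpX (_ : cexp _ = 1) ?expr1n//.
  rewrite mulrC mulr_natr /cexp/= expR0 !mul1r cos2pi.
  by rewrite sin_mulr2n sinpi mulr0 mul0rn.
by move/eqP; rewrite mulf_eq0 subr_eq0 (negbTE t1) => /eqP.
Qed.

Lemma thetaV k j : (theta q k ^+ j)^-1 = (theta q k ^+ j)^* :> R[i].
Proof.
rewrite thetaX conj_cexp -cexpN; congr cexp; by apply: complex_ext; rewrite /= ?oppr0.
Qed.

Lemma normc_theta k : normc (theta q k : R[i]) = 1.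
Proof. by rewrite /theta normc_cexp/= expR0. Qed.

End theta_theory.

Section Q_recurrence.
Context {R : realType} (q : nat).
Hypothesis q_gt1 : (1 < q)%N.
Local Notation n := q.-1.

(** Minus the bilinear covariance of the forms [Qlin k] and [Qlin j] under the law of M; this is the
    sign behind the cancellation in [gaussL_Qm]. *)
Definition Qbeta (k j : 'I_n) : R[i] :=
  - q%:R^-1 * \sum_(a < q) theta q k.+1 ^+ a * theta q j.+1 ^+ a.

Definition Qlin (k : 'I_n) (m : n.-tuple R) : R[i] :=
  \sum_(a < q) (full m a)%:C * theta q k.+1 ^+ a.

Lemma mderiv_Q_exponent (m : n.-tuple R) (k : 'I_n) :
  mderiv k (Q_exponent m) =
  \sum_(j < n) Qbeta k j *: mpolyX R[i] (mnm1 j) + mpolyC n (Qlin k m).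
Proof.
rewrite /Q_exponent.
set S := fun j : nat => \sum_(k < n) theta q k.+1 ^+ j *: mpolyX R[i] (mnm1 k).
have dS (j : nat) : mderiv k (S j) = mpolyC n (theta q k.+1 ^+ j).
  rewrite /S raddf_sum/= (bigD1 k)//= big1 ?addr0.
    rewrite mderivZ mderivX mnm1E eqxx scale1r.
    have -> : mnm_sub (mnm1 k) (mnm1 k) = mnm0 :> multinom n.
      by apply/mnmP => i; rewrite mnmBE subnn mnm0E.
    by rewrite mpolyX0 -mul_mpolyC mulr1.
  by move=> i ik; rewrite mderivZ mderivX mnm1E (negbTE ik) scale0r scaler0.
rewrite mderivD mderivZ !(raddf_sum (mderiv k))/=; congr (_ + _); last first.
  rewrite /Qlin (raddf_sum (@mpolyC n _))/=; apply: eq_bigr => j _.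
  by rewrite mderivZ dS -mul_mpolyC -rmorphM.
rewrite scaler_sumr.
transitivity (\sum_(j < q) (- q%:R^-1 * theta q k.+1 ^+ j) *: S j).
  apply: eq_bigr => j _; rewrite mderivXn dS expr1 mul_mpolyC !scalerA.
  congr (_ *: _); field; rewrite ?pnatr_eq0// -lt0n; exact: ltnW.
have scS c (j : nat) : c *: S j =
    \sum_(k < n) (c * theta q k.+1 ^+ j) *: mpolyX R[i] (mnm1 k).
  etransitivity; first exact: scaler_sumr.
  by apply: eq_bigr => i _; rewrite scalerA.
etransitivity; first by apply: eq_bigr => j _; exact: scS.
rewrite exchange_big/=; apply: eq_bigr => i _.
rewrite -scaler_suml /Qbeta mulr_sumr; congr (_ *: _).
by apply: eq_bigr => j _; rewrite mulrA.
Qed.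

Definition Qm (mu : multinom n) (m : n.-tuple R) : R[i] := ecoef (Q_exponent m) mu.

Lemma QE (l : n.-tuple nat) m : Q l m = Qm (Multinom l) m.
Proof. by []. Qed.

Lemma Qm0 m : Qm mnm0 m = 1.
Proof. by rewrite /Qm ecoef0// mcoeff0_Q_exponent. Qed.

Lemma Qm_rec (mu : multinom n) (k : 'I_n) m :
  (mu k).+1%:R * Qm (mnm_add mu (mnm1 k)) m =
  Qlin k m * Qm mu m + \sum_(j < n) Qbeta k j *
     (if (0 < mu j)%N then Qm (mnm_sub mu (mnm1 j)) m else 0).
Proof.
by apply: ecoef_rec; [exact: mcoeff0_Q_exponent|exact: mderiv_Q_exponent].
Qed.

(* The linear form [Qlin k] has these coordinates once m[0] is eliminated. *)
Definition Qshift (k i : 'I_n) : R[i] := theta q k.+1 ^+ i.+1 - 1.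

Lemma big_ordq (F : nat -> R[i]) :
  \sum_(a < q) F a = F 0%N + \sum_(i < n) F i.+1.
Proof. by rewrite -(prednK (ltnW q_gt1)) big_ord_recl. Qed.

Lemma theta_lt (k : 'I_n) : (0 < k.+1 < q)%N.
Proof. by rewrite ltnS leq0n/= -ltn_predRL ltn_ord. Qed.

Lemma QlinE k m : Qlin k m = \sum_(i < n) Qshift k i * (tnth m i)%:C.
Proof.
rewrite /Qlin (big_ordq (fun a => (full m a)%:C * theta q k.+1 ^+ a)) /=.
rewrite expr0 mulr1 rmorphN rmorph_sum /= -sumrN -big_split/=.
by apply: eq_bigr => i _; rewrite /Qshift (tnth_nth 0) mulrBl mul1r addrC mulrC.
Qed.

Lemma sum_theta (k : 'I_n) : \sum_(i < n) theta q k.+1 ^+ i.+1 = -1 :> R[i].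
Proof.
have := @theta_sum R q (ltnW q_gt1) k.+1 (theta_lt k).
rewrite (big_ordq (fun a => theta q k.+1 ^+ a)) expr0 => /eqP.
by rewrite addrC addr_eq0 => /eqP.
Qed.

Lemma sum_Qshift (k : 'I_n) : \sum_(i < n) Qshift k i = - q%:R.
Proof.
rewrite sumrB sum_theta sumr_const card_ord -[in RHS](prednK (ltnW q_gt1)).
by rewrite -[q.-1.+1]addn1 natrD; ring.
Qed.

(** Covariance of the form with coefficients s and the form [Qlin k], see [covB_Qshift]; it is the
    base of the powers in the transform of [Q]. *)
Definition kap (s : 'I_n -> R[i]) (k : 'I_n) : R[i] :=
  q%:R^-1 * \sum_(a < n) s a * theta q k.+1 ^+ a.+1.

Lemma kap_Qshift k j : kap (Qshift k) j = - Qbeta k j.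
Proof.
rewrite /kap /Qbeta mulNr opprK; congr (_ * _).
rewrite (big_ordq (fun a => theta q k.+1 ^+ a * theta q j.+1 ^+ a)) !expr0 mulr1.
under eq_bigr do rewrite /Qshift mulrBl mul1r.
by rewrite sumrB sum_theta opprK addrC.
Qed.

Lemma kap_lin s s' (t : R[i]) k :
  kap (fun i => s i + t * s' i) k = kap s k + t * kap s' k.
Proof.
rewrite /kap [X in _ = _ + X]mulrCA -mulrDr; congr (_ * _).
rewrite mulr_sumr -big_split/=.
by apply: eq_bigr => i _; ring.
Qed.

(** The covariance matrix of M_+ extended bilinearly, without conjugation, to complex parameters. *)
Definition covB (s t : 'I_n -> R[i]) : R[i] :=
  q%:R^-1 * (\sum_i s i * t i - q%:R^-1 * (\sum_i s i) * (\sum_i t i)).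

(** The coefficients [Qshift k] sum to -q, so the correction -1/q of the covariance becomes plus the
    sum of s, and this cancels the -1 in [Qshift]. *)
Lemma covB_Qshift s k : covB s (Qshift k) = kap s k.
Proof.
rewrite /covB /kap sum_Qshift; congr (_ * _).
rewrite [X in _ - X](_ : _ = - \sum_i s i); last first.
  by field; rewrite pnatr_eq0 -lt0n ltnW.
by rewrite opprK -big_split/=; apply: eq_bigr => i _; rewrite /Qshift; ring.
Qed.

End Q_recurrence.

(** * Gaussian transforms of the polynomials [Q] *)

Section gaussian_moments.
Context {R : realType} (q : nat).
Hypothesis q_gt1 : (1 < q)%N.
Local Notation n := q.-1.
Local Notation lebt := (@lebesgue_tuple R).

Let q0 : (0 : R) < q%:R. Proof. by rewrite ltr0n ltnW. Qed.

Definition phi_cst : R := q%:R `^ (q%:R / 2) / (2 * pi) `^ (n%:R / 2).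

(** The quadratic form of the density has matrix q (I + J), that is [gform] with a = q and lam =
    1. *)
Lemma phi_densityE (s : 'I_n -> R[i]) (m : n.-tuple R) :
  cexp (\sum_i s i * (tnth m i)%:C) * (phi_density m)%:C =
  phi_cst%:C * gform q%:R 1 s m.
Proof.
rewrite /phi_density -/phi_cst rmorphM/= mulrCA; congr (_ * _).
rewrite /gform -cexp_real -cexpD; congr cexp; congr (_ + _).
rewrite -rmorphN; congr (_%:C); rewrite mulNr; congr (- (_ * _)).
rewrite mul1r expr2 mulr_suml -big_split/=; apply: eq_bigr => a _.
rewrite mulr_sumr (bigD1 a)//= [in RHS](bigD1 a)//= eqxx.
rewrite addrA; congr (_ + _).
  by have -> : (true%:R : R) = 1 by []; ring.
by apply: eq_bigr => b ba; rewrite eq_sym (negbTE ba) add0r mul1r.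
Qed.

Definition gaussL (s : 'I_n -> R[i]) (f : n.-tuple R -> R[i]) : R[i] :=
  cintegral (lebt n) (fun m => f m * (phi_cst%:C * gform q%:R 1 s m)).

(** Here 1 + (q - 1) lam = q: the determinant makes the normalization exactly 1, and the inverse I -
    J / q yields the covariance of M_+. *)
Lemma gaussL1 s : gaussL s (fun=> 1) = cexp (2^-1 * covB s s).
Proof.
rewrite /gaussL.
transitivity (cintegral (lebt n) (fun m => phi_cst%:C * gform q%:R 1 s m)).
  by apply: eq_cintegral => m; rewrite mul1r.
rewrite cintegralZl; last exact: cintegrable_gform.
rewrite cintegral_gform// mulrA -rmorphM/= mulr1.
have nq : 1 + n%:R = q%:R :> R by rewrite addrC natr1 prednK// ltnW.
rewrite nq [X in X%:C * _](_ : _ = 1).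
  rewrite [1%:C](_ : _ = 1)// mul1r; congr cexp; rewrite /covB.
  have -> : ((2 * q%:R)^-1)%:C = 2^-1 * q%:R^-1 :> R[i].
    by rewrite fmorphV rmorphM !rmorph_nat invfM.
  have -> : (1 / q%:R)%:C = q%:R^-1 :> R[i] by rewrite mul1r fmorphV rmorph_nat.
  under [in RHS]eq_bigr do rewrite -expr2.
  ring.
rewrite /phi_cst.
have p0 : 0 < (2 * pi : R) `^ (n%:R / 2) by rewrite powR_gt0// mulr_gt0// pi_gt0.
have -> : (2 * pi / q%:R : R) `^ (n%:R / 2) =
    (2 * pi) `^ (n%:R / 2) / q%:R `^ (n%:R / 2).
  apply: (mulIf (lt0r_neq0 (powR_gt0 (n%:R / 2) q0))).
  rewrite divfK ?lt0r_neq0 ?powR_gt0// -powRM ?divr_ge0 ?mulr_ge0 ?pi_ge0//.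
  by rewrite divfK// gt_eqF.
have -> : (q%:R : R) `^ (q%:R / 2) = q%:R `^ (n%:R / 2) * Num.sqrt q%:R.
  rewrite -powR12_sqrt ?ltW// -powRD; last by rewrite gt_eqF ?implybT.
  by congr (_ `^ _); rewrite -nq; field.
have qn : 0 < (q%:R : R) `^ (n%:R / 2) by rewrite powR_gt0.
have sq : 0 < Num.sqrt (q%:R : R) by rewrite sqrtr_gt0.
by field; rewrite !gt_eqF.
Qed.

(** A class containing the constants and the linear forms [Qlin k], closed under sums and products,
    whose members stay Gaussian-integrable after multiplication by any exponential of a linear
    form. *)
Definition expbnd (f : n.-tuple R -> R[i]) := measurable_fun setT f /\
  exists K C : R, [/\ 0 <= K, 0 <= C &
    forall m, normc (f m) <= K * expR (C * \sum_i `|tnth m i|)].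

Lemma expbnd_cst c : expbnd (fun=> c).
Proof.
split; first exact: measurable_cst.
by exists (normc c), 0; split => // [|m]; rewrite ?normc_ge0// mul0r expR0 mulr1.
Qed.

Lemma expbndD f g : expbnd f -> expbnd g -> expbnd (fun m => f m + g m).
Proof.
move=> [mf [K [C [K0 C0 h]]]] [mg [K' [C' [K'0 C'0 h']]]]; split.
  exact: measurable_cD.
exists (K + K'), (C + C'); split; rewrite ?addr_ge0// => m.
have S0 : 0 <= \sum_i `|tnth m i| by rewrite sumr_ge0.
rewrite (le_trans (normcD _ _))// mulrDl lerD//.
  by rewrite (le_trans (h m))// ler_wpM2l// ler_expR mulrDl lerDl mulr_ge0.
by rewrite (le_trans (h' m))// ler_wpM2l// ler_expR mulrDl lerDr mulr_ge0.
Qed.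

Lemma expbndM f g : expbnd f -> expbnd g -> expbnd (fun m => f m * g m).
Proof.
move=> [mf [K [C [K0 C0 h]]]] [mg [K' [C' [K'0 C'0 h']]]]; split.
  exact: measurable_cM.
exists (K * K'), (C + C'); split; rewrite ?addr_ge0 ?mulr_ge0// => m.
rewrite mulrDl expRD mulrACA Normc.normcM ler_pM ?normc_ge0//.
Qed.

Lemma expbnd_sum I (s : seq I) (F : I -> n.-tuple R -> R[i]) :
  (forall i, expbnd (F i)) -> expbnd (fun m => \sum_(i <- s) F i m).
Proof.
move=> h; elim: s => [|i s IH].
  by under eq_fun do rewrite big_nil; exact: expbnd_cst.
by under eq_fun do rewrite big_cons; exact: expbndD.
Qed.

Lemma normc_Qlin_le k (m : n.-tuple R) : normc (Qlin k m) <= 2 * \sum_i `|tnth m i|.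
Proof.
rewrite QlinE// (le_trans (normc_sum _ _ _))// mulr_sumr; apply: ler_sum => i _.
rewrite Normc.normcM normc_real ler_wpM2r// (le_trans (normcB _ _))//.
by rewrite normcX normc_theta expr1n Normc.normc1.
Qed.

Lemma expbnd_Qlin k : expbnd (Qlin k).
Proof.
split.
  rewrite (_ : Qlin k = fun m : n.-tuple R => \sum_(i < n) Qshift k i * (tnth m i)%:C).
    apply: measurable_csum => i; apply: measurable_cM; first exact: measurable_cst.
    by apply: measurable_realC; exact: measurable_tnth.
  by apply/funext => m; rewrite QlinE.
exists 2, 1; split => // m.
rewrite (le_trans (normc_Qlin_le _ _))// ler_wpM2l// mul1r.
by have := expR_ge1Dx (\sum_i `|tnth m i|); lra.
Qed.

Lemma expbnd_gdom K C C' (m : n.-tuple R) :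
  K * expR (C * \sum_i `|tnth m i|) * gdom q%:R C' m = K * gdom q%:R (C + C') m.
Proof.
rewrite -mulrA /gdom -expRD; congr (_ * expR _).
by rewrite mulr_sumr -big_split/=; apply: eq_bigr => i _; ring.
Qed.

Lemma cintegrable_gaussL s f : expbnd f ->
  cintegrable (lebt n) (fun m => f m * (phi_cst%:C * gform q%:R 1 s m)).
Proof.
move=> [mf [K [C [K0 C0 h]]]].
have ig := integrable_gdom n (C + \sum_i normc (s i)) q0.
apply: (@cintegrable_le _ _ _ _ _
  (fun m => (`|phi_cst| * K) * gdom q%:R (C + \sum_i normc (s i)) m)).
- apply: measurable_cM => //; apply: measurable_cM; first exact: measurable_cst.
  exact: measurable_gform.
- exact: (@integrableZl _ _ _ (lebt n) setT measurableT (`|phi_cst| * K) _ ig).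
- move=> m; rewrite -mulrA -expbnd_gdom !Normc.normcM normc_real mulrCA ler_wpM2l//.
  by rewrite ler_pM ?normc_ge0// normc_gform_le.
Qed.

Lemma gaussL_shift s k f : expbnd f ->
  ex2 (fun t => gaussL (fun i => s i + t%:C * Qshift k i) f) (gaussL s f)
    (gaussL s (fun m => f m * Qlin k m)).
Proof.
move=> gf; have [mf [K [C [K0 C0 h]]]] := gf.
(* 6 = 3 * 2: the factor 3 is the one required by [ex2_cintegral], the factor 2 is the bound on
   [Qlin k] by the sum of the absolute coordinates. *)
have ig := integrable_gdom n (6 + (C + \sum_i normc (s i))) q0.
have := @ex2_cintegral R _ _ (lebt n)
  (fun m => f m * (phi_cst%:C * gform q%:R 1 s m)) (Qlin k)
  (fun m => (`|phi_cst| * K) * gdom q%:R (6 + (C + \sum_i normc (s i))) m)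
  _ (expbnd_Qlin k).1
  (@integrableZl _ _ _ (lebt n) setT measurableT (`|phi_cst| * K) _ ig).
have mg : measurable_fun setT (fun m => f m * (phi_cst%:C * gform q%:R 1 s m)).
  apply: measurable_cM => //; apply: measurable_cM; first exact: measurable_cst.
  exact: measurable_gform.
move=> /(_ mg) H.
have e : cintegral (lebt n) (fun x => f x * (phi_cst%:C * gform q%:R 1 s x) *
    Qlin k x) = gaussL s (fun m => f m * Qlin k m).
  by apply: eq_cintegral => m; ring.
rewrite e in H; apply: (ex2_ext _ (H _)).
    move=> t; apply: eq_cintegral => m; rewrite -!mulrA; congr (_ * (_ * _)).
    rewrite /gform -cexpD; congr cexp; rewrite QlinE// mulr_sumr.
    rewrite addrAC -big_split/=; congr (_ - _).
    by apply: eq_bigr => i _; ring.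
  move=> m; rewrite mulrC.
  apply: (@le_trans _ _ (expR (6 * \sum_i `|tnth m i|) *
      (`|phi_cst| * (K * gdom q%:R (C + \sum_i normc (s i)) m)))).
    rewrite ler_pM ?expR_ge0 ?normc_ge0//.
      by rewrite ler_expR; have := normc_Qlin_le k m; lra.
    rewrite -expbnd_gdom !Normc.normcM normc_real mulrCA ler_wpM2l//.
    by rewrite ler_pM ?normc_ge0// normc_gform_le.
  rewrite -[leRHS]expbnd_gdom le_eqVlt; apply/orP; left; apply/eqP.
  move: (gdom _ _ m) (expR _) => G u; ring.
Qed.

Definition kapm (s : 'I_n -> R[i]) (mu : multinom n) : R[i] :=
  \prod_k (kap s k ^+ mu k / (mu k)`!%:R).

Lemma kapm_add (s : 'I_n -> R[i]) (mu : multinom n) k : (mu k).+1%:R * kapm s (mnm_add mu (mnm1 k)) =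
  kap s k * kapm s mu.
Proof.
rewrite /kapm (bigD1 k)//= [in RHS](bigD1 k)//= !mulrA; congr (_ * _); last first.
  apply: eq_bigr => j jk; rewrite mnmDE mnm1E eq_sym (negbTE jk) addn0//.
rewrite mnmDE mnm1E eqxx addn1 exprS factS natrM; field.
by rewrite nat1r !pnatr_eq0 -!lt0n fact_gt0.
Qed.

(** [kap] is affine along the shift with slope [kap (Qshift k)], so this is the product rule. A zero
    exponent gives a zero term, in agreement with the default 0 used where the unit vector cannot be
    subtracted. *)
Lemma kapm_shift (s : 'I_n -> R[i]) (k : 'I_n) (mu : multinom n) :
  ex2 (fun t => kapm (fun i => s i + t%:C * Qshift k i) mu) (kapm s mu)
    (\sum_j - Qbeta k j *
       (if (0 < mu j)%N then kapm s (mnm_sub mu (mnm1 j)) else 0)).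
Proof.
have h j : ex2 (fun t => kap (fun i => s i + t%:C * Qshift k i) j ^+ mu j / (mu j)`!%:R)
    (kap s j ^+ mu j / (mu j)`!%:R)
    ((mu j)`!%:R^-1 * ((mu j)%:R * kap s j ^+ (mu j).-1 * kap (Qshift k) j)).
  have := ex2Ml ((mu j)`!%:R^-1) (ex2X (mu j) (ex2_lin (kap s j) (kap (Qshift k) j))).
  by rewrite mulrC; apply: ex2_ext => t; rewrite kap_lin mulrC.
have := ex2_prod h; rewrite [X in ex2 _ _ X -> _](_ : _ =
  (\sum_j - Qbeta k j *
       (if (0 < mu j)%N then kapm s (mnm_sub mu (mnm1 j)) else 0))); first exact.
apply: eq_bigr => j _; rewrite -kap_Qshift//.
case: ifPn => [mj|]; last first.
  by rewrite -eqn0Ngt => /eqP ->; rewrite !mul0r !mulr0 mul0r.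
rewrite /kapm [in RHS](bigD1 j)//=.
have -> : \prod_(i < n | i != j) (kap s i ^+ mnm_sub mu (mnm1 j) i /
    (mnm_sub mu (mnm1 j) i)`!%:R) =
    \prod_(i < n | i != j) (kap s i ^+ mu i / (mu i)`!%:R).
  by apply: eq_bigr => i ij; rewrite mnmBE mnm1E eq_sym (negbTE ij) subn0.
rewrite [in RHS]mulrA; congr (_ * _).
rewrite mnmBE mnm1E eqxx subn1; case: (mu j) mj => // i _ /=.
rewrite factS natrM; field.
by rewrite nat1r !pnatr_eq0 -!lt0n fact_gt0.
Qed.

Lemma covB_lin (s w : 'I_n -> R[i]) (t : R[i]) :
  covB (fun i => s i + t * w i) (fun i => s i + t * w i) =
  covB s s + 2 * t * covB s w + t ^+ 2 * covB w w.
Proof.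
rewrite /covB !big_split/= -!mulr_sumr.
set S := \sum_i s i; set S' := \sum_i w i.
rewrite (eq_bigr (fun i => s i * s i + (2 * t * (s i * w i) + t ^+ 2 * (w i * w i))));
  last by move=> i _; ring.
rewrite !big_split/= -!mulr_sumr; ring.
Qed.

Lemma covB_shift (s : 'I_n -> R[i]) (k : 'I_n) (t : R) :
  cexp (2^-1 * covB (fun i => s i + t%:C * Qshift k i) (fun i => s i + t%:C * Qshift k i)) =
  cexp (2^-1 * covB s s) *
  cexp (t%:C * kap s k + t%:C ^+ 2 * (2^-1 * covB (Qshift k) (Qshift k))).
Proof.
rewrite -cexpD -(covB_Qshift q_gt1); congr cexp; rewrite covB_lin.
by field.
Qed.

Lemma gaussL_Qm mu : expbnd (Qm mu) /\
  forall s, gaussL s (Qm mu) = cexp (2^-1 * covB s s) * kapm s mu.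
Proof.
(* Strong induction on the degree, since the recurrence reaches both one and two degrees down. *)
have [N] := ubnP (mdeg mu); elim: N mu => // N IH mu muN.
have [/eqP mu0|mu0] := boolP (mu == mnm0).
  have Q1 : Qm mu = (fun=> 1) :> (n.-tuple R -> R[i]).
    by apply/funext => m; rewrite mu0 Qm0.
  split; first by rewrite Q1; exact: expbnd_cst.
  move=> s; rewrite Q1 gaussL1 /kapm big1 ?mulr1// => k _.
  by rewrite mu0 mnm0E expr0 fact0 divr1.
have [k muk] : exists k, (0 < mu k)%N.
  apply/existsP; move: mu0; apply: contraR => /existsPn h; apply/eqP/mnmP => i.
  by rewrite mnm0E; apply/eqP; rewrite eqn0Ngt h.
pose nu := mnm_sub mu (mnm1 k).
have muE : mu = mnm_add nu (mnm1 k).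
  by rewrite submK//; apply/mnm_lepP => l; rewrite mnm1E; case: eqP => // <-.
have nuN : (mdeg nu < N)%N by move: muN; rewrite muE mdegD mdeg1 addn1 ltnS.
have [bnu Lnu] := IH _ nuN.
have nujN j : (mdeg (mnm_sub nu (mnm1 j)) < N)%N by exact: leq_ltn_trans (mdegB _ _) nuN.
pose G j m : R[i] := if (0 < nu j)%N then Qm (mnm_sub nu (mnm1 j)) m else 0.
have bG j : expbnd (G j).
  by rewrite /G; case: (0 < nu j)%N; [exact: (IH _ (nujN j)).1|exact: expbnd_cst].
have LG j s : gaussL s (G j) = cexp (2^-1 * covB s s) *
    (if (0 < nu j)%N then kapm s (mnm_sub nu (mnm1 j)) else 0).
  rewrite /G; case: (0 < nu j)%N; first by rewrite (IH _ (nujN j)).2.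
  rewrite mulr0 /gaussL -[RHS](cintegral_cst0 (lebt n)).
  by apply: eq_cintegral => m; rewrite mul0r.
have nu1 : (nu k).+1%:R != 0 :> R[i] by rewrite pnatr_eq0.
have QmE : Qm mu = (fun m => (nu k).+1%:R^-1 *
    (Qlin k m * Qm nu m + \sum_j Qbeta k j * G j m)).
  apply/funext => m; apply: (mulfI nu1).
  by rewrite muE Qm_rec// mulrA divff// mul1r.
have bA : expbnd (fun m => Qm nu m * Qlin k m).
  by apply: expbndM => //; exact: expbnd_Qlin.
have bS : expbnd (fun m => \sum_j Qbeta k j * G j m).
  by apply: expbnd_sum => j; apply: expbndM => //; exact: expbnd_cst.
split.
  rewrite QmE; apply: expbndM; first exact: expbnd_cst.
  by apply: expbndD => //; apply: expbndM => //; exact: expbnd_Qlin.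
move=> s.
(* Two expansions of the same function of t: the one of [gaussL_shift] has the wanted integral as
   slope, the other comes from the induction hypothesis at the shifted parameter. *)
have LA : gaussL s (fun m => Qm nu m * Qlin k m) = cexp (2^-1 * covB s s) *
    (kap s k * kapm s nu - \sum_j Qbeta k j *
     (if (0 < nu j)%N then kapm s (mnm_sub nu (mnm1 j)) else 0)).
  have h1 := ex2Ml (cexp (2^-1 * covB s s))
    (ex2M (ex2_cexp (kap s k) (2^-1 * covB (Qshift k) (Qshift k))) (kapm_shift s k nu)).
  have h2 := @ex2_ext _ _
    (fun t => gaussL (fun i => s i + t%:C * Qshift k i) (Qm nu)) _ _ _ h1.
  rewrite (ex2_uniq (gaussL_shift s k bnu) (h2 _)); last first.
    by move=> t; rewrite mulrA -covB_shift Lnu.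
  congr (_ * _); rewrite mul1r addrC; congr (_ + _).
  by rewrite -sumrN; apply: eq_bigr => j _; rewrite mulNr.
have LE : gaussL s (Qm mu) = (nu k).+1%:R^-1 *
    (gaussL s (fun m => Qm nu m * Qlin k m) + \sum_j Qbeta k j * gaussL s (G j)).
  transitivity (gaussL s (fun m => (nu k).+1%:R^-1 *
      (Qm nu m * Qlin k m + \sum_j Qbeta k j * G j m))).
    by apply: eq_cintegral => m; rewrite QmE [Qlin k m * _]mulrC.
  have i1 := cintegrable_gaussL s bA; have i2 j := cintegrable_gaussL s (bG j).
  rewrite /gaussL -(eq_bigr _ (fun j _ => cintegralZl _ (i2 j))).
  rewrite -cintegral_sum; last by move=> j; exact: cintegrableZl.
  rewrite -cintegralD//; last by apply: cintegrable_sum => j; exact: cintegrableZl.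
  rewrite -cintegralZl; last first.
    apply: cintegrableD => //; apply: cintegrable_sum => j; exact: cintegrableZl.
  apply: eq_cintegral => m; rewrite -!mulrA mulrDl mulr_suml; congr (_ * (_ + _)).
    exact/esym/mulrA.
  by apply: eq_bigr => j _; exact/esym/mulrA.
apply: (mulfI nu1); rewrite LE mulrA divff// mul1r LA.
have -> : \sum_j Qbeta k j * gaussL s (G j) = cexp (2^-1 * covB s s) *
    \sum_j Qbeta k j * (if (0 < nu j)%N then kapm s (mnm_sub nu (mnm1 j)) else 0).
  by rewrite mulr_sumr; apply: eq_bigr => j _; rewrite LG mulrCA.
(* The [Qbeta] terms of the recurrence cancel those produced by differentiating [kapm]; only the
   factor [kap s k] survives. *)
by rewrite -mulrDr subrK muE [RHS]mulrCA kapm_add.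
Qed.

End gaussian_moments.

(** * Unconditional sums *)

Section fubini_ae.
Context {R : realType} d1 d2 (T1 : measurableType d1) (T2 : measurableType d2).
Variables (m1 : {sigma_finite_measure set T1 -> \bar R})
  (m2 : {sigma_finite_measure set T2 -> \bar R}).

(** Real-valued inner integrals are [fine] of extended ones. An integrable function is finite almost
    everywhere, so [fine] changes neither integrability nor the integral. *)
Let Rfine d (T : measurableType d) (m : {measure set T -> \bar R}) (F : T -> \bar R) :
  m.-integrable setT F ->
  m.-integrable setT (EFin \o (fine \o F)) /\
  (\int[m]_x (fine (F x))%:E = \int[m]_x F x)%E.
Proof.
move=> iF; have mF := measurable_int _ iF.
have mfF : measurable_fun setT (EFin \o (fine \o F)).
  by apply/measurable_EFinP; exact: measurableT_comp.
split; last first.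
  apply: ae_eq_integral => //.
  have [N [mN N0 hN]] := integrable_ae measurableT iF.
  exists N; split => // x /= nx; apply: hN => /= Fx; apply: nx => _.
  by rewrite fineK// Fx.
apply: le_integrable iF => // x _ /=.
by case: (F x) => [r||] //=; rewrite normr0 leey.
Qed.

Lemma integrable_fubiniR (f : T1 * T2 -> R) : (m1 \x m2)%E.-integrable setT (EFin \o f) ->
  [/\ {ae m1, forall x, m2.-integrable setT (fun y => (f (x, y))%:E)},
   m1.-integrable setT (fun x => (\int[m2]_y f (x, y))%:E) &
   \int[m1]_x \int[m2]_y f (x, y) = \int[(m1 \x m2)%E]_z f z].
Proof.
move=> ifi; have [h1 h2] := Rfine (integrable_fubini_F ifi).
split => //; last by rewrite /Rintegral h2 integral12_prod_meas1.
exact: (ae_integrable1 ifi).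
Qed.

Lemma integrable_fubiniL (f : T1 * T2 -> R) : (m1 \x m2)%E.-integrable setT (EFin \o f) ->
  [/\ {ae m2, forall y, m1.-integrable setT (fun x => (f (x, y))%:E)},
   m2.-integrable setT (fun y => (\int[m1]_x f (x, y))%:E) &
   \int[m2]_y \int[m1]_x f (x, y) = \int[(m1 \x m2)%E]_z f z].
Proof.
move=> ifi; have mf := measurable_int _ ifi.
have iG : m2.-integrable setT (fubini_G m1 (EFin \o f)).
  apply/integrableP; split; first exact: (measurable_fubini_G ifi).
  apply: le_lt_trans ((integrable21ltyP m1 m2 mf).1 ifi).
  apply: ge0_le_integral => //.
  - by apply: measurableT_comp => //; exact: (measurable_fubini_G ifi).
  - apply: (measurable_fun_fubini_tonelli_G (abse \o (EFin \o f))) => //=.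
    exact: measurableT_comp.
  - move=> y _; apply: le_abse_integral => //.
    exact: measurableT_comp mf (pair2_measurable y).
have [h1 h2] := Rfine iG.
split => //; last by rewrite /Rintegral h2 integral21_prod_meas1.
exact: (ae_integrable2 ifi).
Qed.

Lemma cintegral_fubiniR (f : T1 * T2 -> R[i]) : cintegrable (m1 \x m2)%E f ->
  [/\ {ae m1, forall x, cintegrable m2 (fun y => f (x, y))},
   cintegrable m1 (fun x => cintegral m2 (fun y => f (x, y))) &
   cintegral m1 (fun x => cintegral m2 (fun y => f (x, y))) =
   cintegral (m1 \x m2)%E f].
Proof.
move=> [/integrable_fubiniR[a1 b1 c1] /integrable_fubiniR[a2 b2 c2]]; split.
- by apply: filterS2 a1 a2 => x hx1 hx2; split.
- by split.
- exact: complex_ext.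
Qed.

Lemma cintegral_fubiniL (f : T1 * T2 -> R[i]) : cintegrable (m1 \x m2)%E f ->
  [/\ {ae m2, forall y, cintegrable m1 (fun x => f (x, y))},
   cintegrable m2 (fun y => cintegral m1 (fun x => f (x, y))) &
   cintegral m2 (fun y => cintegral m1 (fun x => f (x, y))) =
   cintegral (m1 \x m2)%E f].
Proof.
move=> [/integrable_fubiniL[a1 b1 c1] /integrable_fubiniL[a2 b2 c2]]; split.
- by apply: filterS2 a1 a2 => x hx1 hx2; split.
- by split.
- exact: complex_ext.
Qed.

End fubini_ae.

Lemma cintegral_ae_eq {R : realType} d (T : measurableType d)
    (m : {measure set T -> \bar R}) (f g : T -> R[i]) : measurable_fun setT f ->
  {ae m, forall x, f x = g x} -> cintegrable m g ->
  cintegrable m f /\ cintegral m f = cintegral m g.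
Proof.
move=> mf fg cg; have mg := cintegrable_measurable cg; case: (cg) => gR gI.
have aux (h : R[i] -> R) : measurable_fun setT (fun x => h (f x)) ->
    m.-integrable setT (fun x => (h (g x))%:E) ->
    m.-integrable setT (fun x => (h (f x))%:E) /\
    \int[m]_x h (f x) = \int[m]_x h (g x).
  move=> mhf ihg.
  have mhE : measurable_fun setT (fun x => (h (f x))%:E) by exact/measurable_EFinP.
  have ae : ae_eq m setT (fun x => (h (f x))%:E) (fun x => (h (g x))%:E).
    by apply: filterS fg => x -> _.
  split.
    apply/integrableP; split => //; have /integrableP[mhg] := ihg.
    apply: le_lt_trans; rewrite le_eqVlt; apply/orP; left; apply/eqP.
    apply: ae_eq_integral => //; try exact: measurableT_comp.
    by apply: filterS fg => x -> _.
  by congr fine; apply: ae_eq_integral => //; exact: measurable_int ihg.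
have [i1 e1] := aux _ (measurable_cRe mf) gR.
have [i2 e2] := aux _ (measurable_cIm mf) gI.
by split; [split|exact: complex_ext].
Qed.

(** Lets the counting measure be a factor of a product measure, so that exchanging a sum with an
    integral or with another sum is a case of Fubini. *)
HB.instance Definition _ (R : realType) := Measure_isSigmaFinite.Build _ _ _
  (@counting nat R) (sigma_finite_counting R).

Section csum_counting.
Context {R : realType} {I : countType}.
Local Notation count := (@counting nat R).

(* Enumeration of a family over a countable type along [pickle_inv], with the
   filler [z] at the indices that code nothing. *)
Definition useq (V : Type) (z : V) (f : I -> V) (k : nat) : V := oapp f z (pickle_inv k).

Lemma useqE (V W : Type) (h : V -> W) (z : V) (f : I -> V) k :
  h (useq z f k) = useq (h z) (fun i => h (f i)) k.
Proof. by rewrite /useq; case: pickle_inv. Qed.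

Lemma esum_count (g : I -> \bar R) : (forall i, 0 <= g i)%E ->
  (\esum_(i in [set: I]) g i = \int[count]_k useq 0 g k)%E.
Proof.
move=> g0; have u0 k : (0 <= useq 0 g k)%E by rewrite /useq; case: pickle_inv => /=.
rewrite ge0_integral_count// nneseries_esumT//.
rewrite (esumID (range (@pickle I)))//.
rewrite [X in (_ + X)%E]esum1 ?adde0; last first.
  move=> k [_ /= nk]; rewrite /useq; case e : (pickle_inv k) => [i|] //=.
  by exfalso; apply: nk; exists i => //; have := @pickle_invK I k; rewrite /ocancel e.
rewrite setTI esum_image; last by move=> i j _ _; exact: (pcan_inj pickleK_inv).
by apply: eq_esum => i _; rewrite /useq pickleK_inv.
Qed.

Lemma summable_countP (f : I -> R) : summable [set: I] (EFin \o f) <->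
  count.-integrable setT (EFin \o useq 0 f).
Proof.
rewrite /summable esum_count//.
have e : (\int[count]_k useq 0 (fun i => `|(EFin \o f) i|) k =
    \int[count]_k `|(EFin \o useq 0%R f) k|)%E.
  apply: eq_integral => k _; rewrite /=.
  by rewrite (useqE (fun r : R => `|r|%:E)) normr0.
rewrite e; split => [h|/integrableP[]//].
by apply/integrableP; split.
Qed.

Lemma rsum_count (f : I -> R) : summable [set: I] (EFin \o f) ->
  rsum f = \int[count]_k useq 0 f k.
Proof.
move=> sf; rewrite /rsum !esum_count//.
have /summable_countP iu := sf.
rewrite /Rintegral (integralE count setT (fun k => (useq 0 f k)%:E)).
rewrite [RHS]fineB.
- congr (fine _ - fine _); apply: eq_integral => k _.
    by rewrite !funeposE /= /useq; case: pickle_inv => //= [i|]; rewrite ?funeposE// maxxx.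
  by rewrite !funenegE /= /useq; case: pickle_inv => //= [i|]; rewrite ?funenegE//= oppr0 maxxx.
- by apply: integrable_pos_fin_num.
- by apply: integrable_neg_fin_num.
Qed.

Lemma csummable_countP (f : I -> R[i]) : csummable f <->
  cintegrable count (useq 0 f).
Proof.
have eR : (fun k => (cRe (useq 0 f k))%:E) = EFin \o useq 0 (fun i => cRe (f i)).
  by apply/funext => k /=; rewrite (useqE (@complex.Re R)).
have eI : (fun k => (cIm (useq 0 f k))%:E) = EFin \o useq 0 (fun i => cIm (f i)).
  by apply/funext => k /=; rewrite (useqE (@complex.Im R)).
rewrite /csummable /cintegrable eR eI.
by split => -[/summable_countP h1 /summable_countP h2].
Qed.

Lemma csum_count (f : I -> R[i]) : csummable f ->
  csum f = cintegral count (useq 0 f).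
Proof.
move=> [sR sI]; apply: complex_ext => /=; rewrite rsum_count//.
  by apply: eq_Rintegral => k _; rewrite (useqE (@complex.Re R)).
by apply: eq_Rintegral => k _; rewrite (useqE (@complex.Im R)).
Qed.

Lemma csummable_le (f : I -> R[i]) (g : I -> R) : summable [set: I] (EFin \o g) ->
  (forall i, normc (f i) <= g i) -> csummable f.
Proof.
move=> sg fg; split; apply: le_lt_trans sg; apply: le_esum => i _ /=;
  rewrite lee_fin; apply: le_trans (ler_norm _).
  exact: le_trans (ler_cRe_normc _) (fg i).
exact: le_trans (ler_cIm_normc _) (fg i).
Qed.

Lemma csummable_normc (f : I -> R[i]) : csummable f ->
  summable [set: I] (fun i => (normc (f i))%:E).
Proof.
move=> /csummable_countP/cintegrable_normc h; apply/summable_countP.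
apply: eq_integrable h => // k _ /=.
by rewrite (useqE (@Normc.normc R)) Normc.normc0.
Qed.

Lemma csummableZ c (f : I -> R[i]) : csummable f -> csummable (fun i => c * f i).
Proof.
move=> /csummable_countP h; apply/csummable_countP.
apply: eq_cintegrable (cintegrableZl c h) => k.
by rewrite (useqE (fun z => c * z)) mulr0.
Qed.

Lemma csumZ c (f : I -> R[i]) : csummable f ->
  csum (fun i => c * f i) = c * csum f.
Proof.
move=> sf; rewrite !csum_count//; last exact: csummableZ.
rewrite -cintegralZl; last exact/csummable_countP.
by apply: eq_cintegral => k; rewrite (useqE (fun z => c * z)) mulr0.
Qed.

Lemma summableZ (c : R) (f : I -> R) : summable [set: I] (EFin \o f) ->
  summable [set: I] (EFin \o (fun i => c * f i)).
Proof.
move=> /summable_countP h; apply/summable_countP.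
have := @integrableZl _ _ _ count setT measurableT c _ h.
apply: eq_integrable => // k _.
by rewrite /= -EFinM; congr EFin; rewrite (useqE (fun z => c * z)) mulr0.
Qed.

Lemma rsumZ (c : R) (f : I -> R) : summable [set: I] (EFin \o f) ->
  rsum (fun i => c * f i) = c * rsum f.
Proof.
move=> sf; rewrite !rsum_count//; last exact: summableZ.
rewrite -RintegralZl//; last exact/summable_countP.
by apply: eq_Rintegral => k _; rewrite (useqE (fun z => c * z)) mulr0.
Qed.

Lemma rsumD (f g : I -> R) : summable [set: I] (EFin \o f) ->
  summable [set: I] (EFin \o g) -> rsum (fun i => f i + g i) = rsum f + rsum g.
Proof.
move=> sf sg; rewrite !rsum_count//; last first.
  by have := summableD sf sg.
rewrite -RintegralD//; [|exact/summable_countP|exact/summable_countP].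
by apply: eq_Rintegral => k _; rewrite /useq; case: pickle_inv => //=; rewrite addr0.
Qed.

Section swap.
Context d (T : measurableType d) (m : {sigma_finite_measure set T -> \bar R}).

Lemma measurable_rsum (f : I -> T -> R) : (forall i, measurable_fun setT (f i)) ->
  measurable_fun setT (fun x => rsum (fun i => f i x)).
Proof.
move=> mf.
have aux (g : I -> T -> \bar R) : (forall i, measurable_fun setT (g i)) ->
    (forall i x, 0 <= g i x)%E ->
    measurable_fun setT (fun x => fine (\esum_(i in [set: I]) g i x)).
  move=> mg g0; apply: measurableT_comp => //.
  under eq_fun do rewrite esum_count//.
  apply: (eq_measurable_fun (fun x => \sum_(k <oo) useq 0%E (fun i => g i x) k)%E).
    move=> x _; rewrite ge0_integral_count// => k.
    by rewrite /useq; case: pickle_inv => /=.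
  apply: ge0_emeasurable_sum => [k x _ _|k _].
    by rewrite /useq; case: pickle_inv => /=.
  by rewrite /useq; case: pickle_inv => [i|] //=; exact: measurable_cst.
apply: measurable_funB; apply: aux => //.
- move=> i; under eq_fun do rewrite funeposE.
  by apply: measurable_maxe => //; exact/measurable_EFinP.
- move=> i; under eq_fun do rewrite funenegE.
  by apply: measurable_maxe => //; apply: measurableT_comp => //; exact/measurable_EFinP.
Qed.

Lemma measurable_csumI (f : I -> T -> R[i]) : (forall i, measurable_fun setT (f i)) ->
  measurable_fun setT (fun x => csum (fun i => f i x)).
Proof.
move=> mf; apply/measurable_complexP; split.
  by apply: measurable_rsum => i; exact: measurable_cRe.
by apply: measurable_rsum => i; exact: measurable_cIm.
Qed.

Lemma measurable_nat_prod (F : nat * T -> R) :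
  (forall k, measurable_fun setT (fun x => F (k, x))) -> measurable_fun setT F.
Proof.
move=> mF _ B mB; rewrite setTI.
have -> : F @^-1` B = \bigcup_k ([set k] `*` [set x | B (F (k, x))]).
  apply/seteqP; split => [[k x]/= Bx|[k x] [j _ [/= -> //]]].
  by exists k.
apply: bigcup_measurable => k _; apply: measurableX => //.
by have := mF k measurableT B mB; rewrite setTI.
Qed.

(** Fubini for the product of the counting measure with m; summability of the bounds on the
    integrals of the norms is exactly integrability on the product. *)
Lemma cintegral_csum (f : I -> T -> R[i]) (B : I -> R) :
  (forall i, measurable_fun setT (f i)) ->
  summable [set: I] (EFin \o B) ->
  (forall i, \int[m]_x (normc (f i x))%:E <= (B i)%:E)%E ->
  [/\ {ae m, forall x, csummable (fun i => f i x)},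
    cintegrable m (fun x => csum (fun i => f i x)),
    csummable (fun i => cintegral m (f i)) &
    cintegral m (fun x => csum (fun i => f i x)) = csum (fun i => cintegral m (f i))].
Proof.
move=> mf sB fB.
pose F (z : nat * T) : R[i] := useq 0 (fun i => f i z.2) z.1.
have mF : measurable_fun setT F.
  have mk k : measurable_fun setT (fun x => F (k, x)).
    by rewrite /F /= /useq; case: pickle_inv => [i|] //=; exact: measurable_cst.
  apply/measurable_complexP; split; apply: measurable_nat_prod => k /=.
    exact: measurable_cRe.
  exact: measurable_cIm.
pose countS := [the {sigma_finite_measure set nat -> \bar R} of count].
have iF : cintegrable (countS \x m)%E F.
  apply: (@cintegrable_le _ _ _ _ _ (fun z => normc (F z))) => //.
  have mnF : measurable_fun setT (EFin \o (fun z => normc (F z))).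
    by apply/measurable_EFinP; exact: measurable_normc.
  apply/(integrable12ltyP countS m mnF).
  have /summable_countP/integrableP[_] := sB.
  apply: le_lt_trans; apply: ge0_le_integral => //.
  - by move=> k _; apply: integral_ge0.
  - move=> k _ /=; rewrite /F/= /useq; case: pickle_inv => [i|]/=.
      apply: le_trans (le_trans (fB i) _); last by rewrite lee_fin ler_norm.
      rewrite le_eqVlt; apply/orP; left; apply/eqP; apply: eq_integral => x _.
      by rewrite ger0_norm// normc_ge0.
    rewrite integral0_eq ?normr0// => x _.
    by rewrite -[X in (`|X|%:E)]/(normc 0) Normc.normc0 normr0.
have [a1 b1 c1] := cintegral_fubiniR iF; have [a2 b2 c2] := cintegral_fubiniL iF.
have us k : cintegral m (fun x => F (k, x)) = useq 0 (fun i => cintegral m (f i)) k.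
  by rewrite /F /useq /=; case: pickle_inv => //=; rewrite cintegral_cst0.
have s1 : csummable (fun i => cintegral m (f i)).
  by apply/csummable_countP; apply: eq_cintegrable b1 => k; rewrite us.
have ae1 : {ae m, forall x, csummable (fun i => f i x)}.
  by apply: filterS a2 => x hx; apply/csummable_countP; exact: hx.
have mS := measurable_csumI mf.
have cE : {ae m, forall x, csum (fun i => f i x) = cintegral countS (fun k => F (k, x))}.
  by apply: filterS ae1 => x /csum_count.
have [h1 h2] := cintegral_ae_eq mS cE b2.
split => //.
by rewrite h2 c2 -c1 csum_count//; apply: eq_cintegral.
Qed.


End swap.
End csum_counting.

(** * Products of series, the exponential series and multi-index sums *)

Section esums.
Context {R : realType}.

Lemma pickle_inv_nat (k : nat) : pickle_inv k = Some k :> option nat.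
Proof. exact: (@pickleK_inv nat k). Qed.

Lemma cvg_fine_esum (u : nat -> R) : (forall k, 0 <= u k) ->
  summable [set: nat] (EFin \o u) ->
  series u @ \oo --> fine (\esum_(k in [set: nat]) (u k)%:E).
Proof.
move=> u0 su; rewrite -nneseries_esumT; last by move=> k; rewrite lee_fin.
have su' : summable xpredT (EFin \o u).
  by move: su; rewrite /summable; congr (_ < _)%E; congr esum; apply/seteqP.
have := @summable_cvg R xpredT (EFin \o u).
have := @summable_nneseries_lim R xpredT (EFin \o u).
move=> /(_ _ su') ->; last by move=> i _; rewrite lee_fin.
by move=> /(_ _ su') h; apply: h => i _; rewrite lee_fin.
Qed.

Lemma summable_nat (u : nat -> R) : (forall k, 0 <= u k) ->
  cvgn (series u) -> summable [set: nat] (EFin \o u).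
Proof.
move=> u0 cu; rewrite /summable.
under eq_esum do rewrite /= ger0_norm//.
rewrite -nneseries_esumT; last by move=> k; rewrite lee_fin.
rewrite (_ : limn _ = (limn (series u))%:E) ?ltry//.
rewrite -EFin_lim//; congr (limn _); apply/funext => n /=.
by rewrite /series /= sumEFin.
Qed.

Lemma rsum_nat (f : nat -> R) : summable [set: nat] (EFin \o f) ->
  series f @ \oo --> rsum f.
Proof.
move=> sf.
have fp k : 0 <= fine (((EFin \o f)^\+)%E k) by exact: fine_ge0.
have fn k : 0 <= fine (((EFin \o f)^\-)%E k) by exact: fine_ge0.
have Ep k : (fine (((EFin \o f)^\+)%E k))%:E = ((EFin \o f)^\+)%E k.
  by rewrite fineK// funeposE /= -EFin_max.
have En k : (fine (((EFin \o f)^\-)%E k))%:E = ((EFin \o f)^\-)%E k.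
  by rewrite fineK// funenegE /= -EFin_max.
have hp := cvg_fine_esum fp; have hn := cvg_fine_esum fn.
have sp : summable [set: nat] (EFin \o (fun k => fine (((EFin \o f)^\+)%E k))).
  have -> : EFin \o (fun k => fine (((EFin \o f)^\+)%E k)) = ((EFin \o f)^\+)%E.
    exact/funext.
  exact: summable_funepos.
have sn : summable [set: nat] (EFin \o (fun k => fine (((EFin \o f)^\-)%E k))).
  have -> : EFin \o (fun k => fine (((EFin \o f)^\-)%E k)) = ((EFin \o f)^\-)%E.
    exact/funext.
  exact: summable_funeneg.
have -> : series f = series (fun k => fine (((EFin \o f)^\+)%E k)) -
    series (fun k => fine (((EFin \o f)^\-)%E k)).
  apply/funext => n; rewrite /series /= fctE /= -sumrB; apply: eq_bigr => k _.
  by rewrite /= funeposE funenegE /= -!EFin_max /= /Num.max; do 2 case: ifP; lra.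
rewrite /rsum; under eq_esum do rewrite -Ep.
under [X in _ - fine X]eq_esum do rewrite -En.
exact: (cvgB (hp sp) (hn sn)).
Qed.

Lemma esum_useq (I : countType) (g : I -> \bar R) : (forall i, 0 <= g i)%E ->
  (\esum_(i in [set: I]) g i = \esum_(k in [set: nat]) useq 0 g k)%E.
Proof.
move=> g0; rewrite !esum_count//; last first.
  by move=> k; rewrite /useq; case: pickle_inv => /=.
by apply: eq_integral => k _; rewrite [RHS]/useq pickle_inv_nat.
Qed.

(** Expresses an unconditional sum as the limit of partial sums along an enumeration, the form in
    which dominated convergence can be used. *)
Lemma cvg_rsum (I : countType) (f : I -> R) : summable [set: I] (EFin \o f) ->
  series (useq 0 f) @ \oo --> rsum f.
Proof.
move=> sf; have -> : rsum f = rsum (useq 0 f).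
  rewrite /rsum !(@esum_useq I)//; congr (fine _ - fine _); apply: eq_esum => k _.
    by rewrite !funeposE /= /useq; case: pickle_inv => //= [i|]; rewrite ?funeposE// maxxx.
  by rewrite !funenegE /= /useq; case: pickle_inv => //= [i|]; rewrite ?funenegE//= oppr0 maxxx.
apply: rsum_nat; move: sf; rewrite /summable esum_useq//.
congr (_ < _)%E; apply: eq_esum => k _ /=.
by rewrite (useqE (fun r : R => `|r|%:E)) normr0.
Qed.

Lemma csum_nat (f : nat -> R[i]) : csummable f ->
  cintegrable (@counting nat R) f /\ csum f = cintegral (@counting nat R) f.
Proof.
move=> sf; have fE k : f k = useq 0 f k by rewrite /useq pickle_inv_nat.
split; first by rewrite (funext fE); exact/csummable_countP.
by rewrite csum_count//; exact/esym/eq_cintegral.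
Qed.

Lemma esum_bij (I J : choiceType) (e : I -> J) (a : J -> \bar R) : bijective e ->
  (\esum_(j in [set: J]) a j = \esum_(i in [set: I]) a (e i))%E.
Proof. by move=> be; apply: reindex_esum; rewrite setTT_bijective. Qed.

Lemma csum_bij (I J : choiceType) (e : I -> J) (f : J -> R[i]) : bijective e ->
  csum (fun i => f (e i)) = csum f.
Proof.
move=> be; rewrite /csum /rsum !(esum_bij _ be); congr (_ +i* _);
by congr (fine _ - fine _); apply: eq_esum => i _; rewrite ?funeposE ?funenegE.
Qed.

Lemma csummable_bij (I J : choiceType) (e : I -> J) (f : J -> R[i]) : bijective e ->
  csummable f -> csummable (fun i => f (e i)).
Proof. by move=> be [h1 h2]; split; move: h1 h2; rewrite /summable !(esum_bij _ be). Qed.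

(** Tonelli for [esum], applied to positive and negative parts separately; finiteness of each inner
    sum follows from that of the double sum. *)
Lemma rsum_pair (I J : countType) (f : I * J -> R) : summable [set: I * J] (EFin \o f) ->
  [/\ forall i, summable [set: J] (fun j => (f (i, j))%:E),
   summable [set: I] (fun i => (rsum (fun j => f (i, j)))%:E) &
   rsum f = rsum (fun i => rsum (fun j => f (i, j)))].
Proof.
move=> sf.
have pairE (g : I * J -> \bar R) : (forall p, 0 <= g p)%E ->
    (\esum_(p in [set: I * J]) g p =
     \esum_(i in [set: I]) \esum_(j in [set: J]) g (i, j))%E.
  move=> g0; rewrite (esum_esum (fun i j _ _ => g0 (i, j))).
  rewrite (_ : _ `*`` _ = [set: I * J]); last by apply/seteqP; split.
  by apply: eq_esum => -[].
have posE (g : I * J -> R) : (forall p, 0 <= g p) -> summable setT (EFin \o g) ->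
    let G i := fine (\esum_(j in [set: J]) (g (i, j))%:E)%E in
    [/\ forall i, (G i)%:E = (\esum_(j in [set: J]) (g (i, j))%:E)%E,
      forall i, 0 <= G i, summable [set: I] (EFin \o G) &
      (\esum_(i in [set: I]) (G i)%:E = \esum_(p in [set: I * J]) (g p)%:E)%E].
  move=> g0 sg G.
  have gE0 p : (0 <= (g p)%:E)%E by rewrite lee_fin.
  have sgE : (\esum_(p in [set: I * J]) (g p)%:E < +oo)%E.
    by move: sg; rewrite /summable; under eq_esum do rewrite /= ger0_norm//.
  have GE i : (G i)%:E = (\esum_(j in [set: J]) (g (i, j))%:E)%E.
    rewrite fineK// ge0_fin_numE; last exact: esum_ge0.
    apply: le_lt_trans sgE; rewrite pairE// (esumID [set i]); last first.
      by move=> *; apply: esum_ge0.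
    by rewrite setTI esum_set1 ?leeDl ?esum_ge0// => *; exact: esum_ge0.
  have G0 k : 0 <= G k by apply: fine_ge0; apply: esum_ge0.
  have E : (\esum_(i in [set: I]) (G i)%:E = \esum_(p in [set: I * J]) (g p)%:E)%E.
    by rewrite pairE//; apply: eq_esum => i _; rewrite GE.
  split => //; rewrite /summable; under eq_esum do rewrite /= ger0_norm//.
  by rewrite E.
pose p z := Num.max (f z) 0; pose n z := Num.max (- f z) 0.
have p0 z : 0 <= p z by rewrite /p le_max lexx orbT.
have n0 z : 0 <= n z by rewrite /n le_max lexx orbT.
have pE z : ((EFin \o f)^\+)%E z = (p z)%:E by rewrite funeposE /= -EFin_max.
have nE z : ((EFin \o f)^\-)%E z = (n z)%:E by rewrite funenegE /= -EFin_max.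
have sp : summable setT (EFin \o p).
  have -> : EFin \o p = ((EFin \o f)^\+)%E by apply/funext => z; rewrite pE.
  exact: summable_funepos.
have sn : summable setT (EFin \o n).
  have -> : EFin \o n = ((EFin \o f)^\-)%E by apply/funext => z; rewrite nE.
  exact: summable_funeneg.
have [P1 P2 P3 P4] := posE _ p0 sp; have [N1 N2 N3 N4] := posE _ n0 sn.
set A := fun i : I => fine _ in P1 P2 P3 P4.
set B := fun i : I => fine _ in N1 N2 N3 N4.
have innerE i : rsum (fun j => f (i, j)) = A i - B i.
  rewrite /rsum; congr (fine _ - fine _); apply: eq_esum => j _; first by rewrite -pE !funeposE.
  by rewrite -nE !funenegE.
have eI : (fun i => rsum (fun j => f (i, j))) = (fun i => A i + -1 * B i).
  by apply/funext => i; rewrite innerE mulN1r.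
have sB := summableZ (-1) N3.
split.
- move=> i; rewrite /summable.
  apply: (@le_lt_trans _ _ (\esum_(j in [set: J]) ((p (i, j))%:E + (n (i, j))%:E))%E).
    apply: le_esum => j _; rewrite -EFinD lee_fin /p /n /Num.max.
    by do 2 case: ifPn; rewrite -?leNgt => h1 h2; rewrite ler_norml; lra.
  rewrite esumD; [|by move=> j _; rewrite lee_fin|by move=> j _; rewrite lee_fin].
    by apply: lte_add_pinfty; [rewrite -P1 ltry|rewrite -N1 ltry].
- rewrite (_ : (fun i => _) = (EFin \o (fun i => A i + -1 * B i))).
    exact: (summableD P3 sB).
  by apply/funext => i; rewrite /= innerE mulN1r.
- rewrite eI (rsumD P3 sB) rsumZ// mulN1r.
  have ge0 (C : I -> R) : (forall i, 0 <= C i) -> rsum C = fine (\esum_(i in [set: I]) (C i)%:E).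
    move=> C0; rewrite /rsum [X in _ - fine X]esum1 ?subr0 => [|i _]; last first.
      by rewrite funenegE /= -EFin_max; congr EFin; apply/max_idPr; rewrite oppr_le0.
    congr fine; apply: eq_esum => i _.
    by rewrite funeposE /= -EFin_max; congr EFin; apply/max_idPl.
  rewrite !ge0// P4 N4 /rsum; congr (fine _ - fine _); apply: eq_esum => z _.
    exact: pE.
  exact: nE.
Qed.

Lemma csum_pair (I J : countType) (f : I * J -> R[i]) : csummable f ->
  [/\ forall i, csummable (fun j => f (i, j)),
   csummable (fun i => csum (fun j => f (i, j))) &
   csum f = csum (fun i => csum (fun j => f (i, j)))].
Proof.
move=> [/rsum_pair[a1 b1 c1] /rsum_pair[a2 b2 c2]]; split.
- by move=> i; split; [exact: a1|exact: a2].
- by split.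
- by apply: complex_ext.
Qed.

Lemma esumZl (I : countType) (c : R) (g : I -> \bar R) : 0 <= c ->
  (forall i, 0 <= g i)%E ->
  (\esum_(i in [set: I]) (c%:E * g i) = c%:E * \esum_(i in [set: I]) g i)%E.
Proof.
move=> c0 g0; have u0 k : (0 <= useq 0 g k)%E by rewrite /useq; case: pickle_inv => /=.
rewrite !esum_count// => [|i]; last by rewrite mule_ge0// lee_fin.
rewrite -ge0_integralZl//; apply: eq_integral => k _.
by rewrite (useqE (fun z => c%:E * z)%E) mule0.
Qed.

Lemma summable_ge0P (I : choiceType) (a : I -> R) : (forall i, 0 <= a i) ->
  summable [set: I] (EFin \o a) <-> (\esum_(i in [set: I]) (a i)%:E < +oo)%E.
Proof.
by move=> a0; rewrite /summable; under eq_esum do rewrite /= ger0_norm//.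
Qed.

Lemma summable_pairM (I J : countType) (a : I -> R) (b : J -> R) :
  (forall i, 0 <= a i) -> (forall j, 0 <= b j) ->
  summable [set: I] (EFin \o a) -> summable [set: J] (EFin \o b) ->
  summable [set: I * J] (fun p => (a p.1 * b p.2)%:E).
Proof.
move=> a0 b0 /(summable_ge0P a0) sa /(summable_ge0P b0) sb.
apply/summable_ge0P => [p|]; first exact: mulr_ge0.
have aE i : (0 <= (a i)%:E)%E by rewrite lee_fin.
have bE i : (0 <= (b i)%:E)%E by rewrite lee_fin.
rewrite (_ : [set: I * J] = [set: I] `*`` (fun=> [set: J])); last by apply/seteqP; split.
have abE i j : [set: I] i -> [set: J] j -> (0 <= (a i * b j)%:E)%E by rewrite lee_fin mulr_ge0.
rewrite -(esum_esum abE).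
under eq_esum do under eq_esum do rewrite EFinM.
under eq_esum do rewrite esumZl// muleC.
have fb : \esum_(j in [set: J]) (b j)%:E \is a fin_num.
  by rewrite ge0_fin_numE//; exact: esum_ge0.
rewrite -(fineK fb) esumZl//; last by apply/fine_ge0/esum_ge0.
by rewrite lte_mul_pinfty// ?lee_fin; exact/fine_ge0/esum_ge0.
Qed.

Lemma csumM (I J : countType) (f : I -> R[i]) (g : J -> R[i]) :
  csummable f -> csummable g ->
  csummable (fun p : I * J => f p.1 * g p.2) /\
  csum (fun p : I * J => f p.1 * g p.2) = csum f * csum g.
Proof.
move=> sf sg.
have sfg : csummable (fun p : I * J => f p.1 * g p.2).
  apply: (@csummable_le _ _ _ (fun p => normc (f p.1) * normc (g p.2))) => [|p]; last first.
    by rewrite Normc.normcM.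
  have := summable_pairM (fun i => normc_ge0 (f i)) (fun j => normc_ge0 (g j)).
  by apply; exact: csummable_normc.
have [_ _ ->] := csum_pair sfg; split => //.
under [in LHS]eq_fun do rewrite /= csumZ//.
rewrite mulrC -csumZ//.
by congr csum; apply/funext => i; rewrite mulrC.
Qed.

Lemma csum_prod n (f : 'I_n -> nat -> R[i]) : (forall k, csummable (f k)) ->
  csummable (fun l : n.-tuple nat => \prod_(k < n) f k (tnth l k)) /\
  csum (fun l : n.-tuple nat => \prod_(k < n) f k (tnth l k)) = \prod_(k < n) csum (f k).
Proof.
elim: n f => [|n IH] f sf.
  have E : [set: 0.-tuple nat] = [set [tuple]].
    by apply/seteqP; split => // t _; exact: tuple0.
  under eq_fun do rewrite big_ord0.
  rewrite /csummable /summable /csum /rsum big_ord0 E !esum_set1//=.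
  rewrite !funeposE !funenegE /= -!EFin_max /= normr1 normr0 !ltry; split => //.
  by apply: complex_ext => /=; rewrite /Num.max; repeat case: ifP; lra.
pose e (p : nat * n.-tuple nat) : n.+1.-tuple nat := [tuple of p.1 :: p.2].
have be : bijective e.
  exists (fun t => (thead t, [tuple of behead t])) => [[x t]|t].
    by rewrite /e theadE; congr pair; exact/val_inj.
  by rewrite /e /= -tuple_eta.
have [s1 e1] := IH (fun k => f (lift ord0 k)) (fun k => sf _).
have [s2 e2] := csumM (sf ord0) s1.
have fE p : \prod_(k < n.+1) f k (tnth (e p) k) =
    f ord0 p.1 * \prod_(k < n) f (lift ord0 k) (tnth p.2 k).
  rewrite big_ord_recl tnth0; congr (_ * _); apply: eq_bigr => k _.
  by rewrite tnthS.
have [g gK eK] := be.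
split; last by rewrite -(csum_bij _ be) big_ord_recl -e1 -e2; congr csum; apply/funext.
have bg : bijective g by exists e.
have := csummable_bij bg s2; congr csummable.
by apply/funext => l; rewrite -fE eK.
Qed.

Definition expt (z : R[i]) (j : nat) : R[i] := z ^+ j / j`!%:R.

Lemma normc_expt z j : normc (expt z j) = exp_coeff (normc z) j.
Proof. by rewrite Normc.normcM normcX Normc.normcV normc_nat. Qed.

Lemma csummable_expt z : csummable (expt z).
Proof.
apply: (@csummable_le _ _ _ (exp_coeff (normc z))) => [|j]; last by rewrite normc_expt.
apply: summable_nat => [k|]; last exact: is_cvg_series_exp_coeff.
exact/exp_coeff_ge0/normc_ge0.
Qed.

Lemma csum_fin (h : nat -> R[i]) n : (forall k, (n < k)%N -> h k = 0) ->
  csum h = \sum_(k < n.+1) h k.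
Proof.
move=> h0; have sh : csummable h.
  apply: (@csummable_le _ _ _ (fun k => normc (h k))) => //.
  apply: summable_nat => [k|]; first exact: normc_ge0.
  apply/cvg_ex; exists (series (fun k => normc (h k)) n.+1).
  apply: cvg_near_cst; exists n.+1 => // m /= nm.
  rewrite /series /= (@big_cat_nat _ _ _ n.+1)//= -[RHS]addr0; congr (_ + _).
  rewrite big_nat big1// => k /andP[nk _].
  by rewrite h0// Normc.normc0.
have aux (u : nat -> R) : (forall k, (n < k)%N -> u k = 0) ->
    summable [set: nat] (EFin \o u) -> rsum u = \sum_(k < n.+1) u k.
  move=> u0 /rsum_nat/cvg_lim <- //; apply: lim_near_cst => //.
  exists n.+1 => // m /= nm.
  rewrite /series /= (@big_cat_nat _ _ _ n.+1)//= big_mkord -[RHS]addr0; congr (_ + _).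
  by rewrite big_nat big1// => k /andP[nk _]; rewrite u0.
have [sR sI] := sh; apply: complex_ext => /=; rewrite aux// ?cRe_sum ?cIm_sum// => k nk.
  by rewrite h0.
by rewrite h0.
Qed.

Lemma csum_cauchy (f h : nat -> R[i]) : csummable f -> csummable h ->
  csummable (fun n => \sum_(a < n.+1) f a * h (n - a)%N) /\
  csum (fun n => \sum_(a < n.+1) f a * h (n - a)%N) = csum f * csum h.
Proof.
move=> cf ch.
(* The convolution as a double array, row a being the sequence h shifted by a. Summing over n first
   gives f a times the sum of h; summing over a first gives the convolution. *)
pose g (a n : nat) : R[i] := if (a <= n)%N then f a * h (n - a)%N else 0.
have esum_shift (u : nat -> \bar R) a : (forall n, 0 <= u n)%E ->
    (\esum_(n in [set: nat]) (if (a <= n)%N then u (n - a)%N else 0) = \esum_(n in [set: nat]) u n)%E.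
  move=> u0; rewrite (esumID (range (addn a))); last by move=> n _; case: ifP.
  rewrite [X in (_ + X)%E]esum1 ?adde0; last first.
    move=> n [_ /= nn]; case: ifP => // an; exfalso; apply: nn; exists (n - a)%N => //.
    by rewrite subnKC.
  rewrite setTI esum_image; last by move=> x y _ _; exact: addnI.
  by apply: eq_esum => n _; rewrite leq_addr addKn.
have csum_shift (u : nat -> R[i]) a : csum (fun n => if (a <= n)%N then u (n - a)%N else 0) = csum u.
  rewrite /csum /rsum; congr (_ +i* _); congr (fine _ - fine _);
    rewrite -[RHS](esum_shift _ a)//; apply: eq_esum => n _; rewrite ?funeposE ?funenegE /=;
    by case: ifP; rewrite /= ?funeposE ?funenegE //= ?oppr0 maxxx.
have mg a : measurable_fun setT (g a) by [].
have sw := csummable_normc ch; have sz := csummable_normc cf.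
have w0 i : 0 <= normc (h i) by exact: normc_ge0.
have n0 a i : 0 <= normc (g a i) by exact: normc_ge0.
move/(summable_ge0P w0) in sw.
pose S := fine (\esum_(n in [set: nat]) (normc (h n))%:E)%E.
have SE : S%:E = (\esum_(n in [set: nat]) (normc (h n))%:E)%E.
  by rewrite fineK// ge0_fin_numE// esum_ge0// => n _; rewrite lee_fin.
have sB := summableZ S sz.
have gB a : (\esum_(n in [set: nat]) (normc (g a n))%:E <= (S * normc (f a))%:E)%E.
  rewrite mulrC EFinM SE -esumZl ?normc_ge0//.
  rewrite -[leRHS](esum_shift _ a); last first.
    by move=> n; rewrite -EFinM lee_fin mulr_ge0 ?normc_ge0.
  apply: le_esum => n _; rewrite /g; case: ifP => _.
    by rewrite Normc.normcM EFinM.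
  by rewrite -[X in X%:E]/(normc 0) Normc.normc0.
have [] := @cintegral_csum R nat _ nat (@counting nat R) g _ mg sB.
  move=> a; rewrite ge0_integral_count; last by move=> n; rewrite lee_fin normc_ge0.
  by rewrite nneseries_esumT// => n; rewrite lee_fin normc_ge0.
move=> a1 b1 c1 d1.
have gE n : csum (fun a => g a n) = \sum_(a < n.+1) f a * h (n - a)%N.
  rewrite (@csum_fin _ n); last by move=> a an; rewrite /g leqNgt an.
  by apply: eq_bigr => a _; rewrite /g -ltnS ltn_ord.
have s2 : csummable (fun n => \sum_(a < n.+1) f a * h (n - a)%N).
  apply/csummable_countP; apply: (eq_cintegrable _ b1) => n.
  by rewrite gE /useq pickle_inv_nat.
split => //; rewrite (csum_nat s2).2.
transitivity (cintegral (@counting nat R) (fun n => csum (fun a => g a n))).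
  by apply: eq_cintegral => n; rewrite gE.
rewrite d1 mulrC -csumZ//.
congr csum; apply/funext => a.
have s1 : csummable (g a).
  apply: (@csummable_le _ _ _ (fun n => normc (g a n))) => //.
  by apply/summable_ge0P => //; apply: le_lt_trans (gB a) _; rewrite ltry.
rewrite -(csum_nat s1).2 mulrC -csumZ//.
by rewrite -[RHS](csum_shift _ a).
Qed.

Lemma csum_exptD z w : csum (expt (z + w)) = csum (expt z) * csum (expt w).
Proof.
have [_ <-] := csum_cauchy (csummable_expt z) (csummable_expt w).
congr csum; apply/funext => n.
rewrite /expt [z + w]addrC exprDn mulr_suml; apply: eq_bigr => a _.
have an : (a <= n)%N by rewrite -ltnS.
have nz m : (m`!%:R : R[i]) != 0 by rewrite pnatr_eq0 -lt0n fact_gt0.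
rewrite -(bin_fact an) !natrM -mulr_natr.
have bz : ('C(n, a)%:R : R[i]) != 0 by rewrite pnatr_eq0 -lt0n bin_gt0.
by field; rewrite bz !nz.
Qed.

Lemma csum_expt_real (x : R) : csum (expt x%:C) = (expR x)%:C.
Proof.
have sx := csummable_expt x%:C.
have E j : expt x%:C j = (exp_coeff x j)%:C.
  rewrite /expt -(@natrC R) -rmorphXn -fmorphV -rmorphM//.
have eR : (fun j => cRe (expt x%:C j)) = exp_coeff x by apply/funext => j; rewrite E.
have eI : (fun j => cIm (expt x%:C j)) = fun=> 0 by apply/funext => j; rewrite E.
move: sx => [sR sI]; apply: complex_ext => /=.
  rewrite eR; move: sR.
  rewrite (_ : (fun i => (cRe (expt x%:C i))%:E) = EFin \o (exp_coeff x)); last first.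
    by rewrite -eR.
  by move=> /rsum_nat/cvg_lim <- //; rewrite unlock.
rewrite eI /rsum !esum1 ?subrr// => i _; rewrite ?funeposE ?funenegE /= ?oppr0 maxxx//.
Qed.

Lemma csum_expt_imag (y : R) : csum (expt (y *i)) = cos y +i* sin y.
Proof.
have [sR sI] := csummable_expt (y *i).
have imX j : ('i : R[i]) ^+ j = ((~~ odd j)%:R * (-1) ^+ j./2) +i* ((odd j)%:R * (-1) ^+ j./2).
  elim: j => [|j IH]; first by rewrite expr0; apply: complex_ext => /=; rewrite ?mul0r ?mul1r.
  rewrite exprS IH; apply: complex_ext => /=; rewrite uphalf_half; case: (odd j) => /=;
    rewrite ?exprS; lra.
have E j : expt (y *i) j = cos_coeff y j +i* sin_coeff y j.
  rewrite /expt (_ : y *i = 'i * y%:C); last first.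
    by apply: complex_ext => /=; ring.
  rewrite exprMn imX -(@natrC R) -rmorphXn -fmorphV.
  rewrite -mulrA -rmorphM; apply: complex_ext; rewrite ?cReMr ?cImMr /=.
    by rewrite /cos_coeff /= mulr0 subr0 !mulrA.
  rewrite /sin_coeff /= mulr0 add0r !mulrA; case: (boolP (odd j)) => oj; rewrite ?mul0r//.
  suff -> : j./2 = j.-1./2 by [].
  by move: oj; case: (j) => //= m; rewrite uphalf_half => /negbTE ->.
have eR : EFin \o (fun j => cRe (expt (y *i) j)) = EFin \o cos_coeff y.
  by apply/funext => j /=; rewrite E.
have eI : EFin \o (fun j => cIm (expt (y *i) j)) = EFin \o sin_coeff y.
  by apply/funext => j /=; rewrite E.
apply: complex_ext => /=.
  have := rsum_nat sR; rewrite (_ : series _ = series (cos_coeff y)); last first.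
    by congr series; apply/funext => j; rewrite E.
  by move/cvg_lim <- => //; rewrite unlock.
have := rsum_nat sI; rewrite (_ : series _ = series (sin_coeff y)); last first.
  by congr series; apply/funext => j; rewrite E.
by move/cvg_lim <- => //; rewrite unlock.
Qed.

(** [cexp] is built from the real exponential, cosine and sine; the addition formula for the series
    reduces the claim to real and to imaginary arguments. *)
Lemma csum_expt z : csum (expt z) = cexp z.
Proof.
have -> : z = (cRe z)%:C + (cIm z) *i by apply: complex_ext => /=; rewrite ?addr0 ?add0r.
rewrite csum_exptD csum_expt_real csum_expt_imag.
by apply: complex_ext => /=; rewrite ?addr0 ?add0r; ring.
Qed.

Lemma csum_exp_tuple n (z : 'I_n -> R[i]) :
  csummable (fun l : n.-tuple nat => \prod_(k < n) expt (z k) (tnth l k)) /\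
  csum (fun l : n.-tuple nat => \prod_(k < n) expt (z k) (tnth l k)) =
  cexp (\sum_(k < n) z k).
Proof.
have [s1 ->] := csum_prod (fun k => csummable_expt (z k)); split => //.
by rewrite cexp_sum; apply: eq_bigr => k _; rewrite csum_expt.
Qed.

Lemma summable_sqrt_tuple n (C : 'I_n -> R) : (forall k, 0 <= C k) ->
  summable [set: n.-tuple nat] (fun l =>
    (\prod_(k < n) (C k ^+ tnth l k / Num.sqrt (tnth l k)`!%:R))%:E).
Proof.
move=> C0.
have sk k : csummable (fun j : nat => (C k ^+ j / Num.sqrt (j`!%:R))%:C).
  (* The inequality 2 x y <= x^2 + y^2 with weights 2^j: it trades the square root of the factorial
     for an exponential series at 2 C^2 plus a geometric series. *)
  apply: (@csummable_le _ _ _ (fun j => 2^-1 * (exp_coeff (2 * C k ^+ 2) j + (2^-1) ^+ j))).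
    apply: summableZ.
    have s1 : summable [set: nat] (EFin \o exp_coeff (2 * C k ^+ 2)).
      apply: summable_nat => [j|]; last exact: is_cvg_series_exp_coeff.
      by apply: exp_coeff_ge0; rewrite mulr_ge0// exprn_ge0.
    have s2 : summable [set: nat] (EFin \o (fun j => (2^-1 : R) ^+ j)).
      apply: summable_nat => [j|]; first by rewrite exprn_ge0// invr_ge0.
      have := @is_cvg_geometric_series R 1 2^-1.
      rewrite /geometric /= (_ : (fun n => _) = (fun n => 2^-1 ^+ n)); last first.
        by apply/funext => m; rewrite mul1r.
      by apply; rewrite ger0_norm ?invr_ge0// invf_lt1 ?ltr1n.
    exact: (summableD s1 s2).
  move=> j; rewrite normc_real ger0_norm; last first.
    by rewrite divr_ge0 ?exprn_ge0// sqrtr_ge0.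
  rewrite /exp_coeff /= exprMn -exprM mulnC exprM exprVn.
  have f0 : 0 < j`!%:R :> R by rewrite ltr0n fact_gt0.
  have b0 : 0 < (2 : R) ^+ j by rewrite exprn_gt0.
  set b := 2 ^+ j in b0 *; set a := C k ^+ j; set s := Num.sqrt _.
  have s0 : 0 < s by rewrite sqrtr_gt0.
  have -> : j`!%:R = s ^+ 2 :> R by rewrite sqr_sqrtr// ltW.
  rewrite -subr_ge0 (_ : _ - _ = (b * (a / s) - 1) ^+ 2 / (2 * b)).
    by rewrite divr_ge0 ?sqr_ge0// mulr_ge0// ltW.
  by field; rewrite !gt_eqF.
have [s1 _] := (csum_prod sk).1.
apply: le_lt_trans s1; apply: le_esum => l _ /=.
by rewrite -rmorph_prod.
Qed.

End esums.

(** * Characteristic functions *)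

Section law_from_integrals.
Context {R : realType}.
Local Notation leb := (@lebesgue_measure R).
Variables m1 m2 : probability (measurableTypeR R) R.

(** The open half-lines ]-oo, b[ are stable under intersection and generate the Borel sets, so
    equality of the measures there is enough. *)
Lemma law_eq_of_continuous :
  (forall g : R -> R, continuous g -> (forall x, 0 <= g x <= 1) ->
    (\int[m1]_x (g x)%:E = \int[m2]_x (g x)%:E)%E) ->
  forall A, measurable A -> m1 A = m2 A.
Proof.
move=> eg A mA.
have h b : m1 `]-oo, b[%classic = m2 `]-oo, b[%classic.
  (* Continuous ramps increasing to the indicator of ]-oo, b[; at and beyond b they vanish for every
     n. *)
  pose g n (x : R) := Num.max 0 (Num.min 1 (n%:R * (b - x))).
  have cg n : continuous (g n).
    move=> x; apply: (@continuous_max _ _ (fun=> 0) ((fun=> 1) \min (fun y => n%:R * (b - y)))).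
      exact: cvg_cst.
    apply: (@continuous_min _ _ (fun=> 1) (fun y => n%:R * (b - y))).
      exact: cvg_cst.
    by apply: cvgM; [exact: cvg_cst|apply: cvgB; [exact: cvg_cst|exact: cvg_id]].
  have g01 n x : 0 <= g n x <= 1.
    by rewrite /g le_max lexx ge_max ler01 ge_min lexx.
  have mg n : measurable_fun setT (g n) by exact: continuous_measurable_fun.
  have cvgg x : g ^~ x @ \oo --> (\1_(`]-oo, b[%classic) x : R).
    rewrite indicE; have [xb|bx] := ltP x b.
      rewrite mem_set/= ?in_itv//.
      apply: cvg_near_cst.
      exists (Num.truncn ((b - x)^-1)).+1 => // m /= nm.
      have bx : 0 < b - x by rewrite subr_gt0.
      have : 1 <= m%:R * (b - x).
        rewrite -ler_pdivrMr// mul1r ltW// (lt_le_trans (truncnS_gt _))//.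
        by rewrite ler_nat.
      by rewrite /g => /min_idPl ->; apply/max_idPr.
    rewrite memNset/=; last by rewrite in_itv/= ltNge bx.
    apply: cvg_near_cst; apply: nearW => m; rewrite /g; apply/max_idPl.
    by rewrite ge_min mulr_ge0_le0 ?orbT// subr_le0.
  have key (m : probability (measurableTypeR R) R) :
      (\int[m]_x (g n x)%:E @[n --> \oo] --> m `]-oo, b[%classic)%E.
    have [] := @dominated_convergence _ _ _ m setT measurableT
      (fun n x => (g n x)%:E) (fun x => (\1_(`]-oo, b[%classic) x)%:E) (fun=> 1%E).
    - by move=> n; apply/measurable_EFinP; exact: mg.
    - by apply/measurable_EFinP; exact: measurable_indic.
    - by apply: aeW => x _; apply/cvg_EFin; [exact: nearW|exact: cvgg].
    - exact: finite_measure_integrable_cst.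
    - apply: aeW => x n _; rewrite lee_fin; have /andP[h1 h2] := g01 n x.
      by rewrite ger0_norm.
    by move=> _ _; rewrite integral_indic// setIT.
  have k1 := key m1; have k2 := key m2.
  have e12 : (fun n => \int[m1]_x (g n x)%:E)%E = (fun n => \int[m2]_x (g n x)%:E)%E.
    by apply/funext => n; rewrite eg.
  rewrite e12 in k1.
  by rewrite -(cvg_lim _ k1)// -(cvg_lim _ k2).
move: A mA; apply: (@measure_unique _ R (measurableTypeR R) (@RGenInftyO.G R)
  (fun n => `]-oo, n%:R[%classic)).
- exact: RGenInftyO.measurableE.
- move=> _ _ [x ->] [y ->]; exists (Num.min x y).
  by apply/seteqP; split => z /=; rewrite !in_itv/= lt_min => /andP.
- by move=> n; exists n%:R.
- apply/seteqP; split => // x _; exists (Num.truncn x).+1 => //=.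
  by rewrite in_itv/= truncnS_gt.
- by move=> _ [x ->]; exact: h.
- by move=> n; rewrite (le_lt_trans (probability_le1 _ _))// ltry.
Qed.

End law_from_integrals.

Section bounded_integrable.
Context {R : realType} d (T : measurableType d) (P : probability T R).

Lemma integrable_bounded (f : T -> R) (C : R) : measurable_fun setT f ->
  (forall x, `|f x| <= C) -> P.-integrable setT (EFin \o f).
Proof.
move=> mf fC; have ic := finite_measure_integrable_cst P C measurableT.
apply: le_integrable ic => //; first exact/measurable_EFinP.
by move=> x _ /=; rewrite lee_fin (le_trans (fC x))// ler_norm.
Qed.

Lemma cintegrable_bounded (f : T -> R[i]) (C : R) : measurable_fun setT f ->
  (forall x, normc (f x) <= C) -> cintegrable P f.
Proof.
by move=> mf fC; apply: cintegrable_le mf (finite_measure_integrable_cst P C measurableT) fC.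
Qed.

Lemma integrable_prod2 d2 (T2 : measurableType d2)
    (m2 : {sigma_finite_measure set T2 -> \bar R}) (h : T2 -> R) :
  m2.-integrable setT (EFin \o h) ->
  (P \x m2)%E.-integrable setT (fun z => (h z.2)%:E).
Proof.
move=> ih; have mh : measurable_fun setT (fun z : T * T2 => (h z.2)%:E).
  by apply: (measurableT_comp (measurable_int _ ih)).
apply/(integrable12ltyP P _ mh) => /=.
rewrite integral_cst// [X in (_ * X)%E](_ : _ = 1%E) ?mule1; last exact: probability_setT.
by case/integrableP : ih.
Qed.

End bounded_integrable.

Section char_fun.
Context {R : realType}.
Local Notation leb := (@lebesgue_measure R).
Implicit Types m : probability (measurableTypeR R) R.

Definition charf m (t : R) : R[i] := cintegral m (fun x => cexp ((t * x) *i)).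

Lemma measurable_charf_fun (t : R) :
  measurable_fun setT (fun x : measurableTypeR R => cexp ((t * x) *i)).
Proof.
by apply: measurable_cexp; apply: measurable_imag; apply: measurable_funM.
Qed.

Lemma normc_charf_fun (t x : R) : normc (cexp ((t * x) *i)) = 1.
Proof. by rewrite normc_cexp expR0. Qed.

Lemma cintegrable_charf_fun m (t : R) : cintegrable m (fun x => cexp ((t * x) *i)).
Proof.
apply: (@cintegrable_bounded _ _ _ _ _ 1); first exact: measurable_charf_fun.
by move=> x; rewrite normc_charf_fun.
Qed.

Lemma integrable_gauss_kernel m (a y : R) : 0 < a ->
  m.-integrable setT (fun x => (expR (- (y - x) ^+ 2 / (2 * a)))%:E).
Proof.
move=> a0; apply: (@integrable_bounded _ _ _ _ _ 1).
  by apply: measurableT_comp => //; apply: measurable_funM => //;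
    apply: measurable_funN; apply: measurable_funX; apply: measurable_funB.
move=> x; rewrite ger0_norm ?expR_ge0// expR_le1 mulNr oppr_le0.
by rewrite divr_ge0 ?sqr_ge0// mulr_ge0// ltW.
Qed.

(* Fourier inversion of the Gaussian kernel turns the smoothed law into an
   integral of the characteristic function. *)
Lemma gauss_smooth m (a y : R) : 0 < a ->
  (Num.sqrt (2 * pi / a))%:C *
    (\int[m]_x expR (- (y - x) ^+ 2 / (2 * a)))%:C =
  cintegral leb (fun t => gaussF a (y *i) t * charf m (- t)).
Proof.
move=> a0.
pose F (z : measurableTypeR R * measurableTypeR R) : R[i] :=
  gaussF a ((y - z.1) *i) z.2.
have mF : measurable_fun setT F.
  apply: measurable_cexp; apply: measurable_cD.
    apply: measurable_cM; last by apply: measurable_realC.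
    by apply: measurable_imag; apply: measurable_funB.
  under eq_fun do rewrite -rmorphN.
  apply: measurable_realC; apply: measurable_funN.
  by apply: measurable_funM => //; apply: measurable_funX.
have nF z : normc (F z) = expR (0 * `|z.2| - a / 2 * z.2 ^+ 2).
  rewrite normc_cexp cReB cReM /=; congr expR; ring.
have iF : cintegrable (m \x leb)%E F.
  apply: (cintegrable_le mF (integrable_prod2 m (integrable_gauss 0 a0))) => z.
  by rewrite nF.
have [_ _ h1] := cintegral_fubiniR iF; have [_ _ h2] := cintegral_fubiniL iF.
have iK : m.-integrable setT (fun x => (expR (- (y - x) ^+ 2 / (2 * a)))%:E).
  exact: integrable_gauss_kernel.
rewrite -[RHS](_ : cintegral leb (fun t => cintegral m (fun x => F (x, t))) = _); last first.
  apply: eq_cintegral => t; rewrite /charf -cintegralZl; last exact: cintegrable_charf_fun.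
  apply: eq_cintegral => x; rewrite /F /gaussF /= -cexpD; congr cexp.
  apply: complex_ext; rewrite /=; ring.
rewrite h2 -h1.
have <- : cintegral m (fun x => (expR (- (y - x) ^+ 2 / (2 * a)))%:C) =
   (\int[m]_x expR (- (y - x) ^+ 2 / (2 * a)))%:C.
  by apply: complex_ext => //=; rewrite Rintegral_cst// mul0r.
rewrite -cintegralZl; last first.
  split => //=; exact: integrable0.
apply: eq_cintegral => x.
have -> : (fun t : measurableTypeR R => F (x, t)) = gaussF a ((y - x) *i) by [].
rewrite (cintegral_gauss _ a0); congr (_ * _).
rewrite -cexp_real; congr cexp; apply: complex_ext; rewrite /= !(mul0r, mulr0, subr0, sub0r, addr0, add0r).
  by field; exact: lt0r_neq0.
by ring.
Qed.

Variables m1 m2 : probability (measurableTypeR R) R.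
Hypothesis cf : charf m1 =1 charf m2.

(** After the substitution y = s w + x and Tonelli, both sides integrate g against the law smoothed
    by a Gaussian of scale s, and [gauss_smooth] expresses that density by the characteristic
    function. *)
Lemma smooth_eq (g : R -> R) (s : R) : 0 < s -> measurable_fun setT g -> (forall x, 0 <= g x) ->
  (\int[m1]_x \int[leb]_w (g (s * w + x) * expR (- w ^+ 2 / 2))%:E =
   \int[m2]_x \int[leb]_w (g (s * w + x) * expR (- w ^+ 2 / 2))%:E)%E.
Proof.
move=> s0 mg g0.
have s2 : 0 < s ^+ 2 by rewrite exprn_gt0.
have key (m : probability (measurableTypeR R) R) :
  (s%:E * \int[m]_x \int[leb]_w (g (s * w + x)%R * expR (- w ^+ 2 / 2))%:E =
   \int[leb]_y ((g y)%:E * (\int[m]_x expR (- (y - x) ^+ 2 / (2 * s ^+ 2)))%:E))%E.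
  pose f (z : measurableTypeR R * measurableTypeR R) : \bar R :=
    (g z.2 * expR (- (z.2 - z.1) ^+ 2 / (2 * s ^+ 2)))%:E.
  have f0 z : (0 <= f z)%E by rewrite lee_fin mulr_ge0 ?expR_ge0.
  have mf : measurable_fun setT f.
    apply/measurable_EFinP; apply: measurable_funM; first exact: measurableT_comp.
    apply: measurableT_comp => //; apply: measurable_funM => //.
    by apply: measurable_funN; apply: measurable_funX; apply: measurable_funB.
  have := @fubini_tonelli _ _ _ _ _ m leb f mf f0.
  rewrite /fubini_F /fubini_G => FT.
  transitivity (\int[m]_x \int[leb]_y f (x, y))%E; last first.
    rewrite FT; apply: eq_integral => y _; rewrite /f /=.
    have iK := integrable_gauss_kernel m y s2.
    rewrite fineK; last exact: integrable_fin_num.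
    rewrite -ge0_integralZl//.
    - exact: measurable_int iK.
    - by rewrite lee_fin.
  rewrite -ge0_integralZl//; last 3 first.
  - pose f2 (z : measurableTypeR R * measurableTypeR R) : \bar R :=
      (g (s * z.2 + z.1) * expR (- z.2 ^+ 2 / 2))%:E.
    apply: (@measurable_fun_fubini_tonelli_F _ _ _ _ _ leb f2).
      apply/measurable_EFinP; apply: measurable_funM.
        by apply: measurableT_comp => //; apply: measurable_funD => //; apply: measurable_funM.
      apply: measurableT_comp => //; apply: measurable_funM => //.
      by apply: measurable_funN; apply: measurable_funX.
    by move=> z; rewrite lee_fin mulr_ge0 ?expR_ge0.
  - move=> x _; apply: integral_ge0 => w _; rewrite lee_fin mulr_ge0 ?expR_ge0//.
  - by rewrite lee_fin ltW.
  apply: eq_integral => x _.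
  rewrite -[RHS](@ge0_integral_affine _ s x (fun y => f (x, y)) s0)//; last first.
    exact: measurableT_comp mf (pair1_measurable x).
  congr (_ * _)%E; apply: eq_integral => w _; rewrite /f /=; congr (_ * expR _)%:E.
  by rewrite addrK; field; rewrite gt_eqF.
have e y : \int[m1]_x expR (- (y - x) ^+ 2 / (2 * s ^+ 2)) =
    \int[m2]_x expR (- (y - x) ^+ 2 / (2 * s ^+ 2)).
  have := gauss_smooth m1 y s2; have := gauss_smooth m2 y s2.
  have -> : charf m1 = charf m2 by exact/funext.
  move=> <- h; apply: complexI.
  by apply: (mulfI _ h); rewrite gt_eqF// ltcR sqrtr_gt0 divr_gt0// mulr_gt0// pi_gt0.
have h : (\int[leb]_y ((g y)%:E * (\int[m1]_x expR (- (y - x) ^+ 2 / (2 * s ^+ 2)))%:E) =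
    \int[leb]_y ((g y)%:E * (\int[m2]_x expR (- (y - x) ^+ 2 / (2 * s ^+ 2)))%:E))%E.
  by apply: eq_integral => y _; rewrite e.
rewrite -!key in h.
by have := congr1 (fun z => (s^-1)%:E * z)%E h; rewrite !muleA -EFinM mulVf ?gt_eqF// !mul1e.
Qed.

(** Smoothing at scale 1 / (n + 1) and letting n grow: for continuous g between 0 and 1, the
    smoothed integrals converge by domination to the integral of g times the Gaussian mass [I],
    which is then divided out. *)
Lemma charf_inj A : measurable A -> m1 A = m2 A.
Proof.
apply: law_eq_of_continuous => g cg g01.
have mg : measurable_fun setT g by exact: continuous_measurable_fun.
have g0 x : 0 <= g x by have /andP[] := g01 x.
pose e (w : R) := expR (- w ^+ 2 / 2).
have e0 w : 0 <= e w by exact: expR_ge0.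
have eE w : e w = expR (0 * `|w| - 1 / 2 * w ^+ 2) by rewrite /e; congr expR; field.
have ie : leb.-integrable setT (EFin \o e).
  have -> : EFin \o e = (fun w => (expR (0 * `|w| - 1 / 2 * w ^+ 2))%:E).
    by apply/funext => w /=; rewrite eE.
  exact: integrable_gauss.
pose I := Num.sqrt (2 * pi / 1 : R).
have IE : (\int[leb]_w (e w)%:E = I%:E)%E.
  rewrite -[LHS]fineK; last exact: integrable_fin_num.
  congr EFin; have := congr1 (@complex.Re R) (cintegral_gauss0 (@ltr01 R)).
  rewrite [X in _ = X -> _]/= -/I => <-; congr fine; apply: eq_integral => w _.
  by rewrite /gaussF mul0r sub0r -rmorphN cexp_real /= eE mul0r sub0r.
have I0 : 0 < I by rewrite sqrtr_gt0 divr_gt0// mulr_gt0// pi_gt0.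
pose f n (z : measurableTypeR R * measurableTypeR R) : R := g (n.+1%:R^-1 * z.2 + z.1) * e z.2.
have key (m : probability (measurableTypeR R) R) :
   (\int[m]_x \int[leb]_w (g (n.+1%:R^-1 * w + x)%R * e w)%:E @[n --> \oo] -->
    (\int[m]_x (g x)%:E) * I%:E)%E.
  have mg2 n : measurable_fun setT (fun z : measurableTypeR R * measurableTypeR R =>
      g (n.+1%:R^-1 * z.2 + z.1)).
    by apply: measurableT_comp => //; apply: measurable_funD => //; apply: measurable_funM.
  have me2 : measurable_fun setT (fun z : measurableTypeR R * measurableTypeR R => e z.2).
    have me : measurable_fun setT e by apply/measurable_EFinP; exact: measurable_int ie.
    exact: measurableT_comp.
  have mf n : measurable_fun setT (fun z => (f n z)%:E).
    by apply/measurable_EFinP; apply: measurable_funM.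
  pose h (z : measurableTypeR R * measurableTypeR R) := (g z.1 * e z.2)%:E.
  have mh : measurable_fun setT h.
    apply/measurable_EFinP; apply: measurable_funM => //.
    exact: measurableT_comp.
  have [] := @dominated_convergence _ _ _ (m \x leb)%E setT measurableT
    (fun n z => (f n z)%:E) h (fun z => (e z.2)%:E).
  - by [].
  - by [].
  - apply: aeW => z _; apply/cvg_EFin; first exact: nearW.
    apply: cvgM; last exact: cvg_cst.
    have : n.+1%:R^-1 * z.2 + z.1 @[n --> \oo] --> z.1.
      rewrite -[X in _ --> X]add0r -[X in _ --> X + _](mul0r z.2).
      by apply: cvgD; [apply: cvgM; [exact: cvg_harmonic|exact: cvg_cst]|exact: cvg_cst].
    exact: (continuous_cvg _ (cg z.1)).
  - exact: integrable_prod2.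
  - apply: aeW => z n _; have /andP[h1 h2] := g01 (n.+1%:R^-1 * z.2 + z.1).
    by rewrite lee_fin ger0_norm ?mulr_ge0// ler_piMl.
  move=> _ _.
  rewrite (_ : (\int[(m \x leb)%E]_x h x = (\int[m]_x (g x)%:E) * I%:E)%E); last first.
    rewrite fubini_tonelli1//; last by move=> z; rewrite lee_fin mulr_ge0.
    have mgE : measurable_fun setT (fun x : measurableTypeR R => (g x)%:E).
      by apply/measurable_EFinP.
    rewrite /fubini_F muleC -ge0_integralZl//; last 2 first.
    - by move=> x _; rewrite lee_fin.
    - by rewrite lee_fin ltW.
    apply: eq_integral => x _; rewrite -IE muleC.
    by rewrite -(integralZl measurableT ie (g x)); apply: eq_integral.
  suff -> : (fun n => \int[m]_x \int[leb]_w (g (n.+1%:R^-1 * w + x)%R * e w)%:E)%E =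
    [sequence (\int[(m \x leb)%E]_z (f n z)%:E)%E]_n by [].
  have fE0 n z : (0 <= (f n z)%:E)%E by rewrite lee_fin mulr_ge0.
  have FE n := @fubini_tonelli1 _ _ _ _ _ m leb (fun z => (f n z)%:E) (mf n) (fE0 n).
  by apply/funext => n; rewrite /= FE.
have k1 := key m1; have k2 := key m2.
rewrite (_ : (fun n => _) = (fun n => \int[m2]_x \int[leb]_w (g (n.+1%:R^-1 * w + x)%R * e w)%:E)%E) in k1; last first.
  by apply/funext => n; apply: smooth_eq => //; rewrite invr_gt0.
have h12 := cvg_unique (@ereal_hausdorff R) k1 k2.
have := congr1 (fun z => z * (I^-1)%:E)%E (h12 _).
by rewrite -!muleA -EFinM divff ?gt_eqF// !mule1; apply; exact: fmap_proper_filter.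
Qed.

End char_fun.

(** * Independence *)

Section layer_cake.
Context {R : realType}.
Local Notation leb := (@lebesgue_measure R).

Lemma measurable_under d (T : measurableType d) (f : T -> R) : measurable_fun setT f ->
  measurable [set z : T * measurableTypeR R | 0 <= z.2 < f z.1].
Proof.
move=> mf.
have -> : [set z : T * measurableTypeR R | 0 <= z.2 < f z.1] =
  [set z | (0 : R) <= z.2] `&` [set z | z.2 < f z.1].
  by apply/seteqP; split => z /= => [/andP[]//|[-> ->]].
apply: measurableI.
  rewrite -[X in measurable X]setTI; apply: measurable_fun_le => //.
rewrite (_ : [set z | _] = ~` [set z | f z.1 <= z.2]); last first.
  by apply/seteqP; split => z /=; rewrite ltNge => /negP.
apply: measurableC; rewrite -[X in measurable X]setTI; apply: measurable_fun_le => //.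
exact: measurableT_comp.
Qed.

Lemma measurable_indic_under d (T : measurableType d) (f : T -> R) : measurable_fun setT f ->
  measurable_fun setT (fun z : T * measurableTypeR R => (0 <= z.2 < f z.1)%R%:R : R).
Proof.
move=> mf; rewrite (_ : (fun z => _) =
    \1_[set z : T * measurableTypeR R | 0 <= z.2 < f z.1]).
  by apply: measurable_indic; exact: measurable_under.
apply/funext => z; rewrite indicE; congr (_%:R).
by rewrite mem_setE.
Qed.

Lemma lebesgue_co (c : R) : 0 <= c -> leb (`[0, c[%classic : set R) = c%:E.
Proof.
move=> c0; rewrite lebesgue_measure_itv/= lte_fin; case: ifPn; first by rewrite sube0.
by rewrite -leNgt => c1; congr EFin; apply/le_anti; rewrite c0 c1.
Qed.

Lemma integral_under (c : R) : 0 <= c ->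
  (\int[leb]_u ((0 <= (u : R) < c)%R%:R)%:E = c%:E)%E.
Proof.
move=> c0; transitivity (\int[leb]_u (\1_(`[0, c[%classic : set R) u)%:E)%E.
  by apply: eq_integral => u _; rewrite indicE; congr (_%:R%:E); rewrite mem_setE in_itv.
by rewrite integral_indic//= setIT; exact: lebesgue_co.
Qed.

Lemma integrable_indic_co (c : R) : 0 <= c ->
  leb.-integrable setT (EFin \o \1_(`[0, c[%classic : set R)).
Proof.
move=> c0; apply/integrableP; split.
  by apply/measurable_EFinP; exact: measurable_indic.
rewrite (eq_integral (fun u : measurableTypeR R => (\1_(`[0, c[%classic : set R) u)%:E)) => [|u _]; last first.
  by rewrite /= ger0_norm ?indicE.
by rewrite integral_indic//= setIT [X in (X < _)%E](_ : _ = c%:E) ?ltry//; exact: lebesgue_co.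
Qed.

(* Tonelli with [f x = \int 1_(0 <= u < f x) du]. *)
Lemma weighted_layer_cake d (T : measurableType d)
    (m : {sigma_finite_measure set T -> \bar R}) (w f : T -> R) :
  measurable_fun setT w -> (forall x, 0 <= w x) ->
  measurable_fun setT f -> (forall x, 0 <= f x) ->
  (\int[m]_x (w x * f x)%:E =
   \int[leb]_u \int[m]_x (w x * ((0 <= (u : R) < f x)%R%:R))%:E)%E.
Proof.
move=> mw w0 mf f0.
pose h (z : T * measurableTypeR R) : \bar R := (w z.1 * (0 <= z.2 < f z.1)%R%:R)%:E.
have mh : measurable_fun setT h.
  apply/measurable_EFinP; apply: measurable_funM; last exact: measurable_indic_under.
  exact: measurableT_comp.
have h0 z : (0 <= h z)%E by rewrite lee_fin mulr_ge0.
have := @fubini_tonelli _ _ _ _ _ m leb h mh h0.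
rewrite /fubini_F /fubini_G => <-; apply: eq_integral => x _.
rewrite /h /=; under eq_integral do rewrite EFinM.
rewrite ge0_integralZl//.
- by rewrite integral_under.
- apply/measurable_EFinP.
  exact: measurableT_comp (measurable_indic_under mf) (pair1_measurable x).
- by rewrite lee_fin.
Qed.

End layer_cake.

Section independence.
Context {R : realType} d (T : measurableType d) (P : probability T R).
Local Notation leb := (@lebesgue_measure R).

Definition cbounded d' (T' : measurableType d') (f : T' -> R[i]) : Prop :=
  measurable_fun setT f /\ exists C : R, forall x, normc (f x) <= C.

Lemma cbounded_cintegrable (f : T -> R[i]) : cbounded f -> cintegrable P f.
Proof. by move=> [mf [C fC]]; exact: cintegrable_bounded fC. Qed.

Lemma cboundedM d' (T' : measurableType d') (f g : T' -> R[i]) :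
  cbounded f -> cbounded g -> cbounded (fun x => f x * g x).
Proof.
move=> [mf [C fC]] [mg [D gD]]; split; first exact: measurable_cM.
by exists (C * D) => x; rewrite Normc.normcM ler_pM ?normc_ge0.
Qed.

Lemma cbounded_cst d' (T' : measurableType d') (c : R[i]) : cbounded (fun _ : T' => c).
Proof. by split; [exact: measurable_cst|exists (normc c)]. Qed.

Lemma cbounded_prod d' (T' : measurableType d') I (s : seq I) (f : I -> T' -> R[i]) :
  (forall i, cbounded (f i)) -> cbounded (fun x => \prod_(i <- s) f i x).
Proof.
move=> bf; elim: s => [|i s IH].
  by under eq_fun do rewrite big_nil; exact: cbounded_cst.
by under eq_fun do rewrite big_cons; exact: cboundedM.
Qed.

Lemma cbounded_comp d1 (T1 : measurableType d1) d2 (T2 : measurableType d2)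
    (X : T1 -> T2) (f : T2 -> R[i]) :
  measurable_fun setT X -> cbounded f -> cbounded (fun x => f (X x)).
Proof.
move=> mX [mf [C fC]]; split; last by exists C => x.
exact: measurableT_comp.
Qed.

Lemma cbounded_indic d' (T' : measurableType d') (A : set T') : measurable A ->
  cbounded (fun x => (\1_A x : R)%:C).
Proof.
move=> mA; split; first exact/measurable_realC/measurable_indic.
by exists 1 => x; rewrite normc_real indicE; case: (_ \in _); rewrite ?normr1 ?normr0.
Qed.

Lemma cintegral_indic (A : set T) : measurable A ->
  cintegral P (fun x => (\1_A x : R)%:C) = (fine (P A))%:C.
Proof.
move=> mA; apply: complex_ext => /=.
  by rewrite /Rintegral integral_indic// setIT.
by rewrite Rintegral_cst// mul0r.
Qed.

Section uncorrelated.
Context d' (T' : measurableType d') (X : T -> T').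
Hypothesis mX : measurable_fun setT X.

Lemma cintegral_layer_cake (G : T -> R[i]) (f : T' -> R) (D : R) : cbounded G ->
  measurable_fun setT f -> (forall y, 0 <= f y <= D) ->
  let H (u : R) := cintegral P (fun x => G x * (\1_[set y | 0 <= u < f y] (X x) : R)%:C) in
  cintegrable leb H /\ cintegral P (fun x => G x * (f (X x))%:C) = cintegral leb H.
Proof.
move=> [mG [C GC]] mf fD.
(* A negative D is contradictory because the sample space, being pointed, is not empty. *)
have [D0|D0] := ltP D 0.
  have T0 (x : T) : False.
    by have /andP[h1 h2] := fD (X x); have := le_trans h1 h2; rewrite leNgt D0.
  by exfalso; exact: (T0 point).
have i1 := integrable_indic_co (addr_ge0 D0 ler01).
pose F (z : T * measurableTypeR R) : R[i] := G z.1 * ((0 <= z.2 < f (X z.1))%R%:R : R)%:C.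
have mF : measurable_fun setT F.
  apply: measurable_cM; first exact: measurableT_comp.
  by apply: measurable_realC; exact: (measurable_indic_under (measurableT_comp mf mX)).
have ih : leb.-integrable setT (EFin \o (fun u => C * \1_(`[0, D + 1[%classic : set R) u)).
  exact: (integrableZl measurableT C i1).
have bu x u : `|((0 <= u < f (X x))%R%:R : R)| <= \1_(`[0, D + 1[%classic : set R) u.
  rewrite indicE mem_setE /= in_itv/=; have /andP[_ fX] := fD (X x).
  case: (boolP (0 <= u < f (X x))) => [/andP[u0 uf]|_]; last by rewrite normr0.
  by rewrite u0 (lt_le_trans uf) ?normr1// (le_trans fX)// lerDl.
have iF : cintegrable (P \x leb)%E F.
  apply: (cintegrable_le mF (integrable_prod2 P ih)) => -[x u].
  rewrite /F /= Normc.normcM normc_real ler_pM ?normc_ge0//.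
have [_ _ h1] := cintegral_fubiniR iF; have [_ h3 h2] := cintegral_fubiniL iF.
have HE u : cintegral P (fun x => F (x, u)) =
    cintegral P (fun x => G x * (\1_[set y | 0 <= (u : R) < f y] (X x) : R)%:C).
  by apply: eq_cintegral => x; rewrite /F /= indicE mem_setE.
split; first exact: eq_cintegrable HE h3.
transitivity (cintegral (P \x leb)%E F); last first.
  by rewrite -h2; exact: eq_cintegral.
rewrite -h1; apply: eq_cintegral => x.
have f0 : 0 <= f (X x) by have /andP[] := fD (X x).
rewrite /F /=; rewrite cintegralZl; last first.
  apply: (cintegrable_le _ i1).
    apply: measurable_realC.
    exact: measurableT_comp (measurable_indic_under (measurableT_comp mf mX)) (pair1_measurable x).
  by move=> u; rewrite normc_real; exact: bu.
congr (_ * _); apply: complex_ext => /=; last by rewrite Rintegral_cst// mul0r.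
by rewrite /Rintegral integral_under.
Qed.

(* By the layer cake formula it suffices to test [f] on indicators. *)
Lemma uncorrelated (G : T -> R[i]) (f : T' -> R[i]) : cbounded G -> cbounded f ->
  (forall A, measurable A ->
    cintegral P (fun x => G x * (\1_A (X x) : R)%:C) =
    cintegral P G * (fine (P (X @^-1` A)))%:C) ->
  cintegral P (fun x => G x * f (X x)) = cintegral P G * cintegral P (fun x => f (X x)).
Proof.
move=> bG bf GA.
have bfX := cbounded_comp mX bf.
have pos (h : T' -> R) (D : R) : measurable_fun setT h -> (forall y, 0 <= h y <= D) ->
    cintegral P (fun x => G x * (h (X x))%:C) =
    cintegral P G * cintegral P (fun x => (h (X x))%:C).
  move=> mh hD; have [_ ->] := cintegral_layer_cake bG mh hD.
  have [i1] := cintegral_layer_cake (cbounded_cst _ 1) mh hD.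
  under eq_cintegral do rewrite mul1r; move=> ->.
  have mA (u : R) : measurable [set y | 0 <= u < h y].
    have := measurable_under mh => /(measurable_ysection u).
    by congr measurable; apply/seteqP; split => y; rewrite /ysection/= inE.
  rewrite -cintegralZl//.
  apply: eq_cintegral => u; rewrite GA//; congr (_ * _).
  under eq_cintegral do rewrite mul1r.
  rewrite -cintegral_indic; last first.
    by rewrite -[X in measurable X]setTI; exact: mX.
  by apply: eq_cintegral => x; rewrite !indicE.
have real (h : T' -> R) (D : R) : measurable_fun setT h -> (forall y, `|h y| <= D) ->
    cintegral P (fun x => G x * (h (X x))%:C) =
    cintegral P G * cintegral P (fun x => (h (X x))%:C).
  (* Adding the constant D makes the function nonnegative and bounded; the constant contributes the
     same amount to both sides. *)
  move=> mh hD; pose g y := h y + D.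
  have mg : measurable_fun setT g by apply: measurable_funD.
  have gD y : 0 <= g y <= D + D.
    by have := hD y; rewrite ler_norml /g => /andP[h1 h2]; apply/andP; split; lra.
  have bg : cbounded (fun x => (g (X x))%:C).
    apply: (cbounded_comp (f := fun y => (g y)%:C) mX); split; first exact: measurable_realC.
    by exists (D + D) => y; rewrite normc_real; have /andP[g0 g1] := gD y; rewrite ger0_norm.
  have e x : (h (X x))%:C = (g (X x))%:C - D%:C by rewrite -rmorphB /g addrK.
  have e1 x : G x * (h (X x))%:C = G x * (g (X x))%:C - D%:C * G x by rewrite e; ring.
  have c1 := cbounded_cintegrable bg; have c2 := cbounded_cintegrable (cbounded_cst _ D%:C).
  have c3 := cbounded_cintegrable (cboundedM bG bg).
  have c4 := cintegrableZl D%:C (cbounded_cintegrable bG).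
  rewrite (eq_cintegral _ e1) (eq_cintegral _ e) !cintegralB//.
  rewrite cintegralZl; last exact: cbounded_cintegrable.
  rewrite (pos _ _ mg gD) cintegral_cst1; last exact: probability_setT.
  by ring.
have [mf [C fC]] := bf.
have mR := measurable_cRe mf; have mI := measurable_cIm mf.
have hR := real (fun y => cRe (f y)) C mR (fun y => le_trans (ler_cRe_normc _) (fC y)).
have hI := real (fun y => cIm (f y)) C mI (fun y => le_trans (ler_cIm_normc _) (fC y)).
have bR : cbounded (fun x => (cRe (f (X x)))%:C).
  apply: (cbounded_comp (f := fun y => (cRe (f y))%:C) mX); split; first exact: measurable_realC.
  by exists C => y; rewrite normc_real (le_trans (ler_cRe_normc _) (fC y)).
have bI : cbounded (fun x => (cIm (f (X x)))%:C).
  apply: (cbounded_comp (f := fun y => (cIm (f y))%:C) mX); split; first exact: measurable_realC.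
  by exists C => y; rewrite normc_real (le_trans (ler_cIm_normc _) (fC y)).
have e x : f (X x) = (cRe (f (X x)))%:C + 'i%C * (cIm (f (X x)))%:C.
  by apply: complex_ext; rewrite /=; ring.
have e1 x : G x * f (X x) = G x * (cRe (f (X x)))%:C + 'i%C * (G x * (cIm (f (X x)))%:C).
  by rewrite {1}e; ring.
have c1 := cbounded_cintegrable bR; have c2 := cbounded_cintegrable bI.
have c3 := cbounded_cintegrable (cboundedM bG bR).
have c4 := cbounded_cintegrable (cboundedM bG bI).
rewrite (eq_cintegral _ e1) (eq_cintegral _ e) !cintegralD//; try exact: cintegrableZl.
rewrite !cintegralZl//.
rewrite hR hI; ring.
Qed.

End uncorrelated.

Lemma indep_cintegral_prod d' (T' : measurableType d') (I : eqType)
    (X : I -> {RV P >-> T'}) (f : I -> T' -> R[i]) (s : seq I) :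
  mutually_independent X -> (forall i, cbounded (f i)) -> uniq s ->
  cintegral P (fun x => \prod_(i <- s) f i (X i x)) =
  \prod_(i <- s) cintegral P (fun x => f i (X i x)).
Proof.
move=> ind bf us.
(* Independence is stated for events. The strengthened claim mixes functions indexed by s with
   indicators indexed by t, so that a function can be tested on an indicator by moving its index
   from s to t. *)
suff gen : forall s t (A : I -> set T'), (forall i, measurable (A i)) -> uniq (s ++ t) ->
    cintegral P (fun x => \prod_(i <- s) f i (X i x) * (\1_(\bigcap_(j in [set` t]) X j @^-1` A j) x : R)%:C) =
    \prod_(i <- s) cintegral P (fun x => f i (X i x)) * (\prod_(j <- t) fine (P (X j @^-1` A j)))%:C.
  have := gen s [::] (fun=> setT); rewrite cats0 big_nil mulr1 => <- //.
  apply: eq_cintegral => x; rewrite indicE mem_set ?mulr1//.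
have mXA j A : measurable A -> measurable (X j @^-1` A).
  by move=> mA; rewrite -[X in measurable X]setTI; exact: measurable_funP.
have mcap (t : seq I) (A : I -> set T') : (forall i, measurable (A i)) ->
    measurable (\bigcap_(j in [set` t]) X j @^-1` A j).
  move=> mA; apply: fin_bigcap_measurable => [|j _]; last exact: mXA.
  exact: finite_seq.
have bX i : cbounded (fun x => f i (X i x)).
  by apply: cbounded_comp => //; exact: measurable_funP.
elim=> [|i r IH] t A mA /=.
  move=> ut; under eq_cintegral do rewrite big_nil mul1r.
  rewrite big_nil mul1r cintegral_indic; last exact: mcap.
  rewrite ind//; congr (_%:C).
  rewrite (eq_bigr (fun j => (fine (P (X j @^-1` A j)))%:E)) => [|j _]; last first.
    by rewrite fineK//; apply: fin_num_measure; exact: mXA.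
  by rewrite -(big_morph EFin EFinM erefl).
move=> /andP[irt urt].
pose G x := \prod_(i <- r) f i (X i x) * (\1_(\bigcap_(j in [set` t]) X j @^-1` A j) x : R)%:C.
have bG : cbounded G.
  by apply: cboundedM; [exact: cbounded_prod|exact/cbounded_indic/mcap].
transitivity (cintegral P (fun x => G x * f i (X i x))).
  by apply: eq_cintegral => x; rewrite big_cons /G; ring.
rewrite uncorrelated//.
- by rewrite /G IH// big_cons; ring.
- move=> B mB.
  (* The test set B is inserted at index i; since i does not occur in t, the events already there
     are unchanged. *)
  pose A' j := if j == i then B else A j.
  have mA' j : measurable (A' j) by rewrite /A'; case: ifP.
  have urt' : uniq (r ++ i :: t) by rewrite -(uniq_catCA [:: i] r t)/= irt.
  have it : i \notin t by apply: contra irt; rewrite mem_cat orbC => ->.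
  have A'i : A' i = B by rewrite /A' eqxx.
  have A't j : j \in t -> A' j = A j.
    by move=> jt; rewrite /A'; case: eqP => // ji; move: it; rewrite -ji jt.
  rewrite {2}/G IH//.
  transitivity (cintegral P (fun x => \prod_(i <- r) f i (X i x) *
      (\1_(\bigcap_(j in [set` i :: t]) X j @^-1` A' j) x : R)%:C)).
    apply: eq_cintegral => x; rewrite /G -mulrA -rmorphM; congr (_ * _%:C).
    rewrite !indicE -natrM mulnb; congr (nat_of_bool _)%:R.
    apply/andP/idP => [[]|]; rewrite !inE.
      move=> h1 h2 j /=; rewrite inE => /orP[/eqP ->|jt]; first by rewrite A'i.
      by rewrite A't//; exact: h1.
    move=> h; split => [j /= jt|]; last by have := h i; rewrite A'i; apply; rewrite /= mem_head.
    by rewrite -A't//; apply: h; rewrite /= inE jt orbT.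
  rewrite IH// big_cons A'i [X in _ * (_ * X)%:C](eq_big_seq (fun j => fine (P (X j @^-1` A j)))).
    by rewrite rmorphM /=; ring.
  by move=> j jt; rewrite A't.
Qed.

End independence.

(** * Transfer of integrals between variables with the same law *)

Section same_law.
Context {R : realType} d1 (T1 : measurableType d1) d2 (T2 : measurableType d2)
  d' (T' : measurableType d').
Variables (P1 : {measure set T1 -> \bar R}) (P2 : {measure set T2 -> \bar R}).
Variables (X1 : T1 -> T') (X2 : T2 -> T').
Hypothesis mX1 : measurable_fun setT X1.
Hypothesis mX2 : measurable_fun setT X2.
Hypothesis lawE : forall A, measurable A -> P1 (X1 @^-1` A) = P2 (X2 @^-1` A).

Lemma same_law_ge0 (g : T' -> \bar R) : measurable_fun setT g -> (forall y, 0 <= g y)%E ->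
  (\int[P1]_x g (X1 x) = \int[P2]_x g (X2 x))%E.
Proof.
move=> mg g0.
have h1 := @ge0_integral_pushforward _ _ _ _ R X1 mX1 P1 setT g measurableT mg (fun y _ => g0 y).
have h2 := @ge0_integral_pushforward _ _ _ _ R X2 mX2 P2 setT g measurableT mg (fun y _ => g0 y).
rewrite !preimage_setT in h1 h2; rewrite -[LHS]h1 -[RHS]h2.
by apply: eq_measure_integral => A mA _; exact: lawE.
Qed.

Lemma same_law_integrable (g : T' -> R) : measurable_fun setT g ->
  P2.-integrable setT (EFin \o (g \o X2)) ->
  P1.-integrable setT (EFin \o (g \o X1)) /\
  \int[P1]_x g (X1 x) = \int[P2]_x g (X2 x).
Proof.
move=> mg /integrableP[_ i2].
have mg' : measurable_fun setT (EFin \o g) by exact/measurable_EFinP.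
split.
  apply/integrableP; split; first by apply/measurable_EFinP; exact: measurableT_comp.
  rewrite (same_law_ge0 (g := fun y => `|(g y)%:E|%E))//; exact: measurableT_comp.
rewrite /Rintegral; congr fine; rewrite integralE [RHS]integralE; congr (_ - _)%E.
  under eq_integral do rewrite funeposE /=; under [RHS]eq_integral do rewrite funeposE /=.
  apply: (same_law_ge0 (g := fun y => maxe (g y)%:E 0)) => [|y]; last by rewrite le_max lexx orbT.
  by apply: measurable_maxe => //; exact: measurable_cst.
under eq_integral do rewrite funenegE /=; under [RHS]eq_integral do rewrite funenegE /=.
apply: (same_law_ge0 (g := fun y => maxe (- g y)%:E 0)) => [|y]; last by rewrite le_max lexx orbT.
apply: measurable_maxe; last exact: measurable_cst.
by apply/measurable_EFinP; exact: measurable_funN.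
Qed.

Lemma same_law_cintegral (g : T' -> R[i]) : measurable_fun setT g ->
  cintegrable P2 (fun x => g (X2 x)) ->
  cintegrable P1 (fun x => g (X1 x)) /\
  cintegral P1 (fun x => g (X1 x)) = cintegral P2 (fun x => g (X2 x)).
Proof.
move=> mg [iR iI].
have [r1 r2] := same_law_integrable (measurable_cRe mg) iR.
have [i1 i2] := same_law_integrable (measurable_cIm mg) iI.
by split; [split|exact: complex_ext].
Qed.

End same_law.

Section char_law.
Context {R : realType}.

Let law_probability d (T : measurableType d) (P : probability T R) (X : T -> R) :
  measurable_fun setT X ->
  exists m : probability (measurableTypeR R) R, forall A, m A = P (X @^-1` A).
Proof.
move=> mX.
pose X0 : T -> measurableTypeR R := X.
have mX' : measurable_fun setT X0 by exact: mX.
pose X' : {RV P >-> measurableTypeR R} := mfun_Sub (mem_set mX').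
by exists (distribution P X').
Qed.

Lemma charf_law d1 (T1 : measurableType d1) d2 (T2 : measurableType d2)
    (P1 : probability T1 R) (P2 : probability T2 R) (X1 : T1 -> R) (X2 : T2 -> R) :
  measurable_fun setT X1 -> measurable_fun setT X2 ->
  (forall t, cintegral P1 (fun x => cexp ((t * X1 x) *i)) =
             cintegral P2 (fun x => cexp ((t * X2 x) *i))) ->
  forall A : set R, measurable A -> P1 (X1 @^-1` A) = P2 (X2 @^-1` A).
Proof.
move=> mX1 mX2 cf A mA.
have [m1 h1] := law_probability P1 mX1; have [m2 h2] := law_probability P2 mX2.
have aux d (T : measurableType d) (P : probability T R) (X : T -> R)
    (m : probability (measurableTypeR R) R) : measurable_fun setT X ->
    (forall A, m A = P (X @^-1` A)) ->
    forall t, charf m t = cintegral P (fun x => cexp ((t * X x) *i)).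
  move=> mX hm t.
  have mX' : @measurable_fun _ _ T (measurableTypeR R) setT X by exact: mX.
  have := @same_law_cintegral R _ (measurableTypeR R) _ T _ (measurableTypeR R) m P id X
    (@measurable_id _ _ setT) mX' (fun A _ => hm A) (fun x => cexp ((t * x) *i))
    (measurable_charf_fun t).
  case=> //; apply: (@cintegrable_bounded _ _ _ _ _ 1) => [|z]; last by rewrite normc_charf_fun.
  exact: measurableT_comp (measurable_charf_fun t) mX'.
rewrite -h1 -h2; apply: charf_inj => // t.
by rewrite (aux _ _ _ _ _ mX1 h1) (aux _ _ _ _ _ mX2 h2).
Qed.

End char_law.

(** * The normal law: integrals, characteristic function, moments *)

Section normal_law.
Context {R : realType}.
Local Notation leb := (@lebesgue_measure R).
Local Notation N m s := (normal_prob (m : R) (s : R)).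

(** The layer cake formula on both sides reduces the claim to indicators, where it is the definition
    of [normal_prob] as an integral of its density. *)
Lemma ge0_integral_normal (m s : R) (f : R -> R) : measurable_fun setT f ->
  (forall x, 0 <= f x) ->
  (\int[N m s]_x (f x)%:E = \int[leb]_x (normal_pdf m s x * f x)%:E)%E.
Proof.
move=> mf f0.
have := @weighted_layer_cake R _ _ (N m s) (fun=> 1) f (measurable_cst _) (fun=> ler01) mf f0.
under eq_integral do rewrite mul1r; move=> ->.
have pdf0 x : 0 <= normal_pdf m s x := normal_pdf_ge0 m s x.
have mpdf := measurable_normal_pdf m s.
rewrite (@weighted_layer_cake R _ _ leb _ f mpdf pdf0 mf f0).
apply: eq_integral => u _.
have mA : measurable [set x : measurableTypeR R | 0 <= u < f x].
  have := measurable_under (T := measurableTypeR R) mf => /(measurable_ysection u).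
  by congr measurable; apply/seteqP; split => y; rewrite /ysection/= inE.
transitivity (\int[N m s]_x (\1_[set x : measurableTypeR R | (0 <= u < f x)%R] x)%:E)%E.
  by apply: eq_integral => x _; rewrite mul1r indicE mem_setE.
rewrite integral_indic//= setIT /normal_prob integral_mkcond.
apply: eq_integral => x _; rewrite patchE; case: (boolP (0 <= u < f x)) => h.
  by rewrite mem_set// mulr1.
by rewrite memNset ?mulr0//; exact/negP.
Qed.

Lemma cintegral_normal (m s : R) (f : R -> R[i]) : measurable_fun setT f ->
  cintegrable leb (fun x => (normal_pdf m s x)%:C * f x) ->
  cintegrable (N m s) f /\
  cintegral (N m s) f = cintegral leb (fun x => (normal_pdf m s x)%:C * f x).
Proof.
have pdf0 x : 0 <= normal_pdf m s x := normal_pdf_ge0 m s x.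
have key (g : R -> R) : measurable_fun setT g ->
   leb.-integrable setT (fun x => (normal_pdf m s x * g x)%:E) ->
   (N m s).-integrable setT (fun x => (g x)%:E) /\
   \int[N m s]_x g x = \int[leb]_x (normal_pdf m s x * g x).
  move=> mg ig; split.
    apply/integrableP; split; first exact/measurable_EFinP.
    rewrite (ge0_integral_normal m s (f := fun x => `|g x|))//; last exact: measurableT_comp.
    have /integrableP[_] := ig; apply: le_lt_trans; rewrite le_eqVlt; apply/orP; left.
    by apply/eqP/eq_integral => x _; rewrite /= normrM ger0_norm.
  rewrite /Rintegral; congr fine; rewrite integralE [RHS]integralE; congr (_ - _)%E.
    under eq_integral do rewrite funeposE -EFin_max.
    rewrite (ge0_integral_normal m s (f := fun x => Num.max (g x) 0)); last 2 first.
    - exact: measurable_maxr.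
    - by move=> x; rewrite le_max lexx orbT.
    by apply: eq_integral => x _; rewrite funeposE -EFin_max maxr_pMr// mulr0.
  under eq_integral do rewrite funenegE -EFinN -EFin_max.
  rewrite (ge0_integral_normal m s (f := fun x => Num.max (- g x) 0)); last 2 first.
  - by apply: measurable_maxr => //; exact: measurable_funN.
  - by move=> x; rewrite le_max lexx orbT.
  by apply: eq_integral => x _; rewrite funenegE -EFinN -EFin_max maxr_pMr// mulr0 mulrN.
move=> mf [iR iI].
have eR x : cRe ((normal_pdf m s x)%:C * f x) = normal_pdf m s x * cRe (f x) by rewrite cReMr.
have eI x : cIm ((normal_pdf m s x)%:C * f x) = normal_pdf m s x * cIm (f x) by rewrite cImMr.
have iR' : leb.-integrable setT (fun x => (normal_pdf m s x * cRe (f x))%:E).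
  by move: iR; congr (_.-integrable _ _); apply/funext => x; rewrite eR.
have iI' : leb.-integrable setT (fun x => (normal_pdf m s x * cIm (f x))%:E).
  by move: iI; congr (_.-integrable _ _); apply/funext => x; rewrite eI.
have [a1 b1] := key _ (measurable_cRe mf) iR'.
have [a2 b2] := key _ (measurable_cIm mf) iI'.
split; first by split.
apply: complex_ext => /=; [rewrite b1|rewrite b2].
  by congr fine; apply: eq_integral => x _; rewrite eR.
by congr fine; apply: eq_integral => x _; rewrite eI.
Qed.

Lemma charf_normal (m s t : R) : 0 < s ->
  charf (N m s) t = cexp ((t * m) *i - (s ^+ 2 * t ^+ 2 / 2)%:C).
Proof.
move=> s0; have sn0 : s != 0 by rewrite gt_eqF.
pose a := (s ^+ 2)^-1; have a0 : 0 < a by rewrite invr_gt0 exprn_gt0.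
(* From expanding the square: - a (x - m)^2 / 2 contributes the linear term a m x, and the constant
   - a m^2 / 2 goes into k. *)
pose z : R[i] := t *i + (m * a)%:C.
pose k := normal_peak s * expR (- (m ^+ 2 * a / 2)).
have e x : (normal_pdf m s x)%:C * cexp ((t * x) *i) = k%:C * gaussF a z x.
  rewrite normal_pdfE// /k !rmorphM /= -!mulrA; congr (_ * _).
  rewrite /normal_fun /gaussF -!cexp_real -!cexpD; congr cexp.
  by rewrite /z /a; apply: complex_ext; rewrite /=; field.
have ie : cintegrable leb (fun x => (normal_pdf m s x)%:C * cexp ((t * x) *i)).
  rewrite (_ : (fun x => _) = (fun x => k%:C * gaussF a z x)); last exact/funext.
  exact/cintegrableZl/cintegrable_gaussF.
have [_] := cintegral_normal (measurable_charf_fun t) ie.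
rewrite /charf => ->; transitivity (cintegral leb (fun x => k%:C * gaussF a z x)).
  by apply: eq_cintegral => x; rewrite e.
rewrite cintegralZl; last exact: cintegrable_gaussF.
rewrite (cintegral_gauss _ a0) mulrA -rmorphM /=.
have -> : k * Num.sqrt (2 * pi / a) = expR (- (m ^+ 2 * a / 2)).
  rewrite /k mulrAC /normal_peak (_ : 2 * pi / a = s ^+ 2 * pi *+ 2); last first.
    by rewrite /a invrK mulr2n; ring.
  rewrite mulVf ?mul1r// gt_eqF// sqrtr_gt0 pmulrn_lgt0// mulr_gt0 ?pi_gt0// exprn_gt0//.
rewrite -cexp_real -cexpD; congr cexp.
by rewrite /z /a; apply: complex_ext; rewrite /=; field.
Qed.

Lemma integrable_normal_expR (C : R) :
  (N 0 1).-integrable setT (fun x => (expR (C * `|x|))%:E).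
Proof.
pose f (x : R) : R[i] := (expR (C * `|x|))%:C.
have mf : measurable_fun setT f.
  by apply: measurable_realC; apply: measurableT_comp => //; apply: measurable_funM.
have [] := @cintegral_normal 0 1 f mf; last by case.
apply: (cintegrable_le _ (integrableZl measurableT (normal_peak 1) (integrable_gauss C ltr01))).
  by apply: measurable_cM => //; apply: measurable_realC; exact: measurable_normal_pdf.
move=> x; rewrite -rmorphM normc_real ger0_norm; last first.
  by rewrite mulr_ge0 ?expR_ge0 ?normal_pdf_ge0.
have -> : normal_pdf 0 1 x = normal_peak 1 * normal_fun 0 1 x by rewrite normal_pdfE ?oner_eq0.
suff h : normal_fun 0 1 x * expR (C * `|x|) <= expR (C * `|x| - 1 / 2 * x ^+ 2).
  by rewrite -[leLHS]mulrA; exact: (ler_wpM2l (normal_peak_ge0 1) h).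
rewrite /normal_fun -expRD ler_expR subr0 expr1n mulr2n le_eqVlt; apply/orP; left; apply/eqP.
by field.
Qed.

Let Nid_le (C x : R) : 0 <= C -> `|x| * expR (C * `|x|) <= expR ((C + 1) * `|x|).
Proof.
move=> C0; rewrite mulrDl mul1r expRD mulrC ler_wpM2l ?expR_ge0//.
by have := expR_ge1Dx `|x|; lra.
Qed.

Lemma integrable_normal_id : (N 0 1).-integrable setT (fun x => (x%:E)).
Proof.
apply: le_integrable (integrable_normal_expR 1) => //; first exact/measurable_EFinP.
move=> x _ /=; rewrite lee_fin [leRHS]ger0_norm ?expR_ge0// mul1r.
by have := expR_ge1Dx `|x|; lra.
Qed.

Lemma integrable_normal_sqr : (N 0 1).-integrable setT (fun x => ((x ^+ 2)%:E)).
Proof.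
apply: le_integrable (integrable_normal_expR 2) => //.
  by apply/measurable_EFinP; exact: measurable_funX.
move=> x _ /=; rewrite lee_fin [leRHS]ger0_norm ?expR_ge0// normrX.
rewrite (_ : 2 * `|x| = `|x| + `|x|) ?expRD; last by ring.
have h := expR_ge1Dx `|x|; rewrite expr2 ler_pM//; lra.
Qed.

(** The characteristic function is differentiated under the integral, first at an arbitrary point
    and then once more at 0; both slopes are identified by [ex2_uniq]. Mean and second moment are
    the imaginary part of the first result and minus the real part of the second. *)
Lemma normal_moments : \int[N 0 1]_x x = 0 /\ \int[N 0 1]_x (x ^+ 2) = 1.
Proof.
have ch t : cintegral (N 0 1) (fun x => cexp ((t * x) *i)) = cexp (- (t ^+ 2 / 2)%:C).
  have := charf_normal 0 t ltr01; rewrite /charf => ->; congr cexp.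
  by apply: complex_ext; rewrite /=; field.
have mi : measurable_fun setT (fun x : measurableTypeR R => x *i) by exact: measurable_imag.
have d1 t0 : cintegral (N 0 1) (fun x => cexp ((t0 * x) *i) * x *i) =
    - t0%:C * cexp (- (t0 ^+ 2 / 2)%:C).
  have := @ex2_cintegral R _ _ (N 0 1) (fun x => cexp ((t0 * x) *i)) (fun x => x *i) _
    (measurable_charf_fun t0) mi (integrable_normal_expR 3).
  have h0 (x : R) : normc (cexp ((t0 * x) *i)) * expR (3 * normc (x *i)) <= expR (3 * `|x|).
    by rewrite normc_charf_fun mul1r /Normc.normc /= expr0n add0r sqrtr_sqr.
  move=> /(_ h0) h1.
  have h2 := ex2M (ex2_cst (cexp (- (t0 ^+ 2 / 2)%:C))) (ex2_cexp (- t0%:C) (- 2^-1)).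
  rewrite mul0r addr0 mulr1 in h2.
  rewrite [RHS]mulrC; apply: (ex2_uniq h1); apply: ex2_ext h2 => t /=.
  transitivity (cintegral (N 0 1) (fun x => cexp (((t0 + t) * x) *i))).
    rewrite ch -cexpD; congr cexp.
    by apply: complex_ext; rewrite /=; field.
  apply: eq_cintegral => x; rewrite -cexpD; congr cexp.
  by apply: complex_ext; rewrite /=; ring.
have m1 : cintegral (N 0 1) (fun x => x *i) = 0.
  rewrite -[RHS](_ : - (0 : R)%:C * cexp (- (0 ^+ 2 / 2)%:C) = 0); last by rewrite oppr0 mul0r.
  rewrite -d1; apply: eq_cintegral => x; rewrite mul0r.
  by rewrite (_ : 0 *i = 0) ?cexp0 ?mul1r.
have m2 : cintegral (N 0 1) (fun x => x *i * x *i) = -1.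
  have := @ex2_cintegral R _ _ (N 0 1) (fun x => x *i) (fun x => x *i) _
    mi mi (integrable_normal_expR 4).
  have h0 (x : R) : normc (x *i) * expR (3 * normc (x *i)) <= expR (4 * `|x|).
    have := Nid_le x (ler0n R 3); have -> : 3 + 1 = 4 :> R by ring.
    by rewrite /Normc.normc /= expr0n add0r sqrtr_sqr.
  move=> /(_ h0) h1; apply: (ex2_uniq h1).
  have h2 := ex2M (ex2_lin (0 : R[i]) (-1)) (ex2_cexp 0 (- 2^-1)).
  rewrite !(mulr1, mulr0, add0r) in h2; apply: ex2_ext h2 => t /=.
  transitivity (cintegral (N 0 1) (fun x => cexp ((t * x) *i) * x *i)).
    rewrite d1; congr (_ * cexp _); first by ring.
    by apply: complex_ext; rewrite /=; field.
  by apply: eq_cintegral => x; rewrite mulrC; congr (_ * cexp _); apply: complex_ext; rewrite /=; ring.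
split; first exact: (congr1 (@complex.Im R) m1).
have := congr1 (@complex.Re R) m2 => /= h.
apply: oppr_inj; rewrite -h -mulN1r -RintegralZl//; last exact: integrable_normal_sqr.
by apply: eq_Rintegral => x _ /=; ring.
Qed.

(** Every Gaussian law, degenerate or not, is an affine image of the standard one; this treats zero
    variance uniformly in what follows. *)
Lemma gaussian_lawE (m s : R) (A : set (measurableTypeR R)) : 0 <= s -> measurable A ->
  gaussian_law m s A = N 0 1 ((fun z => m + s * z) @^-1` A).
Proof.
move=> s0 mA; rewrite /gaussian_law; case: eqP => [->|/eqP sn0].
  rewrite diracE; case: (boolP (m \in A)) => mA'.
    rewrite (_ : _ @^-1` _ = setT) ?probability_setT//.
    by apply/seteqP; split => // z _ /=; rewrite mul0r addr0; rewrite inE in mA'.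
  rewrite (_ : _ @^-1` _ = set0) ?measure0//.
  by apply/seteqP; split => // z /=; rewrite mul0r addr0; rewrite notin_setE in mA'.
have sp : 0 < s by rewrite lt_def sn0.
have maff : measurable_fun setT (fun z : measurableTypeR R => m + s * z).
  by apply: measurable_funD => //; apply: measurable_funM.
have mid : measurable_fun setT (fun z : measurableTypeR R => (z : R)) by [].
suff cf t : cintegral (N m s) (fun x => cexp ((t * x) *i)) =
    cintegral (N 0 1) (fun x => cexp ((t * (m + s * x)) *i)).
  exact: (charf_law mid maff cf mA).
have := charf_normal m t sp; rewrite /charf => ->.
transitivity (cexp ((t * m) *i) * charf (N 0 1) (t * s)).
  rewrite charf_normal// -cexpD; congr cexp.
  by apply: complex_ext; rewrite /=; ring.
rewrite -cintegralZl; last exact: cintegrable_charf_fun.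
by apply: eq_cintegral => x; rewrite -cexpD; congr cexp; apply: complex_ext; rewrite /=; ring.
Qed.

End normal_law.

(** * Series in i.i.d. Gaussian variables *)

Section gaussian_sums.
Context {R : realType} d (T : measurableType d) (P : probability T R).
Context (I : countType) (gamma : I -> {RV P >-> R}).
Hypothesis gamma_iid : iid gamma (normal_prob 0 1).
Local Notation N := (normal_prob (0 : R) (1 : R)).

Definition gsum (c : I -> R) (x : T) : R := rsum (fun l => c l * gamma l x).

Let mgamma l : measurable_fun setT (gamma l).
Proof. exact: measurable_funP. Qed.

Let gamma_lawE l (A : set R) : measurable A ->
  P (gamma l @^-1` A) = N ((fun z : measurableTypeR R => (z : R)) @^-1` A).
Proof. by move=> mA; have [h _] := gamma_iid; exact: h. Qed.

Let mid : measurable_fun setT (fun z : measurableTypeR R => (z : R)).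
Proof. by []. Qed.

Lemma gamma_abs_bound : exists K : R, 0 <= K /\
  forall l, (\int[P]_x (`|gamma l x|)%:E = K%:E)%E.
Proof.
have iN : N.-integrable setT (fun x : measurableTypeR R => `|(x : R)%:E|%E).
  exact: integrable_abse integrable_normal_id.
exists (fine (\int[N]_x `|(x : R)%:E|)%E); split; first by apply: fine_ge0; exact: integral_ge0.
move=> l; rewrite fineK; last exact: integrable_fin_num.
apply: (same_law_ge0 (mgamma l) mid (gamma_lawE l) (g := fun y : R => `|y|%:E)) => //.
by apply/measurable_EFinP; exact: normr_measurable.
Qed.

Lemma cintegral_cexp_gamma l (t : R) :
  cintegral P (fun x => cexp ((t * gamma l x) *i)) = cexp (- (t ^+ 2 / 2)%:C).
Proof.
have mg : measurable_fun setT (fun y : R => cexp ((t * y) *i)) by exact: measurable_charf_fun.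
have [] := same_law_cintegral (mgamma l) mid (gamma_lawE l) mg.
  exact: cintegrable_charf_fun.
move=> _ ->; have := charf_normal 0 t ltr01; rewrite /charf => ->; congr cexp.
by apply: complex_ext; rewrite /=; field.
Qed.

Lemma sum_useq (V : nmodType) (f : I -> V) (r : seq nat) :
  \sum_(k <- r) useq 0 f k = \sum_(l <- pmap pickle_inv r) f l.
Proof.
elim: r => [|k r IH]; first by rewrite !big_nil.
by rewrite big_cons IH /= /useq; case: pickle_inv => [i|] /=; rewrite ?big_cons ?add0r.
Qed.

Section one.
Variable c : I -> R.
Hypothesis sc : summable [set: I] (EFin \o c).

(** A summable family is bounded by its sum S, hence c^2 <= S |c|. *)
Lemma summable_sqr : summable [set: I] (EFin \o (fun l => c l ^+ 2)).
Proof.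
have ca0 l : 0 <= `|c l| := normr_ge0 _.
have sS : (\esum_(l in [set: I]) `|c l|%:E < +oo)%E by exact: sc.
pose S := fine (\esum_(l in [set: I]) `|c l|%:E)%E.
have SE : S%:E = (\esum_(l in [set: I]) `|c l|%:E)%E.
  by rewrite fineK// ge0_fin_numE// esum_ge0// => l _; rewrite lee_fin.
have S0 : 0 <= S by apply: fine_ge0; apply: esum_ge0 => l _; rewrite lee_fin.
have cS l : `|c l| <= S.
  rewrite -lee_fin SE (esumID [set l])//.
  by rewrite setTI esum_set1 ?lee_fin// leeDl// esum_ge0// => i _; rewrite lee_fin.
have sc' : summable [set: I] (EFin \o (fun l => `|c l|)) by apply/summable_ge0P.
have := summableZ S sc'; apply: le_lt_trans; apply: le_esum => l _ /=.
by rewrite lee_fin normrX normrM normr_id expr2 (ger0_norm S0) ler_wpM2r.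
Qed.

Definition gvar : R := rsum (fun l => c l ^+ 2).

Lemma gvar_ge0 : 0 <= gvar.
Proof.
rewrite /gvar /rsum [X in _ - fine X]esum1; last first.
  move=> l _; rewrite funenegE /= -EFin_max; congr EFin; apply/max_idPr.
  by rewrite oppr_le0 sqr_ge0.
by rewrite subr0; apply: fine_ge0; apply: esum_ge0.
Qed.

(** All [gamma l] share the same finite E|gamma l|, so the sum of the E|c_l gamma_l| is finite; the
    series then converges absolutely almost surely, as unconditional summation requires. *)
Lemma ae_summable_gsum :
  {ae P, forall x, summable [set: I] (EFin \o (fun l => c l * gamma l x))}.
Proof.
have [K [K0 hK]] := gamma_abs_bound.
have sc' : summable [set: I] (EFin \o (fun l => `|c l|)) by apply/summable_ge0P.
have mf l : measurable_fun setT (fun x => (c l * gamma l x)%:C : R[i]).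
  by apply: measurable_realC; apply: measurable_funM.
have [] := @cintegral_csum R I _ T P (fun l x => (c l * gamma l x)%:C) _ mf (summableZ K sc').
  move=> l; under eq_integral do rewrite normc_real normrM EFinM.
  rewrite ge0_integralZl ?lee_fin//; last by apply/measurable_EFinP; exact: measurableT_comp.
  by rewrite hK -EFinM mulrC.
by move=> h _ _ _; apply: filterS h => x [].
Qed.

Lemma measurable_gsum : measurable_fun setT (gsum c).
Proof. by apply: measurable_rsum => l; apply: measurable_funM. Qed.

(** Partial sums along the enumeration of I; indices coding nothing contribute zero. *)
Let S n (x : T) : R := \sum_(k < n) useq 0 (fun l => c l * gamma l x) k.

Let mS n : measurable_fun setT (S n).
Proof.
apply: measurable_sum => k; rewrite /useq; case: pickle_inv => [l|] //=.
by apply: measurable_funM.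
Qed.

Let cvgS : {ae P, forall x, S ^~ x @ \oo --> gsum c x}.
Proof.
apply: filterS ae_summable_gsum => x /cvg_rsum h.
suff -> : S ^~ x = series (useq 0 (fun l => c l * gamma l x)) by [].
by apply/funext => n; rewrite /series /= big_mkord.
Qed.

Let cfS n t : cintegral P (fun x => cexp ((t * S n x) *i)) =
  (expR (- (t ^+ 2 / 2 * series (useq 0 (fun l => c l ^+ 2)) n)))%:C.
Proof.
have us : uniq (pmap (@pickle_inv I) (index_iota 0 n)).
  by apply: (pmap_uniq (@pickle_invK I)); exact: iota_uniq.
have bf l : cbounded (fun y : R => cexp ((t * c l * y) *i)).
  split; first exact: measurable_charf_fun.
  by exists 1 => y; rewrite normc_charf_fun.
have [_ ind] := gamma_iid.
have := indep_cintegral_prod ind bf us.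
under [X in _ = X -> _]eq_bigr do rewrite cintegral_cexp_gamma.
rewrite -cexp_sum => h.
transitivity (cintegral P (fun x =>
    \prod_(l <- pmap pickle_inv (index_iota 0 n)) cexp ((t * c l * gamma l x) *i))).
  apply: eq_cintegral => x; rewrite -cexp_sum; congr cexp.
  rewrite /S -(big_mkord xpredT) sum_useq.
  apply: complex_ext; rewrite ?cRe_sum ?cIm_sum /=; first by rewrite big1.
  by rewrite mulr_sumr; apply: eq_bigr => l _; rewrite mulrA.
rewrite h -cexp_real; congr cexp.
rewrite /series /= sum_useq mulr_sumr -sumrN raddf_sum; apply: eq_bigr => l _ /=.
by rewrite exprMn -rmorphN; congr (_%:C); ring.
Qed.

Let lim_bounded (h : R -> R) t : continuous h -> (forall y, `|h y| <= 1) ->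
  (\int[P]_x (h (t * S n x))%:E @[n --> \oo] --> \int[P]_x (h (t * gsum c x))%:E)%E.
Proof.
move=> ch h1; have mh : measurable_fun setT h by exact: continuous_measurable_fun.
have [] := @dominated_convergence _ _ _ P setT measurableT
  (fun n x => (h (t * S n x))%:E) (fun x => (h (t * gsum c x))%:E) (fun=> 1%E).
- move=> n; apply/measurable_EFinP; apply: measurableT_comp => //.
  by apply: measurable_funM => //; exact: mS.
- apply/measurable_EFinP; apply: measurableT_comp => //.
  by apply: measurable_funM => //; exact: measurable_gsum.
- apply: filterS cvgS => x hx _; apply/cvg_EFin; first exact: nearW.
  have h2 : t * S n x @[n --> \oo] --> t * gsum c x by apply: cvgM => //; exact: cvg_cst.
  exact: (continuous_cvg _ (ch _) h2).
- exact: finite_measure_integrable_cst.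
- by apply: aeW => x n _; rewrite lee_fin.
by [].
Qed.

Let cos_le (y : R) : `|cos y| <= 1.
Proof. by rewrite ler_norml cos_le1 cos_geN1. Qed.

Let sin_le (y : R) : `|sin y| <= 1.
Proof. by rewrite ler_norml sin_le1 sin_geN1. Qed.

Let mcosS (h : R -> R) t (V : T -> R) : continuous h -> measurable_fun setT V ->
  measurable_fun setT (fun x => h (t * V x)).
Proof.
move=> ch mV; apply: measurableT_comp; first exact: continuous_measurable_fun.
exact: measurable_funM.
Qed.

(** The characteristic functions of the partial sums are products of Gaussian ones by independence.
    Cosine and sine being bounded and continuous, both pass to the almost sure limit. *)
Lemma cf_gsum t : cintegral P (fun x => cexp ((t * gsum c x) *i)) =
  (expR (- (t ^+ 2 / 2 * gvar)))%:C.
Proof.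
have cosE n : (\int[P]_x (cos (t * S n x))%:E =
    (expR (- (t ^+ 2 / 2 * series (useq 0 (fun l => c l ^+ 2)) n)))%:E)%E.
  have := congr1 (@complex.Re R) (cfS n t) => /= <-.
  rewrite /Rintegral fineK.
    by apply: eq_integral => x _ /=; rewrite expR0 mul1r.
  apply: integrable_fin_num => //; under eq_fun do rewrite expR0 mul1r.
  apply: (@integrable_bounded R _ T P (fun x => cos (t * S n x)) 1) => [|x]; last exact: cos_le.
  exact: (mcosS t (@continuous_cos R) (mS n)).
have sinE n : (\int[P]_x (sin (t * S n x))%:E = 0)%E.
  have := congr1 (@complex.Im R) (cfS n t) => /= e0.
  rewrite -[RHS]/(0%:E) -[in RHS]e0 /Rintegral fineK.
    by apply: eq_integral => x _ /=; rewrite expR0 mul1r.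
  apply: integrable_fin_num => //; under eq_fun do rewrite expR0 mul1r.
  apply: (@integrable_bounded R _ T P (fun x => sin (t * S n x)) 1) => [|x]; last exact: sin_le.
  exact: (mcosS t (@continuous_sin R) (mS n)).
have lc := @lim_bounded (@cos R) t (@continuous_cos R) cos_le.
have ls := @lim_bounded (@sin R) t (@continuous_sin R) sin_le.
rewrite (funext cosE) in lc; rewrite (funext sinE) in ls.
have lc' : ((expR (- (t ^+ 2 / 2 * series (useq 0 (fun l => c l ^+ 2)) n)))%:E @[n --> \oo] -->
    (expR (- (t ^+ 2 / 2 * gvar)))%:E)%E.
  apply/cvg_EFin; first exact: nearW.
  apply: (continuous_cvg _ (@continuous_expR R _)); apply: cvgN; apply: cvgM; first exact: cvg_cst.
  exact: (cvg_rsum summable_sqr).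
have e1 := cvg_unique (@ereal_hausdorff R) lc lc'.
have e2 := cvg_unique (@ereal_hausdorff R) ls (cvg_cst 0%E).
apply: complex_ext => /=; rewrite /Rintegral.
  by under eq_integral do rewrite expR0 mul1r; rewrite e1.
by under eq_integral do rewrite expR0 mul1r; rewrite e2.
Qed.

Definition gsd : R := Num.sqrt gvar.

Lemma gsum_law (A : set R) : measurable A ->
  P (gsum c @^-1` A) = N ((fun z : measurableTypeR R => 0 + gsd * z) @^-1` A).
Proof.
move=> mA.
have maff : measurable_fun setT (fun z : measurableTypeR R => 0 + gsd * z).
  by apply: measurable_funD => //; apply: measurable_funM.
suff cf t : cintegral P (fun x => cexp ((t * gsum c x) *i)) =
    cintegral N (fun x => cexp ((t * (0 + gsd * x)) *i)).
  exact: (charf_law measurable_gsum maff cf mA).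
rewrite cf_gsum; have := charf_normal 0 (t * gsd) ltr01; rewrite /charf.
rewrite (_ : cexp _ = (expR (- (t ^+ 2 / 2 * gvar)))%:C); last first.
  rewrite -cexp_real; congr cexp; rewrite -(sqr_sqrtr gvar_ge0) -/gsd.
  by apply: complex_ext; rewrite /=; field.
by move=> <-; apply: eq_cintegral => x; rewrite add0r mulrA.
Qed.

Lemma gaussian_gsum : gaussian P (gsum c).
Proof.
split; first exact: measurable_gsum.
exists 0, gsd; split; first exact: sqrtr_ge0.
by move=> A mA; rewrite gaussian_lawE ?sqrtr_ge0// -gsum_law.
Qed.

Lemma gsum_moments :
  [/\ P.-integrable setT (EFin \o gsum c), \int[P]_x gsum c x = 0,
   P.-integrable setT (EFin \o (fun x => gsum c x ^+ 2)) &
   \int[P]_x (gsum c x ^+ 2) = gvar].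
Proof.
have maff : measurable_fun setT (fun z : measurableTypeR R => 0 + gsd * z).
  by apply: measurable_funD => //; apply: measurable_funM.
have [m1 m2] := @normal_moments R.
have i1 : N.-integrable setT (fun z => (0 + gsd * z)%:E).
  have := integrableZl measurableT gsd (@integrable_normal_id R).
  by apply: eq_integrable => // x _; rewrite add0r.
have i2 : N.-integrable setT (fun z => ((0 + gsd * z) ^+ 2)%:E).
  have := integrableZl measurableT (gsd ^+ 2) (@integrable_normal_sqr R).
  by apply: eq_integrable => // x _; rewrite add0r exprMn.
have [a1 b1] := same_law_integrable measurable_gsum maff gsum_law (g := fun y : R => y) (@measurable_id _ _ setT) i1.
have msq : measurable_fun setT (fun y : R => y ^+ 2) by exact: measurable_funX.
have [a2 b2] := same_law_integrable measurable_gsum maff gsum_law msq i2.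
split => //.
  rewrite b1; under eq_Rintegral do rewrite add0r.
  by rewrite RintegralZl// ?m1 ?mulr0//; exact: integrable_normal_id.
rewrite b2; under eq_Rintegral do rewrite add0r exprMn.
rewrite RintegralZl// ?m2 ?mulr1 ?sqr_sqrtr ?gvar_ge0//; exact: integrable_normal_sqr.
Qed.

End one.

Lemma ae_gsumD (c e : I -> R) : summable [set: I] (EFin \o c) -> summable [set: I] (EFin \o e) ->
  {ae P, forall x, gsum (fun l => c l + e l) x = gsum c x + gsum e x}.
Proof.
move=> sc se; apply: filterS2 (ae_summable_gsum sc) (ae_summable_gsum se) => x h1 h2.
rewrite /gsum -rsumD//; congr rsum; apply/funext => l; ring.
Qed.

Lemma ae_gsumZ (a : R) (c : I -> R) : summable [set: I] (EFin \o c) ->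
  {ae P, forall x, gsum (fun l => a * c l) x = a * gsum c x}.
Proof.
move=> sc; apply: filterS (ae_summable_gsum sc) => x h1.
rewrite /gsum -rsumZ//; congr rsum; apply/funext => l; ring.
Qed.

Lemma Rintegral_ae_eq (f g : T -> R) : measurable_fun setT f ->
  {ae P, forall x, f x = g x} -> P.-integrable setT (EFin \o g) ->
  P.-integrable setT (EFin \o f) /\ \int[P]_x f x = \int[P]_x g x.
Proof.
move=> mf fg ig.
have ae : {ae P, forall x, (f x)%:C = (g x)%:C :> R[i]} by apply: filterS fg => x ->.
have [] := cintegral_ae_eq (measurable_realC mf) ae.
  split => //=; exact: integrable0.
by move=> [h _] /(congr1 (@complex.Re R)).
Qed.

(** Polarization: the product is half of (X + Y)^2 - X^2 - Y^2, and X + Y is almost surely the sum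
    with coefficients c + e, whose variance is known. *)
Lemma gsumM (c e : I -> R) : summable [set: I] (EFin \o c) -> summable [set: I] (EFin \o e) ->
  P.-integrable setT (EFin \o (fun x => gsum c x * gsum e x)) /\
  \int[P]_x (gsum c x * gsum e x) = rsum (fun l => c l * e l).
Proof.
move=> sc se; have sce : summable [set: I] (EFin \o (fun l => c l + e l)) := summableD sc se.
have [_ _ ic vc] := gsum_moments sc; have [_ _ ie ve] := gsum_moments se.
have [_ _ ice vce] := gsum_moments sce.
have mc := measurable_gsum c; have me := measurable_gsum e.
have mce := measurable_gsum (fun l => c l + e l).
have sq2 : summable [set: I] (EFin \o (fun l => 2 * (c l * e l))).
  have := summableB (summableB (summable_sqr sce) (summable_sqr sc)) (summable_sqr se).
  congr summable; apply/funext => l; rewrite /= -!EFinB; congr EFin; ring.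
have i2 : P.-integrable setT (EFin \o (fun x => gsum (fun l => c l + e l) x ^+ 2 - gsum c x ^+ 2 - gsum e x ^+ 2)).
  have := integrableB measurableT (integrableB measurableT ice ic) ie.
  by apply: eq_integrable => // x _.
have m2 : measurable_fun setT (fun x => gsum c x * gsum e x) by exact: measurable_funM.
have ae : {ae P, forall x, gsum c x * gsum e x =
    2^-1 * (gsum (fun l => c l + e l) x ^+ 2 - gsum c x ^+ 2 - gsum e x ^+ 2)}.
  by apply: filterS (ae_gsumD sc se) => x ->; field.
have i3 : P.-integrable setT (EFin \o (fun x => 2^-1 *
    (gsum (fun l => c l + e l) x ^+ 2 - gsum c x ^+ 2 - gsum e x ^+ 2))).
  exact: (integrableZl measurableT 2^-1 i2).
have [r1 r2] := Rintegral_ae_eq m2 ae i3; split => //; rewrite r2 (RintegralZl _ measurableT i2).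
have i12 : P.-integrable setT (EFin \o (fun x => gsum (fun l => c l + e l) x ^+ 2 - gsum c x ^+ 2)).
  by have := integrableB measurableT ice ic; apply: eq_integrable.
rewrite (RintegralB measurableT i12 ie) (RintegralB measurableT ice ic) vce vc ve.
have sq1 := summable_sqr sc; have sq3 := summable_sqr se.
have sce1 : summable [set: I] (EFin \o (fun l => c l * e l)).
  have := summableZ 2^-1 sq2; congr summable; apply/funext => l /=; congr EFin; field.
- by [].
have -> : gvar (fun l => c l + e l) = rsum (fun l => (c l ^+ 2 + e l ^+ 2) + 2 * (c l * e l)).
  by congr rsum; apply/funext => l; ring.
rewrite (rsumD (summableD sq1 sq3) sq2) (rsumD sq1 sq3) rsumZ// /gvar.
by field.
Qed.

Lemma gaussian_ae_eq (f : T -> R) (c : I -> R) : measurable_fun setT f ->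
  summable [set: I] (EFin \o c) -> {ae P, forall x, f x = gsum c x} -> gaussian P f.
Proof.
move=> mf sc fc; have [mg [m [s [s0 h]]]] := gaussian_gsum sc.
split => //; exists m, s; split => // A mA; rewrite -h// /pushforward.
have mI : measurable_fun setT (\1_A : R -> R) by exact: measurable_indic.
have mXA (X : T -> R) : measurable_fun setT X -> measurable (X @^-1` A).
  by move=> mX; rewrite -[X in measurable X]setTI; exact: mX.
have e (X : T -> R) : measurable_fun setT X -> P (X @^-1` A) = (\int[P]_x (\1_A (X x))%:E)%E.
  move=> mX; rewrite (eq_integral (fun x => (\1_(X @^-1` A) x)%:E)).
    by rewrite integral_indic ?setIT//; exact: mXA.
  by move=> x _; rewrite !indicE.
rewrite !e//; apply: ae_eq_integral => //.
- by apply/measurable_EFinP; exact: measurableT_comp mI mf.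
- by apply/measurable_EFinP; exact: measurableT_comp mI mg.
- by apply: filterS fc => x -> _.
Qed.

Definition cgsum (a : I -> R[i]) (x : T) : R[i] := csum (fun l => a l * (gamma l x)%:C).

Lemma cgsumE (a : I -> R[i]) x :
  cgsum a x = gsum (fun l => cRe (a l)) x +i* gsum (fun l => cIm (a l)) x.
Proof.
by rewrite /cgsum /csum /gsum; congr (_ +i* _); congr rsum; apply/funext => l;
  rewrite [_ * _%:C]mulrC ?cReMr ?cImMr mulrC.
Qed.

Lemma ae_csummable_cgsum a : csummable a ->
  {ae P, forall x, csummable (fun l => a l * (gamma l x)%:C)}.
Proof.
move=> [sR sI].
apply: filterS2 (ae_summable_gsum sR) (ae_summable_gsum sI) => x h1 h2; split.
  by move: h1; congr summable; apply/funext => l /=; rewrite [_ * _%:C]mulrC cReMr mulrC.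
by move: h2; congr summable; apply/funext => l /=; rewrite [_ * _%:C]mulrC cImMr mulrC.
Qed.

Lemma cgsum_mean a : csummable a -> cintegrable P (cgsum a) /\ cintegral P (cgsum a) = 0.
Proof.
move=> [sR sI]; have [i1 e1 _ _] := gsum_moments sR; have [i2 e2 _ _] := gsum_moments sI.
rewrite (funext (cgsumE a)); split; first by split.
by apply: complex_ext.
Qed.

Lemma cgsum_cov a b : csummable a -> csummable b ->
  cintegrable P (fun x => cgsum a x * conjc (cgsum b x)) /\
  cintegral P (fun x => cgsum a x * conjc (cgsum b x)) = csum (fun l => a l * conjc (b l)).
Proof.
move=> [aR aI] [bR bI].
have [i1 e1] := gsumM aR bR; have [i2 e2] := gsumM aI bI.
have [i3 e3] := gsumM aI bR; have [i4 e4] := gsumM aR bI.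
have eR x : cRe (cgsum a x * conjc (cgsum b x)) =
    gsum (fun l => cRe (a l)) x * gsum (fun l => cRe (b l)) x +
    gsum (fun l => cIm (a l)) x * gsum (fun l => cIm (b l)) x.
  by rewrite !cgsumE /=; ring.
have eI x : cIm (cgsum a x * conjc (cgsum b x)) =
    gsum (fun l => cIm (a l)) x * gsum (fun l => cRe (b l)) x -
    gsum (fun l => cRe (a l)) x * gsum (fun l => cIm (b l)) x.
  by rewrite !cgsumE /=; ring.
have iR : P.-integrable setT (EFin \o (fun x => cRe (cgsum a x * conjc (cgsum b x)))).
  by have := integrableD measurableT i1 i2; apply: eq_integrable => // x _; rewrite [RHS]/comp eR.
have iI : P.-integrable setT (EFin \o (fun x => cIm (cgsum a x * conjc (cgsum b x)))).
  by have := integrableB measurableT i3 i4; apply: eq_integrable => // x _; rewrite [RHS]/comp eI.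
have sM (c e : I -> R) : summable [set: I] (EFin \o c) -> summable [set: I] (EFin \o e) ->
    summable [set: I] (EFin \o (fun l => c l * e l)).
  move=> sc se; have sce : summable [set: I] (EFin \o (fun l => c l + e l)) := summableD sc se.
  have := summableZ 2^-1 (summableB (summableB (summable_sqr sce) (summable_sqr sc)) (summable_sqr se)).
  by congr summable; apply/funext => l /=; congr EFin; field.
split; first by split.
apply: complex_ext => /=; rewrite /rsum.
  transitivity (\int[P]_x (gsum (fun l => cRe (a l)) x * gsum (fun l => cRe (b l)) x +
      gsum (fun l => cIm (a l)) x * gsum (fun l => cIm (b l)) x)).
    by apply: eq_Rintegral => x _; exact: eR.
  rewrite (RintegralD measurableT i1 i2) e1 e2 -rsumD; [|exact: sM|exact: sM].
  by congr rsum; apply/funext => l; case: (a l) (b l) => ? ? [? ?] /=; ring.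
transitivity (\int[P]_x (gsum (fun l => cIm (a l)) x * gsum (fun l => cRe (b l)) x -
    gsum (fun l => cRe (a l)) x * gsum (fun l => cIm (b l)) x)).
  by apply: eq_Rintegral => x _; exact: eI.
rewrite (RintegralB measurableT i3 i4) e3 e4.
rewrite -mulN1r -rsumZ -?rsumD; [|exact: sM|exact/summableZ/sM|exact: sM].
by congr rsum; apply/funext => l; case: (a l) (b l) => ? ? [? ?] /=; ring.
Qed.

(** A finite real combination of real and imaginary parts is almost surely the single series with
    the combined real coefficients. The equality holds only where the series are summable, hence the
    detour through almost sure equality. *)
Lemma complex_gaussian_cgsum (J : Type) (a : J -> I -> R[i]) :
  (forall j, csummable (a j)) -> complex_gaussian_field P (fun j => cgsum (a j)).
Proof.
move=> sa s u.
pose c (j : J + J) l := match j with inl j => cRe (a j l) | inr j => cIm (a j l) end.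
have sc j : summable [set: I] (EFin \o c j) by case: j => j; case: (sa j).
have fE j x : match j with inl i => cRe (cgsum (a i) x) | inr i => cIm (cgsum (a i) x) end =
    gsum (c j) x.
  by case: j => j; rewrite cgsumE.
have m1 : measurable_fun setT (fun x => \sum_(j <- s) u j * gsum (c j) x).
  by apply: measurable_sum => j; apply: measurable_funM => //; exact: measurable_gsum.
rewrite (_ : (fun x => _) = (fun x => \sum_(j <- s) u j * gsum (c j) x)); last first.
  by apply/funext => x; apply: eq_bigr => j _; rewrite -fE.
suff [sS hS] : summable [set: I] (EFin \o (fun l => \sum_(j <- s) u j * c j l)) /\
    {ae P, forall x, \sum_(j <- s) u j * gsum (c j) x = gsum (fun l => \sum_(j <- s) u j * c j l) x}.
  exact: gaussian_ae_eq hS.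
elim: s {m1} => [|j s [IH1 IH2]].
  split.
    by rewrite /summable esum1 ?ltry// => l _; rewrite /= big_nil normr0.
  apply: aeW => x; rewrite big_nil /gsum /rsum !esum1 ?subrr// => l _.
    by rewrite funenegE /= big_nil mul0r oppr0 maxxx.
  by rewrite funeposE /= big_nil mul0r maxxx.
have sj := summableZ (u j) (sc j).
split.
  have := summableD sj IH1; congr summable; apply/funext => l /=.
  by rewrite big_cons.
have h1 := ae_gsumD sj IH1; have h2 := ae_gsumZ (u j) (sc j).
apply: filterS3 IH2 h1 h2 => x e1 e2 e3; rewrite big_cons e1 -e3 -e2.
by congr (gsum _ x); apply/funext => l; rewrite big_cons.
Qed.

End gaussian_sums.

Lemma ae_probability1 {R : realType} d (T : measurableType d) (P : probability T R) (B : set T) :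
  measurable B -> P B = 1%E -> {ae P, forall x, B x}.
Proof.
move=> mB PB; exists (~` B); split; first exact: measurableC.
  by rewrite probability_setC// PB subee.
by move=> x.
Qed.

(** * Moments of the point products *)

Section rising_factorial.
Context {K : fieldType}.

Definition rising (x : K) (n : nat) : K := \prod_(i < n) (x + i%:R).

Lemma risingS x n : rising x n.+1 = rising x n * (x + n%:R).
Proof. by rewrite /rising big_ord_recr. Qed.

(** The Chu-Vandermonde identity, the coefficient form of multiplying two negative powers of 1 -
    z. *)
Lemma rising_vandermonde (x y : K) n :
  rising (x + y) n = \sum_(a < n.+1) 'C(n, a)%:R * (rising x a * rising y (n - a)).
Proof.
elim: n => [|n IH]; first by rewrite big_ord1 /rising !big_ord0 bin0 !mulr1.
pose t a := rising x a * rising y (n.+1 - a).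
(* Splitting x + y + n as (x + a) + (y + (n - a)) raises one of the two rising factorials; the two
   families are recombined by the Pascal rule. *)
have step (a : 'I_n.+1) : 'C(n, a)%:R * (rising x a * rising y (n - a)) * (x + y + n%:R) =
    'C(n, a)%:R * t a.+1 + 'C(n, a)%:R * t a.
  have an : (a <= n)%N by rewrite -ltnS.
  rewrite /t subSS subSn// !risingS -[in X in x + y + X](subnKC an) natrD; ring.
rewrite risingS IH mulr_suml (eq_bigr _ (fun a _ => step a)) big_split /=.
have e1 : \sum_(a < n.+2) 'C(n.+1, a)%:R * t a =
    t 0%N + \sum_(i < n.+1) ('C(n, i.+1)%:R * t i.+1 + 'C(n, i)%:R * t i.+1).
  rewrite big_ord_recl bin0 mul1r; congr (_ + _); apply: eq_bigr => i _.
  by rewrite lift0 binS natrD mulrDl.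
have e2 : \sum_(i < n.+1) 'C(n, i.+1)%:R * t i.+1 = \sum_(i < n) 'C(n, i.+1)%:R * t i.+1.
  by rewrite big_ord_recr /= bin_small// mul0r addr0.
have e3 : \sum_(i < n.+1) 'C(n, i)%:R * t i = t 0%N + \sum_(i < n) 'C(n, i.+1)%:R * t i.+1.
  by rewrite big_ord_recl bin0 mul1r; congr (_ + _); apply: eq_bigr => i _; rewrite lift0.
rewrite [RHS]e1 big_split /= e2 e3; ring.
Qed.

End rising_factorial.

Section measurable_tuple_functions.
Context {R : realType}.

(* Truncations agreeing with the identity on the unit disc and, for [tau], on
   [-1, 1]: they turn the almost sure bounds on xi into pointwise ones. *)
Definition ctrunc (z : R[i]) : R[i] := (\1_[set z : R[i] | normc z <= 1] z : R)%:C * z.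

Lemma measurable_unit_disc : measurable [set z : R[i] | normc z <= 1].
Proof.
rewrite (_ : [set z | _] = (@Normc.normc R) @^-1` `]-oo, 1]%classic); last first.
  by apply/seteqP; split => z /=; rewrite in_itv.
have mn : measurable_fun setT (fun z : R[i] => normc z) by apply: measurable_normc.
by rewrite -[X in measurable X]setTI; exact: mn.
Qed.

Lemma normc_ctrunc z : normc (ctrunc z) <= 1.
Proof.
rewrite Normc.normcM normc_real indicE; case: (boolP (normc z <= 1)) => h.
  by rewrite mem_set// normr1 mul1r.
by rewrite memNset ?normr0 ?mul0r//; exact/negP.
Qed.

Lemma cbounded_ctrunc : cbounded ctrunc.
Proof.
split.
  apply: measurable_cM => //; apply: measurable_realC; apply: measurable_indic.
  exact: measurable_unit_disc.
by exists 1; exact: normc_ctrunc.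
Qed.

Lemma ctruncE z : normc z <= 1 -> ctrunc z = z.
Proof. by move=> h; rewrite /ctrunc indicE mem_set// mul1r. Qed.

Definition tau (z : R[i]) : R := cRe (ctrunc z).

Lemma measurable_tau : measurable_fun setT tau.
Proof. by apply: measurable_cRe; have [] := cbounded_ctrunc. Qed.

Lemma tau_le1 z : `|tau z| <= 1.
Proof.
exact: le_trans (ler_cRe_normc _) (normc_ctrunc z).
Qed.

Lemma tauE z : normc z <= 1 -> cIm z = 0 -> (tau z)%:C = z.
Proof. by move=> z1 z0; rewrite /tau ctruncE//; case: z z0 {z1} => a b /= ->. Qed.

Context (n : nat).
Definition monom (l : n.-tuple nat) (v : n.-tuple R[i]) : R[i] :=
  \prod_(k < n) (tau (tnth v k))%:C ^+ tnth l k.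

Lemma monom_le1 l v : normc (monom l v) <= 1.
Proof.
rewrite /monom normc_prod; apply: prodr_ile1 => k _; rewrite normc_ge0 normcX normc_real.
by rewrite exprn_ile1// tau_le1.
Qed.

Lemma measurable_monom l d (T : measurableType d) (X : T -> n.-tuple R[i]) :
  measurable_fun setT X -> measurable_fun setT (fun x => monom l (X x)).
Proof.
move=> mX; apply: measurable_cprod => k; apply: measurable_cX; apply: measurable_realC.
apply: (measurableT_comp measurable_tau); exact: (measurableT_comp (measurable_tnth k) mX).
Qed.

Lemma cbounded_monom l : cbounded (monom l).
Proof.
split; last by exists 1 => v; exact: monom_le1.
exact: (measurable_monom l (@measurable_id _ _ setT)).
Qed.

End measurable_tuple_functions.

(** * Random products in the de Finetti model *)

Section definetti_model.
Context {R : realType} (q : nat) (mu : probability (q.-tuple R) R).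
Hypothesis mu_simplex : mu (@simplex R q) = 1%E.
Context (d : measure_display) (T : measurableType d) (P : probability T R).
Variable xi : nat -> {RV P >-> q.-1.-tuple R[i]}.
Hypothesis xi_iid : iid xi (nu_of mu).

Let mxi b : measurable_fun setT (xi b).
Proof. exact: measurable_funP. Qed.

Let mxik b k : measurable_fun setT (fun x => tnth (xi b x) k).
Proof. exact: measurableT_comp (measurable_tnth k) (mxi b). Qed.

Lemma measurable_simplex : measurable (@simplex R q).
Proof.
have -> : @simplex R q = (\bigcap_(j in [set: 'I_q]) [set p | 0 <= tnth p j]) `&`
    [set p | \sum_(j < q) tnth p j = 1].
  by apply/seteqP; split => p [h1 h2]; split => // j //=; exact: h1.
apply: measurableI.
  apply: fin_bigcap_measurable => // j _; rewrite -[X in measurable X]setTI.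
  apply: measurable_fun_le => //; exact: measurable_tnth.
rewrite (_ : [set p | _] = (fun p : q.-tuple R => \sum_(j < q) tnth p j) @^-1` [set 1]); last by [].
rewrite -[X in measurable X]setTI.
have ms : measurable_fun setT (fun p : q.-tuple R => \sum_(j < q) tnth p j).
  by apply: measurable_sum => j; exact: measurable_tnth.
by apply: ms => //; exact: measurable_set1.
Qed.

Lemma measurable_xi_of : measurable_fun setT (@xi_of R q).
Proof.
apply/measurable_fun_tnthP => k.
rewrite (_ : _ \o _ = (fun p : q.-tuple R => \sum_(j < q) theta q 1 ^+ (k.+1 * j) * (tnth p j)%:C)).
  apply: measurable_csum => j; apply: measurable_cM; first exact: measurable_cst.
  by apply: measurable_realC; exact: measurable_tnth.
by apply/funext => p /=; rewrite tnth_mktuple.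
Qed.

Let disc := [set v : q.-1.-tuple R[i] | forall k, normc (tnth v k) <= 1].

Let mdisc : measurable disc.
Proof.
have -> : disc = \bigcap_(k in [set: 'I_q.-1]) (fun v : q.-1.-tuple R[i] => tnth v k) @^-1` [set z : R[i] | normc z <= 1].
  by apply/seteqP; split => v h k; [move=> _; exact: h|exact: (h k Logic.I)].
apply: fin_bigcap_measurable => // k _; rewrite -[X in measurable X]setTI.
by apply: (measurable_tnth k) => //; exact: measurable_unit_disc.
Qed.

Lemma xi_of_disc p : @simplex R q p -> disc (xi_of p).
Proof.
move=> [p0 p1] k; rewrite tnth_mktuple; apply: (le_trans (normc_sum _ _ _)).
rewrite -p1; apply: ler_sum => j _.
rewrite Normc.normcM normcX normc_theta expr1n mul1r normc_real ger0_norm//.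
Qed.

Lemma ae_xi_disc b : {ae P, forall x, disc (xi b x)}.
Proof.
have [h _] := xi_iid.
have mB : measurable (xi b @^-1` disc) by rewrite -[X in measurable X]setTI; exact: (mxi b measurableT mdisc).
apply: (ae_probability1 mB); have := h b disc mdisc; rewrite /distribution /pushforward => ->.
apply/eqP; rewrite eq_le; apply/andP; split.
  by rewrite /nu_of /pushforward; apply: probability_le1; rewrite -[X in measurable X]setTI; exact: measurable_xi_of.
rewrite -mu_simplex /nu_of /pushforward le_measure ?inE//.
- exact: measurable_simplex.
- by rewrite -[X in measurable X]setTI; exact: measurable_xi_of.
- exact: xi_of_disc.
Qed.

Section real.
Variables (alpha : R) (T1 : {RV P >-> nat}).
Hypothesis alpha01 : 0 < alpha < 1.
Hypothesis T1_law : negbin T1 alpha 1.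
Hypothesis T1_indep : independent P (sigma_gen (fun _ : unit => T1)) (sigma_gen xi).
Hypothesis Y_real : {ae P, forall x,
    forall k : 'I_q.-1, complex.Im (point_product xi T1 k x) = 0}.

Let realv := [set v : q.-1.-tuple R[i] | forall k, cIm (tnth v k) = 0].

Let mrealv : measurable realv.
Proof.
have -> : realv = \bigcap_(k in [set: 'I_q.-1]) (fun v : q.-1.-tuple R[i] => cIm (tnth v k)) @^-1` [set 0].
  by apply/seteqP; split => v h k; [move=> _; exact: h|exact: (h k Logic.I)].
apply: fin_bigcap_measurable => // k _; rewrite -[X in measurable X]setTI.
have mk : measurable_fun setT (fun v : q.-1.-tuple R[i] => cIm (tnth v k)).
  apply: measurable_cIm; exact: measurable_tnth.
exact: mk.
Qed.

Lemma sigma_gen_preimage d' (T' : measurableType d') (J : Type) (X : J -> T -> T') j A :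
  measurable A -> sigma_gen X (X j @^-1` A).
Proof.
move=> mA; apply: sub_sigma_algebra; exists j => //; exists A => //.
by rewrite setTI.
Qed.

Lemma ae_xi_real b : {ae P, forall x, realv (xi b x)}.
Proof.
have mB A c : measurable A -> measurable (xi c @^-1` A).
  by move=> mA; rewrite -[X in measurable X]setTI; exact: mxi.
have mN : measurable (T1 @^-1` [set 1%N]).
  by rewrite -[X in measurable X]setTI; exact: measurable_funP.
(* On the event T1 = 1 the product reduces to [xi 0]. This event is independent of xi and has
   probability (1 - alpha) alpha > 0, so [xi 0] is almost surely real, and the other [xi b] have the
   same law. *)
have h0 : P (xi 0%N @^-1` ~` realv) = 0%E.
  have := T1_indep (@sigma_gen_preimage _ _ unit (fun _ => T1) tt [set 1%N] _)
    (@sigma_gen_preimage _ _ nat xi 0%N (~` realv) (measurableC mrealv)).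
  move=> /(_ _); rewrite T1_law.
  have [N0 [mN0 PN0 sN0]] := Y_real.
  have -> : P (T1 @^-1` [set 1%N] `&` xi 0%N @^-1` (~` realv)) = 0%E.
    apply/eqP; rewrite eq_le measure_ge0 andbT -PN0 le_measure ?inE//.
      by apply: measurableI => //; exact: mB (measurableC mrealv).
    apply: subset_trans sN0 => x /= [t1 nr] h; apply: nr => k.
    by have := h k; rewrite /point_product t1 big_ord1.
  move=> h; have := h (ltac:(by [])); rewrite /negbin_pmf => /esym/eqP.
  rewrite mule_eq0 => /orP[|/eqP//].
  have /andP[a0 a1] := alpha01.
  rewrite eqe gt_eqF// big_ord1 addr0 !mulr1 divr_gt0 ?mulr_gt0 ?powR_gt0 ?subr_gt0//.
have [h _] := xi_iid.
apply: (ae_probability1 (mB _ b mrealv)).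
have e c : P (xi c @^-1` ~` realv) = nu_of mu (~` realv) := h c _ (measurableC mrealv).
have hb : P (xi b @^-1` ~` realv) = 0%E by rewrite e -(e 0%N).
have := probability_setC P (mB _ b (measurableC mrealv)).
by rewrite preimage_setC setCK hb sube0.
Qed.

(** A version of the random product that is real and bounded by 1 at every sample point, thanks to
    the truncation in each factor. *)
Definition rprod (N : T -> nat) (k : 'I_q.-1) (x : T) : R :=
  \prod_(b < N x) tau (tnth (xi b x) k).

Lemma ae_point_product (N : {RV P >-> nat}) :
  {ae P, forall x, forall k, point_product xi N k x = (rprod N k x)%:C}.
Proof.
have h : {ae P, forall x b, disc (xi b x) /\ realv (xi b x)}.
  by apply/ae_foralln => b; apply: filterS2 (ae_xi_disc b) (ae_xi_real b) => x.
apply: filterS h => x hx k; rewrite /point_product /rprod rmorph_prod.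
apply: eq_bigr => b _; have [h1 h2] := hx b.
by apply/esym/tauE; [exact: h1|exact: h2].
Qed.

End real.
Lemma measurable_random_index (N : {RV P >-> nat}) (h : nat -> T -> R) :
  (forall n, measurable_fun setT (h n)) -> measurable_fun setT (fun x => h (N x) x).
Proof.
move=> mh; apply: (@measurableT_comp _ _ _ _ _ _ (fun z : nat * T => h z.1 z.2) _ (fun x => (N x, x))).
  exact: measurable_nat_prod.
by apply: measurable_fun_pair => //; exact: measurable_funP.
Qed.

Lemma measurable_rprod (N : {RV P >-> nat}) k : measurable_fun setT (rprod N k).
Proof.
apply: (@measurable_random_index N (fun n x => \prod_(b < n) tau (tnth (xi b x) k))) => n.
by apply: measurable_prod => b _; exact: measurableT_comp measurable_tau (mxik b k).
Qed.

Lemma rprod_le1 (N : T -> nat) k x : `|rprod N k x| <= 1.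
Proof.
by rewrite /rprod normr_prod; apply: prodr_ile1 => b _; rewrite normr_ge0 tau_le1.
Qed.

Definition moment (l : q.-1.-tuple nat) : R[i] := cintegral P (fun x => monom l (xi 0%N x)).

(** Real-valuedness gives the constant 1, where the general bound on complex integrals loses a
    factor 2. *)
Lemma normc_expectation_le1 (f : T -> R[i]) : measurable_fun setT f -> (forall x, cIm (f x) = 0) ->
  (forall x, normc (f x) <= 1) -> normc (cintegral P f) <= 1.
Proof.
move=> mf f0 f1.
have i1 : P.-integrable setT (EFin \o (fun x => cRe (f x))).
  apply: (@integrable_bounded _ _ _ _ _ 1); first exact: measurable_cRe.
  by move=> x; exact: le_trans (ler_cRe_normc _) (f1 x).
have -> : cintegral P f = (\int[P]_x cRe (f x))%:C.
  apply: complex_ext => //=; transitivity (\int[P]_x (0 : R)); first exact: eq_Rintegral.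
  by rewrite Rintegral_cst// mul0r.
rewrite normc_real; apply: (le_trans (le_normr_Rintegral measurableT i1)).
have -> : 1 = \int[P]_x (1 : R) by rewrite Rintegral_cst// mul1r -[LHS]/(fine 1%E) -(probability_setT P).
apply: le_Rintegral => //.
- exact: (integrable_norm i1).
- exact: finite_measure_integrable_cst.
- by move=> x _; exact: le_trans (ler_cRe_normc _) (f1 x).
Qed.

Lemma moment_xi b l : cintegral P (fun x => monom l (xi b x)) = moment l.
Proof.
have [h _] := xi_iid.
have lawE A : measurable A -> P (xi b @^-1` A) = P (xi 0%N @^-1` A).
  by move=> mA; have := h b A mA; rewrite -(h 0%N A mA).
have [] := same_law_cintegral (mxi b) (mxi 0%N) lawE (cbounded_monom l).1 _.
  exact/cbounded_cintegrable/(cbounded_comp (mxi 0%N) (cbounded_monom l)).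
by [].
Qed.

Section random_product.
Variables (alpha phi : R) (N : {RV P >-> nat}).
Hypothesis N_law : negbin N alpha phi.
Hypothesis N_indep : independent P (sigma_gen (fun _ : unit => N)) (sigma_gen xi).

Let mN t : measurable (N @^-1` [set t]).
Proof. by rewrite -[X in measurable X]setTI; apply: (measurable_funP N). Qed.

Let W t l x := \prod_(b < t) monom l (xi b x).

Let W1 t l x : normc (W t l x) <= 1.
Proof.
rewrite /W normc_prod; apply: prodr_ile1 => b _; rewrite normc_ge0; exact: monom_le1.
Qed.

Let bW t l : cbounded (W t l).
Proof.
split; last by exists 1; exact: W1.
by apply: measurable_cprod => b; exact: measurable_monom.
Qed.

(** The product is a measurable function on the sample space equipped with the sigma-algebra
    generated by xi, so its preimages belong to that sigma-algebra. *)
Let sigma_W t l (A : set R[i]) : measurable A -> sigma_gen xi (W t l @^-1` A).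
Proof.
pose G := \bigcup_b preimage_set_system setT (xi b) measurable.
pose S := g_sigma_algebraType G.
have mxiS b : measurable_fun setT (xi b : S -> q.-1.-tuple R[i]).
  move=> _ A' mA'; rewrite setTI; apply: sub_sigma_algebra; exists b => //.
  by exists A' => //; rewrite setTI.
have mW : measurable_fun setT (W t l : S -> R[i]).
  by apply: measurable_cprod => b; exact: (measurable_monom l (mxiS b)).
by move=> mA; have := mW measurableT A mA; rewrite setTI.
Qed.

Let EW t l : cintegral P (W t l) = moment l ^+ t.
Proof.
have [_ ind] := xi_iid.
have := indep_cintegral_prod ind (fun=> cbounded_monom l) (iota_uniq 0 t).
under [X in _ = X -> _]eq_bigr do rewrite moment_xi.
rewrite big_const_seq count_predT size_iota iter_mulr_1 => <-.
by apply: eq_cintegral => x; rewrite /W -(big_mkord xpredT (fun b => monom l (xi b x))) /index_iota subn0.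
Qed.

Let E_indic t l : cintegral P (fun x => (\1_(N @^-1` [set t]) x : R)%:C * W t l x) =
  (negbin_pmf alpha phi t)%:C * moment l ^+ t.
Proof.
rewrite -EW.
(* [uncorrelated] asks for a test function bounded on the whole plane; the truncation provides one
   and acts trivially because W has norm at most 1. *)
have e1 x : (\1_(N @^-1` [set t]) x : R)%:C * W t l x =
   (\1_(N @^-1` [set t]) x : R)%:C * ctrunc (W t l x) by rewrite ctruncE.
rewrite (eq_cintegral _ e1) (uncorrelated (bW t l).1).
- rewrite cintegral_indic// N_law /=; congr (_ * _).
  by apply: eq_cintegral => x; rewrite ctruncE.
- exact: cbounded_indic.
- exact: cbounded_ctrunc.
- move=> A mA; have mWA : measurable (W t l @^-1` A).
    by rewrite -[X in measurable X]setTI; apply: (bW t l).1.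
  have iN : sigma_gen (fun _ : unit => N) (N @^-1` [set t]).
    exact: (@sigma_gen_preimage _ _ unit (fun _ => N) tt).
  have := N_indep iN (sigma_W t l mA) => h.
  rewrite cintegral_indic//.
  transitivity (cintegral P (fun x => (\1_(N @^-1` [set t] `&` W t l @^-1` A) x : R)%:C)).
    by apply: eq_cintegral => x; rewrite indicI /= rmorphM.
  rewrite cintegral_indic ?h; last exact: measurableI.
  by rewrite fineM ?rmorphM// fin_num_measure.
Qed.

(** The sample space is partitioned by the value t of N; independence of N and xi factors each
    piece, and the moments of the i.i.d. factors multiply to a power. *)
Lemma expectation_rprod l :
  csummable (fun t => (negbin_pmf alpha phi t)%:C * moment l ^+ t) /\
  cintegral P (fun x => \prod_(k < q.-1) (rprod N k x)%:C ^+ tnth l k) =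
  csum (fun t => (negbin_pmf alpha phi t)%:C * moment l ^+ t).
Proof.
pose f t x := (\1_(N @^-1` [set t]) x : R)%:C * W t l x.
pose p t := fine (P (N @^-1` [set t])).
have pE t : (p t)%:E = P (N @^-1` [set t]) by rewrite fineK// fin_num_measure.
have p0 t : 0 <= p t by apply: fine_ge0.
have mf t : measurable_fun setT (f t).
  by apply: measurable_cM; [apply: measurable_realC; exact: measurable_indic|exact: (bW t l).1].
have sp : summable [set: nat] (EFin \o p).
  apply/summable_ge0P => //; under eq_esum do rewrite pE.
  have <- : P (\bigcup_t N @^-1` [set t]) = (\esum_(t in [set: nat]) P (N @^-1` [set t]))%E.
    rewrite measure_bigcup//; last first.
      by apply/trivIsetP => i j _ _ ij; apply/seteqP; split => // x [/= -> /eqP]; rewrite (negbTE ij).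
    by rewrite nneseries_esum// set_mem_set.
  by rewrite (le_lt_trans (probability_le1 _ _)) ?ltry//; exact: bigcup_measurable.
have [] := @cintegral_csum R nat _ T P f p mf sp.
  move=> t; rewrite pE.
  apply: (@le_trans _ _ (\int[P]_x (\1_(N @^-1` [set t]) x)%:E)%E).
    apply: ge0_le_integral => //.
    - by move=> x _; rewrite lee_fin normc_ge0.
    - by apply/measurable_EFinP; exact: measurable_normc.
    - by apply/measurable_EFinP; exact: measurable_indic.
    - move=> x _; rewrite lee_fin /f Normc.normcM normc_real ger0_norm ?indicE//.
      by rewrite ler_piMr.
  by rewrite integral_indic// setIT.
move=> _ _ c1 d1.
have fE t : cintegral P (f t) = (negbin_pmf alpha phi t)%:C * moment l ^+ t by exact: E_indic.
rewrite (funext fE) in c1 d1; split => //; rewrite -d1.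
apply: eq_cintegral => x.
(* At a given sample point only the index t = N x contributes, so the series is a finite sum whose
   last term alone is nonzero. *)
rewrite (@csum_fin _ _ (N x)); last first.
  move=> t Nt; rewrite /f indicE memNset ?mul0r//= => e.
  by rewrite e ltnn in Nt.
rewrite big_ord_recr /= [X in X + _]big1 ?add0r; last first.
  move=> t _; rewrite /f indicE memNset ?mul0r//= => e.
  by have := ltn_ord t; rewrite -e ltnn.
rewrite /f indicE mem_set// mul1r /W /monom exchange_big /=; apply: eq_bigr => k _.
by rewrite prodrXl /rprod rmorph_prod.
Qed.

End random_product.

(** Two independent copies of T_{alpha,1/2} add up to a copy of T_{alpha,1}; on coefficients this is
    the Chu-Vandermonde identity at x = y = 1/2. *)
Lemma negbin_pmf_half (alpha : R) n : 0 < alpha < 1 ->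
  \sum_(a < n.+1) negbin_pmf alpha 2^-1 a * negbin_pmf alpha 2^-1 (n - a) = negbin_pmf alpha 1 n.
Proof.
move=> /andP[a0 a1].
have E phi t : negbin_pmf alpha phi t = (1 - alpha) `^ phi * alpha ^+ t * (rising phi t / t`!%:R).
  by rewrite /negbin_pmf -mulrA.
have h : (1 - alpha) `^ 2^-1 * (1 - alpha) `^ 2^-1 = (1 - alpha) `^ 1.
  rewrite -powRD; last by rewrite subr_eq0 eq_sym lt_eqF ?implybT.
  by congr (_ `^ _); lra.
rewrite E (_ : rising 1 n = rising (2^-1 + 2^-1) n); last by congr rising; lra.
rewrite rising_vandermonde -h mulr_suml mulr_sumr; apply: eq_bigr => a _.
have an : (a <= n)%N by rewrite -ltnS.
rewrite !E -[in alpha ^+ n](subnKC an) exprD.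
have := congr1 (fun k => k%:R : R) (bin_fact an).
rewrite !natrM => <-.
have f0 k : (k`!%:R : R) != 0 by rewrite pnatr_eq0 -lt0n fact_gt0.
have b0 : ('C(n, a)%:R : R) != 0 by rewrite pnatr_eq0 -lt0n bin_gt0.
by field; rewrite !f0 b0.
Qed.

(** Both expectations are power series in the moment of xi, and the Cauchy product of the first with
    itself is the second by [negbin_pmf_half]. *)
Lemma half_moment_sqr (alpha : R) (N1 Nh : {RV P >-> nat}) l : 0 < alpha < 1 ->
  negbin N1 alpha 1 -> negbin Nh alpha 2^-1 ->
  independent P (sigma_gen (fun _ : unit => N1)) (sigma_gen xi) ->
  independent P (sigma_gen (fun _ : unit => Nh)) (sigma_gen xi) ->
  cintegral P (fun x => \prod_(k < q.-1) (rprod Nh k x)%:C ^+ tnth l k) ^+ 2 =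
  cintegral P (fun x => \prod_(k < q.-1) (rprod N1 k x)%:C ^+ tnth l k).
Proof.
move=> a01 l1 lh i1 ih.
have [sh ->] := expectation_rprod lh ih l; have [_ ->] := expectation_rprod l1 i1 l.
rewrite expr2; have [_ <-] := csum_cauchy sh sh.
congr csum; apply/funext => n; rewrite -negbin_pmf_half// rmorph_sum mulr_suml.
apply: eq_bigr => a _; have an : (a <= n)%N by rewrite -ltnS.
have -> : moment l ^+ n = moment l ^+ a * moment l ^+ (n - a) by rewrite -exprD subnKC.
by rewrite mulrACA; congr (_ * _); exact/esym/(rmorphM _ (negbin_pmf alpha 2^-1 a)).
Qed.

End definetti_model.

(** * The limit field *)

Section gaussian_vector.
Context {R : realType} (d : measure_display) (T : measurableType d) (P : probability T R).

(** Identifies the abstract parameters m and s in the definition of [gaussian] with moments, so that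
    they can be computed from means and covariances. *)
Lemma gaussian_moments (X : T -> R) : gaussian P X -> exists m s : R,
  [/\ measurable_fun setT X,
      0 <= s /\ (forall A : set R, measurable A ->
        P (X @^-1` A) = normal_prob 0 1 ((fun z => m + s * z) @^-1` A)),
      P.-integrable setT (EFin \o X) /\ P.-integrable setT (EFin \o (fun x => X x ^+ 2)),
      \int[P]_x X x = m & \int[P]_x X x ^+ 2 = m ^+ 2 + s ^+ 2].
Proof.
move=> [mX [m [s [s0 h]]]]; exists m, s.
have lawE (A : set (measurableTypeR R)) : measurable A ->
    P (X @^-1` A) = normal_prob 0 1 ((fun z => m + s * z) @^-1` A).
  by move=> mA; have := h A mA; rewrite /pushforward gaussian_lawE.
have maff : measurable_fun setT (fun z : measurableTypeR R => m + s * z).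
  by apply: measurable_funD => //; apply: measurable_funM.
have icst (c : R) : (normal_prob 0 1).-integrable setT (EFin \o cst c).
  exact: finite_measure_integrable_cst.
have iZ (c : R) (f : R -> R) : (normal_prob 0 1).-integrable setT (EFin \o f) ->
  (normal_prob 0 1).-integrable setT (EFin \o (fun z => c * f z)).
  by move=> h1; exact: (integrableZl measurableT c h1).
have iid := @integrable_normal_id R.
have isq := @integrable_normal_sqr R.
have i1 : (normal_prob 0 1).-integrable setT (EFin \o (fun z : R => m + s * z)).
  exact: (integrableD measurableT (icst m) (iZ s _ iid)).
have sqrE : (fun z : R => (m + s * z) ^+ 2) = (fun z => (m ^+ 2 + 2 * m * s * z) + s ^+ 2 * z ^+ 2).
  by apply/funext => z; ring.
have i2 : (normal_prob 0 1).-integrable setT (EFin \o (fun z : R => (m + s * z) ^+ 2)).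
  rewrite sqrE.
  have h1 := integrableD measurableT (icst (m ^+ 2)) (iZ (2 * m * s) _ iid).
  exact: (integrableD measurableT h1 (iZ (s ^+ 2) (fun z => z ^+ 2) isq)).
have [j1 e1] := same_law_integrable mX maff lawE (@measurable_id _ (measurableTypeR R) setT) i1.
have msq : measurable_fun setT (fun z : measurableTypeR R => z ^+ 2) by exact: measurable_funX.
have [j2 e2] := same_law_integrable mX maff lawE msq i2.
have [n1 n2] := @normal_moments R.
have pT : fine (normal_prob 0 1 [set: R]) = 1 by rewrite (probability_setT (normal_prob 0 1)).
split => //.
- rewrite e1 (RintegralD measurableT (icst _) (iZ _ _ iid)).
  by rewrite Rintegral_cst// RintegralZl// n1 mulr0 addr0 pT mulr1.
- have -> : \int[P]_x X x ^+ 2 = \int[normal_prob 0 1]_z (m + s * z) ^+ 2 := e2.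
  rewrite sqrE.
  rewrite (RintegralD measurableT (integrableD measurableT (icst _) (iZ _ _ iid)) (iZ _ _ isq)).
  rewrite (RintegralD measurableT (icst _) (iZ _ _ iid)).
  by rewrite Rintegral_cst// !RintegralZl// n1 n2 mulr0 addr0 pT !mulr1.
Qed.

Lemma cintegral_realC (f : T -> R) : cintegral P (fun x => (f x)%:C) = (\int[P]_x f x)%:C.
Proof. by apply: complex_ext => //=; rewrite Rintegral_cst// mul0r. Qed.

Lemma cintegrable_realC (f : T -> R) : P.-integrable setT (EFin \o f) ->
  cintegrable P (fun x => (f x)%:C).
Proof. by move=> h; split => //=; exact: finite_measure_integrable_cst. Qed.

Context (I : Type) (X : I -> T -> R) (C : I -> I -> R).
Hypothesis gX : jointly_gaussian P X.
Hypothesis X_mean : forall i, ('E_P[X i] = 0)%E.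
Hypothesis X_cov : forall i j, covariance P (X i) (X j) = (C i j)%:E.

Lemma jointly_gaussian1 i : gaussian P (X i).
Proof.
have := gX [:: i] (fun=> 1); congr (gaussian P _); apply/funext => x.
by rewrite big_seq1 mul1r.
Qed.

Lemma integrable_prod_gaussian i j : P.-integrable setT (EFin \o (fun x => X i x * X j x)).
Proof.
have [mi [si [mXi _ [_ ii] _ _]]] := gaussian_moments (jointly_gaussian1 i).
have [mj [sj [mXj _ [_ ij] _ _]]] := gaussian_moments (jointly_gaussian1 j).
apply: le_integrable (integrableD measurableT ii ij) => //.
  by apply/measurable_EFinP; exact: measurable_funM.
move=> x _ /=; rewrite lee_fin [leRHS]ger0_norm; last by rewrite addr_ge0// sqr_ge0.
by rewrite ler_norml; apply/andP; split; nra.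
Qed.

Lemma integral_prod_gaussian i j : \int[P]_x (X i x * X j x) = C i j.
Proof.
have := X_cov i j; rewrite covariance.unlock !X_mean /= => h.
apply: EFin_inj; rewrite -h expectation.unlock /Rintegral fineK.
  by apply: eq_integral => x _; congr EFin; rewrite -[RHS]/((X i x - 0) * (X j x - 0)) !subr0.
by apply: integrable_fin_num => //; exact: integrable_prod_gaussian.
Qed.

(** A linear combination is Gaussian, so its law is fixed by its first two moments; these are 0 and
    the quadratic form of the covariances. *)
Lemma cf_gaussian_vector (s : seq I) (a : I -> R) :
  cintegral P (fun x => cexp ((\sum_(i <- s) a i * X i x) *i)) =
  (expR (- (2^-1 * \sum_(i <- s) \sum_(j <- s) a i * a j * C i j)))%:C.
Proof.
have [m [sd [mS [s0 lawE] [i1 i2] e1 e2]]] := gaussian_moments (gX s a).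
have i1i i : P.-integrable setT (EFin \o X i).
  by have [? [? [_ _ [? _] _ _]]] := gaussian_moments (jointly_gaussian1 i).
have m0 : m = 0.
  rewrite -e1; apply: complexI; rewrite -cintegral_realC.
  under eq_cintegral do rewrite rmorph_sum /=.
  rewrite cintegral_sum; last first.
    by move=> i; apply: cintegrable_realC; exact: (integrableZl measurableT (a i) (i1i i)).
  rewrite big1// => i _; rewrite cintegral_realC RintegralZl//.
  have := X_mean i; rewrite expectation.unlock /Rintegral => ->.
  by rewrite mulr0.
have v0 : sd ^+ 2 = \sum_(i <- s) \sum_(j <- s) a i * a j * C i j.
  transitivity (m ^+ 2 + sd ^+ 2); first by rewrite m0 expr0n add0r.
  rewrite -e2; apply: complexI; rewrite -cintegral_realC.
  have e x : ((\sum_(i <- s) a i * X i x) ^+ 2)%:C =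
      \sum_(i <- s) \sum_(j <- s) (a i * a j * (X i x * X j x))%:C.
    rewrite expr2 mulr_suml rmorph_sum; apply: eq_bigr => i _; rewrite mulr_sumr rmorph_sum.
    by apply: eq_bigr => j _; congr (_%:C); ring.
  rewrite (eq_cintegral _ e) cintegral_sum; last first.
    move=> i; apply: cintegrable_sum => j; apply: cintegrable_realC.
    exact: (integrableZl measurableT (a i * a j) (integrable_prod_gaussian i j)).
  rewrite rmorph_sum; apply: eq_bigr => i _; rewrite cintegral_sum; last first.
    move=> j; apply: cintegrable_realC.
    exact: (integrableZl measurableT (a i * a j) (integrable_prod_gaussian i j)).
  rewrite rmorph_sum; apply: eq_bigr => j _; rewrite cintegral_realC RintegralZl//.
    by rewrite integral_prod_gaussian.
  exact: integrable_prod_gaussian.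
have maff : measurable_fun setT (fun z : measurableTypeR R => m + sd * z).
  by apply: measurable_funD => //; apply: measurable_funM.
have mg : measurable_fun setT (fun z : measurableTypeR R => cexp (z *i)).
  by apply: measurable_cexp; exact: measurable_imag.
have [] := same_law_cintegral mS maff lawE mg _.
  apply: (@cintegrable_bounded _ _ _ _ _ 1); first exact: measurableT_comp mg maff.
  by move=> z; rewrite normc_cexp expR0.
move=> _ ->; rewrite m0.
have := charf_normal 0 sd (@ltr01 R); rewrite /charf.
under eq_cintegral do rewrite -[_ * _]add0r.
move=> ->; rewrite mulr0 -v0 -cexp_real; congr cexp.
by apply: complex_ext; rewrite /=; field.
Qed.

End gaussian_vector.

(** Dropping coordinate 0 becomes a sum over the indices [lift ord0 j]. The vector w is extended to
    all indices by [unlift]; the value at [ord0] is never taken by the list. *)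
Lemma dot_behead {R : realType} n (t : n.+1.-tuple R) (w : n.-tuple R) :
  dot (q := n.+1) (behead_tuple t) w =
  \sum_(i <- [seq lift ord0 j | j <- enum 'I_n])
    (if unlift ord0 i is Some j then tnth w j else 0) * tnth t i.
Proof.
rewrite big_map big_enum; apply: eq_bigr => j _; rewrite liftK mulrC; congr (_ * _).
by rewrite !(tnth_nth 0) /= nth_behead.
Qed.

(** The scalar c covers at once the characteristic function (c = 1) and its conjugate (c = -1),
    which both occur in the covariance. *)
Lemma cf_behead_gaussian {R : realType} (q : nat) (d : measure_display) (T : measurableType d)
    (P : probability T R) (M : {RV P >-> q.-tuple R}) (w : q.-1.-tuple R) (c : R) : (0 < q)%N ->
  jointly_gaussian P (fun (a : 'I_q) x => tnth (M x) a) ->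
  (forall a : 'I_q, ('E_P[fun x => tnth (M x) a] = 0)%E) ->
  (forall a b : 'I_q,
    covariance P (fun x => tnth (M x) a) (fun x => tnth (M x) b) =
    (q%:R^-1 * ((a == b)%:R - q%:R^-1))%:E) ->
  cintegral P (fun x => cexp ((c * dot (behead_tuple (M x)) w) *i)) =
  (expR (- c ^+ 2 * (2 * q%:R)^-1 * \sum_(a < q.-1) \sum_(b < q.-1)
     ((a == b)%:R - q%:R^-1) * tnth w a * tnth w b))%:C.
Proof.
case: q M w => // n M w _ gM M0 MC.
pose a i := c * (if unlift ord0 i is Some j then tnth w j else 0).
have := cf_gaussian_vector gM M0 MC [seq lift ord0 j | j <- enum 'I_n] a.
under eq_cintegral do under eq_bigr do rewrite /a -mulrA.
under eq_cintegral do rewrite -mulr_sumr -dot_behead.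
move=> ->; congr (expR _)%:C; rewrite big_map big_enum /= -mulrA mulNr; congr (- _).
rewrite !mulr_sumr; apply: eq_bigr => i _.
rewrite big_map big_enum !mulr_sumr; apply: eq_bigr => j _.
rewrite /a !liftK (inj_eq lift_inj) invfM; ring.
Qed.

Section conjugation.
Context {R : realType}.
Implicit Types a b : R[i].

Lemma conjc_mul a b : conjc (a * b) = conjc a * conjc b. Proof. exact: rmorphM. Qed.

Lemma conjc_exp a k : conjc (a ^+ k) = conjc a ^+ k. Proof. exact: rmorphXn. Qed.

Lemma conjc_sum I (s : seq I) (F : I -> R[i]) :
  conjc (\sum_(i <- s) F i) = \sum_(i <- s) conjc (F i).
Proof. exact: rmorph_sum. Qed.

Lemma conjc_prod I (s : seq I) (F : I -> R[i]) :
  conjc (\prod_(i <- s) F i) = \prod_(i <- s) conjc (F i).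
Proof. exact: rmorph_prod. Qed.

End conjugation.

Lemma sqrtr_prod {R : realType} n (a : 'I_n -> R) : (forall k, 0 <= a k) ->
  Num.sqrt (\prod_(k < n) a k) = \prod_(k < n) Num.sqrt (a k).
Proof.
move=> a0; elim/big_rec2: _ => [|k x y _ <-]; first by rewrite sqrtr1.
by rewrite sqrtrM.
Qed.

(** * Fourier transform of the density times [Q] *)

Section transform.
Context {R : realType} (q : nat).
Hypothesis q_gt1 : (1 < q)%N.

Definition Omega (w : q.-1.-tuple R) (k : 'I_q.-1) : R[i] :=
  \sum_(j < q.-1) (tnth w j)%:C * theta q k.+1 ^+ j.+1.

Definition cfM (w : q.-1.-tuple R) : R :=
  expR (- (2 * q%:R)^-1 *
    \sum_(a < q.-1) \sum_(b < q.-1) ((a == b)%:R - q%:R^-1) * tnth w a * tnth w b).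

(** [gaussL_Qm] at the purely imaginary parameter s = i w: the bilinear form becomes minus the real
    covariance of w, and [kap] becomes i / q times [Omega]. *)
Lemma fourier_phi_Q (w : q.-1.-tuple R) (l : q.-1.-tuple nat) :
  cintegrable (@lebesgue_tuple R q.-1)
    (fun m => cexp ((dot w m) *i) * ((phi_density m)%:C * Q l m)) /\
  cintegral (@lebesgue_tuple R q.-1)
    (fun m => cexp ((dot w m) *i) * ((phi_density m)%:C * Q l m)) =
  (cfM w)%:C * \prod_(k < q.-1) ((1 *i / q%:R * Omega w k) ^+ tnth l k / (tnth l k)`!%:R).
Proof.
pose s i : R[i] := (tnth w i) *i.
have e m : Qm (Multinom l) m * ((phi_cst q)%:C * gform q%:R 1 s m) =
    cexp ((dot w m) *i) * ((phi_density m)%:C * Q l m).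
  rewrite -phi_densityE// QE mulrC -mulrA; congr (cexp _ * _).
  by apply: complex_ext; rewrite ?cRe_sum ?cIm_sum /=;
    [apply: big1 => i _|apply: eq_bigr => i _]; rewrite /=; ring.
have [b h] := @gaussL_Qm R q q_gt1 (Multinom l).
split; first exact: (eq_cintegrable e (cintegrable_gaussL q_gt1 s b)).
rewrite -(eq_cintegral _ e) -/(gaussL s (Qm (Multinom l))) h; congr (_ * _).
  rewrite /cfM -cexp_real; congr cexp; rewrite /covB.
  have -> : \sum_(a < q.-1) \sum_(b < q.-1) ((a == b)%:R - q%:R^-1) * tnth w a * tnth w b =
      \sum_a tnth w a ^+ 2 - q%:R^-1 * (\sum_a tnth w a) ^+ 2.
    rewrite expr2 mulr_suml mulr_sumr -sumrB; apply: eq_bigr => a _.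
    under eq_bigr do rewrite mulrBl mulrBl.
    rewrite sumrB; congr (_ - _); last by rewrite !mulr_sumr; apply: eq_bigr => c _; ring.
    rewrite (bigD1 a)//= eqxx mul1r big1 ?addr0// => c ca.
    by rewrite eq_sym (negbTE ca) !mul0r.
  have -> : \sum_i s i * s i = - (\sum_a tnth w a ^+ 2)%:C.
    rewrite rmorph_sum -sumrN; apply: eq_bigr => i _; apply: complex_ext; rewrite /=; ring.
  have -> : \sum_i s i = (\sum_a tnth w a)%:C * 1 *i.
    rewrite rmorph_sum mulr_suml; apply: eq_bigr => i _; apply: complex_ext; rewrite /=; ring.
  rewrite !(rmorphM, rmorphN, rmorphB, rmorphXn, fmorphV, rmorph_nat) /=.
  have i2 : (1 *i : R[i]) ^+ 2 = -1 by apply: complex_ext; rewrite /=; ring.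
  have q0 : (q%:R : R[i]) != 0 by rewrite pnatr_eq0 -lt0n ltnW.
  set A := (\sum_a _)%:C; set B := (\sum_a _)%:C.
  rewrite (_ : q%:R^-1 * (B * 1 *i) * (B * 1 *i) = q%:R^-1 * B ^+ 2 * (1 *i) ^+ 2); last by ring.
  by rewrite i2; field.
apply: eq_bigr => k _; congr (_ ^+ _ / _).
rewrite /kap /Omega mulrAC [in RHS]mulrC; congr (_ * _); rewrite mulr_sumr.
by apply: eq_bigr => j _; rewrite mulrA; congr (_ * _); apply: complex_ext; rewrite /=; ring.
Qed.

End transform.

(** * The transformed field, with bounded real versions of the random products *)

Section limit_field.
Context {R : realType} (q : nat) (q_gt1 : (1 < q)%N).
Context (d : measure_display) (T : measurableType d) (P : probability T R).
Local Notation n := q.-1.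
Variables (Yh Y1 : 'I_n -> T -> R[i]) (rh r1 : 'I_n -> T -> R).
Hypothesis mYh : forall k, measurable_fun setT (Yh k).
Hypothesis mY1 : forall k, measurable_fun setT (Y1 k).
Hypothesis mrh : forall k, measurable_fun setT (rh k).
Hypothesis mr1 : forall k, measurable_fun setT (r1 k).
Hypothesis rh_le1 : forall k x, `|rh k x| <= 1.
Hypothesis r1_le1 : forall k x, `|r1 k x| <= 1.
Hypothesis YhE : {ae P, forall x, forall k, Yh k x = (rh k x)%:C}.
Hypothesis Y1E : {ae P, forall x, forall k, Y1 k x = (r1 k x)%:C}.
Hypothesis half_sqr : forall l : n.-tuple nat,
  cintegral P (fun x => \prod_(k < n) (rh k x)%:C ^+ tnth l k) ^+ 2 =
  cintegral P (fun x => \prod_(k < n) (r1 k x)%:C ^+ tnth l k).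
Variable gamma : n.-tuple nat -> {RV P >-> R}.
Hypothesis gamma_iid : iid gamma (normal_prob 0 1).

Let mon (r : 'I_n -> T -> R) (l : n.-tuple nat) x : R[i] := \prod_(k < n) (r k x)%:C ^+ tnth l k.

Let mmon r l : (forall k, measurable_fun setT (r k)) -> measurable_fun setT (mon r l).
Proof. by move=> mr; apply: measurable_cprod => k; apply: measurable_cX; exact: measurable_realC. Qed.

Let mon_le1 r l x : (forall k x, `|r k x| <= 1) -> normc (mon r l x) <= 1.
Proof.
move=> r_le1; rewrite /mon normc_prod; apply: prodr_ile1 => k _; rewrite normc_ge0 normcX normc_real.
by rewrite exprn_ile1.
Qed.

Let monR r l x : mon r l x = (\prod_(k < n) r k x ^+ tnth l k)%:C.
Proof. by rewrite rmorph_prod; apply: eq_bigr => k _; rewrite rmorphXn. Qed.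

Let EY l : R[i] := cintegral P (fun y => \prod_(k < n) Yh k y ^+ tnth l k).

Let EYE l : EY l = cintegral P (mon rh l).
Proof.
have [] // := @cintegral_ae_eq R _ T P (fun y => \prod_(k < n) Yh k y ^+ tnth l k) (mon rh l).
- by apply: measurable_cprod => k; apply: measurable_cX.
- by apply: filterS YhE => x h; apply: eq_bigr => k _; rewrite h.
- apply: (@cintegrable_bounded _ _ _ _ _ 1); first exact: mmon.
  by move=> x; exact: mon_le1.
Qed.

Let EY_le1 l : normc (EY l) <= 1.
Proof.
rewrite EYE; apply: normc_expectation_le1; [exact: mmon|by move=> x; rewrite monR|].
by move=> x; exact: mon_le1.
Qed.

(** The expectation is real, so conjugation is trivial and the modulus squared equals the square
    computed by [half_sqr]. *)
Let EY_sqr l : EY l * conjc (EY l) = cintegral P (mon r1 l).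
Proof.
rewrite -half_sqr -/(mon rh l) -EYE expr2; congr (_ * _).
rewrite EYE; apply: complex_ext => //=.
rewrite (_ : Rintegral _ _ _ = 0) ?oppr0//.
transitivity (\int[P]_x (0 : R)); last by rewrite Rintegral_cst// mul0r.
by apply: eq_Rintegral => x _; rewrite monR.
Qed.

(** The weight of the field, the square root of l!, times the 1/l! of [fourier_phi_Q] leaves one
    over the square root of l!. *)
Let dcoef w (l : n.-tuple nat) : R[i] :=
  \prod_(k < n) ((1 *i / q%:R * Omega w k) ^+ tnth l k / (Num.sqrt (tnth l k)`!%:R)%:C).

Let bound w (l : n.-tuple nat) : R :=
  \prod_(k < n) (normc (1 *i / q%:R * Omega w k) ^+ tnth l k / Num.sqrt (tnth l k)`!%:R).

Let normc_dcoef w l : normc (dcoef w l) = bound w l.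
Proof.
rewrite normc_prod; apply: eq_bigr => k _.
by rewrite Normc.normcM Normc.normcV normcX normc_real ger0_norm// sqrtr_ge0.
Qed.

Let bound_ge0 w l : 0 <= bound w l.
Proof. by rewrite -normc_dcoef normc_ge0. Qed.

Let summable_bound w : summable [set: n.-tuple nat] (EFin \o bound w).
Proof. by apply: summable_sqrt_tuple => k; exact: normc_ge0. Qed.

Definition field_coef w l : R[i] := (cfM w)%:C * (EY l * dcoef w l).

Let csummable_EYd w : csummable (fun l => EY l * dcoef w l).
Proof.
apply: (csummable_le (summable_bound w)) => l.
by rewrite Normc.normcM normc_dcoef ler_piMl.
Qed.

Lemma csummable_field_coef w : csummable (field_coef w).
Proof. exact: csummableZ (csummable_EYd w). Qed.

Lemma ghat_termE w l x :
  cintegrable (@lebesgue_tuple R q.-1)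
    (fun m => cexp ((dot w m) *i) * g_term P Yh gamma l m x) /\
  ghat_term P Yh gamma w l x = field_coef w l * (gamma l x)%:C.
Proof.
have [c1 e1] := fourier_phi_Q q_gt1 w l.
pose K := EY l * (Num.sqrt (\prod_(j < n) (tnth l j)`!%:R))%:C * (gamma l x)%:C.
have e m : K * (cexp ((dot w m) *i) * ((phi_density m)%:C * Q l m)) =
    cexp ((dot w m) *i) * g_term P Yh gamma l m x.
  by rewrite /g_term -/(EY l) /K; ring.
split; first exact: (eq_cintegrable e (cintegrableZl K c1)).
rewrite /ghat_term -(eq_cintegral _ e) (cintegralZl K c1) e1 /K /field_coef.
rewrite sqrtr_prod// rmorph_prod.
rewrite (_ : dcoef w l = \prod_(k < n) (Num.sqrt (tnth l k)`!%:R)%:C *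
  \prod_(k < n) ((1 *i / q%:R * Omega w k) ^+ tnth l k / (tnth l k)`!%:R)); first by ring.
rewrite -big_split; apply: eq_bigr => k _ /=.
rewrite mulrCA; congr (_ * _); set f := (tnth l k)`!.
have f0 : 0 < f%:R :> R by rewrite ltr0n fact_gt0.
have -> : (f%:R : R[i]) = (Num.sqrt f%:R)%:C ^+ 2.
  by rewrite -rmorphXn /= sqr_sqrtr ?ltW// rmorph_nat.
have s0 : (Num.sqrt f%:R)%:C != 0 :> R[i].
  by rewrite (inj_eq (@complexI R)) gt_eqF// sqrtr_gt0.
by field.
Qed.

Lemma ghatE w : ghat P Yh gamma w = cgsum gamma (field_coef w).
Proof.
by apply/funext => x; congr csum; apply/funext => l; have [] := ghat_termE w l x.
Qed.

Lemma ae_summable_abs_gamma w :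
  {ae P, forall x, summable [set: n.-tuple nat] (EFin \o (fun l => bound w l * `|gamma l x|))}.
Proof.
apply: filterS (ae_summable_gsum gamma_iid (summable_bound w)) => x; apply: le_lt_trans.
apply: le_esum => l _ /=; rewrite !lee_fin.
by rewrite !normrM normr_id.
Qed.

Lemma series_termE w (r : 'I_n -> T -> R) y g l :
  series_term w (fun k => (r k y)%:C) g l = mon r l y * (dcoef w l * (g l)%:C).
Proof.
rewrite /series_term mulrA; congr (_ * (g l)%:C).
rewrite -prodrXr mulrC /mon /dcoef -!big_split; apply: eq_bigr => k _ /=.
by rewrite -/(Omega w k) !exprMn; ring.
Qed.

Lemma measurable_series_term w g l : measurable_fun setT (fun y => series_term w (Yh^~ y) g l).
Proof.
apply: measurable_cM; last exact: measurable_cst.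
apply: measurable_cM; first exact: measurable_cst.
apply: measurable_cprod => k; apply: measurable_cM; last exact: measurable_cst.
by apply: measurable_cX; apply: measurable_cM; [exact: mYh|exact: measurable_cst].
Qed.

(** For almost every x the majorant [bound w l] times |gamma l x| is summable in l. With such an x
    fixed the gammas are constants, and sum over l and expectation over y are exchanged by
    [cintegral_csum]. *)
Lemma ghat_inner w : {ae P, forall x,
  let inner y := csum (series_term w (Yh^~ y) (gamma^~ x)) in
  [/\ {ae P, forall y, csummable (series_term w (Yh^~ y) (gamma^~ x))},
      cintegrable P inner &
      ghat P Yh gamma w x = (cfM w)%:C * cintegral P inner]}.
Proof.
apply: filterS (ae_summable_abs_gamma w) => x sx.
pose inner y := csum (series_term w (Yh^~ y) (gamma^~ x)).
pose f l y : R[i] := mon rh l y * (dcoef w l * (gamma l x)%:C).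
have mf l : measurable_fun setT (f l).
  by apply: measurable_cM; [exact: mmon|exact: measurable_cst].
have fB l y : normc (f l y) <= bound w l * `|gamma l x|.
  rewrite !Normc.normcM normc_dcoef normc_real ler_piMl ?mulr_ge0//.
  exact: mon_le1.
have [] := @cintegral_csum R _ _ T P f _ mf sx.
  move=> l; apply: (@le_trans _ _ (\int[P]_y (bound w l * `|gamma l x|)%:E)%E).
    apply: ge0_le_integral => //.
    - by move=> y _; rewrite lee_fin normc_ge0.
    - by apply/measurable_EFinP; exact: measurable_normc.
    - by move=> y _; rewrite lee_fin.
  rewrite integral_cst//= probability_setT mule1//.
move=> a1 a2 a3 a4.
have fE y : (forall k, Yh k y = (rh k y)%:C) ->
    series_term w (Yh^~ y) (gamma^~ x) = (fun l => f l y).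
  by move=> h; apply/funext => l; rewrite /f -(series_termE w rh y (gamma^~ x)); congr series_term; apply/funext.
have aein : {ae P, forall y, inner y = csum (fun l => f l y)}.
  by apply: filterS YhE => y h; rewrite /inner fE.
have [c1 e1] := cintegral_ae_eq (measurable_csumI (measurable_series_term w (gamma^~ x))) aein a2.
split; [by apply: filterS2 YhE a1 => y h; rewrite fE|exact: c1|].
transitivity ((cfM w)%:C * csum (fun l => cintegral P (f l))); last first.
  by rewrite -a4; congr (_ * _); exact/esym.
rewrite ghatE /cgsum.
have iE l : cintegral P (f l) = EY l * dcoef w l * (gamma l x)%:C.
  rewrite (eq_cintegral _ (fun y => mulrC (mon rh l y) _)) cintegralZl.
    by rewrite EYE; ring.
  apply: (@cintegrable_bounded _ _ _ _ _ 1); first exact: mmon.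
  by move=> y; exact: mon_le1.
rewrite -(csumZ _ a3); congr csum; apply/funext => l.
by rewrite iE /field_coef -!mulrA.
Qed.

(** [EY_sqr] turns the covariance series into a sum of moments of Y against multi-index exponential
    coefficients; exchanging sum and expectation resums it to an exponential. *)
Lemma ghat_cov w v :
  cintegrable P (fun x => ghat P Yh gamma w x * conjc (ghat P Yh gamma v x)) /\
  cintegral P (fun x => ghat P Yh gamma w x * conjc (ghat P Yh gamma v x)) =
  (cfM w)%:C * (cfM v)%:C * cintegral P (fun x => cexp ((q%:R ^+ 2)^-1 *
    \sum_(k < n) Y1 k x * \sum_(a < n) \sum_(b < n)
      (tnth w a)%:C * (tnth v b)%:C * theta q k.+1 ^+ a.+1 * theta q k.+1 ^- b.+1)).
Proof.
rewrite !ghatE.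
have [c1 ->] := cgsum_cov gamma_iid (csummable_field_coef w) (csummable_field_coef v).
split => //.
(* The product of the k-th bases of [dcoef w] and the conjugate of [dcoef v]: the factors i and conj
   i multiply to 1, and the two square roots combine to a full factorial. *)
pose z k : R[i] := (q%:R ^+ 2)^-1 * (Omega w k * conjc (Omega v k)).
have zE k : z k = (q%:R ^+ 2)^-1 * \sum_(a < n) \sum_(b < n)
      (tnth w a)%:C * (tnth v b)%:C * theta q k.+1 ^+ a.+1 * theta q k.+1 ^- b.+1.
  rewrite /z; congr (_ * _); rewrite /Omega conjc_sum mulr_suml; apply: eq_bigr => a _.
  rewrite mulr_sumr; apply: eq_bigr => b _; by rewrite conjc_mul thetaV conjc_real; ring.
pose f l x := \prod_(k < n) expt ((r1 k x)%:C * z k) (tnth l k).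
pose B (l : n.-tuple nat) := \prod_(k < n) exp_coeff (normc (z k)) (tnth l k).
have fE l x : f l x = mon r1 l x * \prod_(k < n) expt (z k) (tnth l k).
  rewrite /f /mon -big_split; apply: eq_bigr => k _; rewrite /expt exprMn /=; ring.
have mf l : measurable_fun setT (f l).
  by rewrite (funext (fE l)); apply: measurable_cM; [exact: mmon|exact: measurable_cst].
have BE l : B l = normc (\prod_(k < n) expt (z k) (tnth l k)).
  by rewrite normc_prod; apply: eq_bigr => k _; rewrite normc_expt.
have sB : summable [set: n.-tuple nat] (EFin \o B).
  have [h _] := csum_exp_tuple z; have := csummable_normc h.
  by congr summable; apply/funext => l; rewrite /= BE.
have [] := @cintegral_csum R _ _ T P f B mf sB.
  move=> l; apply: (@le_trans _ _ (\int[P]_y (B l)%:E)%E).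
    apply: ge0_le_integral => //.
    - by move=> y _; rewrite lee_fin normc_ge0.
    - by apply/measurable_EFinP; exact: measurable_normc.
    - move=> y _; rewrite lee_fin fE Normc.normcM (BE l) ler_piMl ?normc_ge0//.
      exact: mon_le1.
  by rewrite integral_cst//= probability_setT mule1.
move=> _ a2 a3 a4.
have coefE l : field_coef w l * conjc (field_coef v l) =
    (cfM w)%:C * (cfM v)%:C * cintegral P (f l).
  rewrite (eq_cintegral _ (fE l)) (eq_cintegral _ (fun y => mulrC (mon r1 l y) _)).
  rewrite cintegralZl; last first.
    apply: (@cintegrable_bounded _ _ _ _ _ 1); first exact: mmon.
    by move=> y; exact: mon_le1.
  rewrite -EY_sqr /field_coef !conjc_mul !conjc_real.
  have -> : \prod_(k < n) expt (z k) (tnth l k) = dcoef w l * conjc (dcoef v l).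
    rewrite /dcoef conjc_prod -big_split; apply: eq_bigr => k _ /=.
    rewrite conjc_mul conjc_inv conjc_exp conjc_real /expt.
    set m := tnth l k; set f' := m`!.
    have f0 : 0 < f'%:R :> R by rewrite ltr0n fact_gt0.
    have -> : (f'%:R : R[i]) = (Num.sqrt f'%:R)%:C ^+ 2.
      by rewrite -rmorphXn /= sqr_sqrtr ?ltW// rmorph_nat.
    have -> : z k = (1 *i / q%:R * Omega w k) * conjc (1 *i / q%:R * Omega v k).
      rewrite !conjc_mul conjc_inv conjc_nat /z.
      have -> : conjc (1 *i : R[i]) = - 1 *i by apply: complex_ext; rewrite /= ?oppr0.
      have i2 : (1 *i : R[i]) * - 1 *i = 1 by apply: complex_ext; rewrite /=; ring.
      rewrite mulrACA [X in _ = X * _]mulrACA i2 mul1r expr2 invfM; ring.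
    by rewrite exprMn invfM; ring.
  ring.
rewrite (funext coefE) csumZ// -a4; congr (_ * _).
have [] // := @cintegral_ae_eq R _ T P (fun x => cexp ((q%:R ^+ 2)^-1 *
    \sum_(k < n) Y1 k x * \sum_(a < n) \sum_(b < n)
      (tnth w a)%:C * (tnth v b)%:C * theta q k.+1 ^+ a.+1 * theta q k.+1 ^- b.+1))
      (fun x => csum (f^~ x)) _ _ a2.
- apply: measurable_cexp; apply: measurable_cM; first exact: measurable_cst.
  apply: measurable_csum => k; apply: measurable_cM; first exact: mY1.
  exact: measurable_cst.
- apply: filterS Y1E => x h.
  have [_ ->] := csum_exp_tuple (fun k => (r1 k x)%:C * z k); congr cexp.
  rewrite mulr_sumr; apply: eq_bigr => k _; rewrite h zE; ring.
Qed.

End limit_field.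

Lemma measurable_point_product {R : realType} q d (T : measurableType d) (P : probability T R)
    (xi : nat -> {RV P >-> q.-1.-tuple R[i]}) (N : {RV P >-> nat}) k :
  measurable_fun setT (point_product xi N k).
Proof.
have mp t : measurable_fun setT (fun x => \prod_(b < t) tnth (xi b x) k).
  apply: measurable_cprod => b; apply: (measurableT_comp (measurable_tnth k)).
  exact: measurable_funP.
apply/measurable_complexP; split.
  exact: (@measurable_random_index _ _ _ P N _ (fun t => measurable_cRe (mp t))).
exact: (@measurable_random_index _ _ _ P N _ (fun t => measurable_cIm (mp t))).
Qed.

Lemma ccovariance_mean0 {R : realType} d (T : measurableType d) (P : probability T R)
    (X Y : T -> R[i]) : cintegral P X = 0 -> cintegral P Y = 0 ->
  ccovariance P X Y = cintegral P (fun x => X x * conjc (Y x)).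
Proof. by move=> X0 Y0; apply: eq_cintegral => x; rewrite X0 Y0 !subr0. Qed.

Theorem proposition12
  (R : realType) (q : nat) (q_ge2 : (2 <= q)%N)
  (alpha : R) (alpha01 : 0 < alpha < 1)
  (mu : probability (q.-tuple R) R) (mu_simplex : mu (@simplex R q) = 1%E)
  (d : measure_display) (T : measurableType d) (P : probability T R)
  (xi : nat -> {RV P >-> q.-1.-tuple R[i]})
  (xi_iid : iid xi (nu_of mu))
  (T1 Thalf : {RV P >-> nat})
  (T1_law : negbin T1 alpha 1) (Thalf_law : negbin Thalf alpha 2^-1)
  (T1_indep : independent P (sigma_gen (fun _ : unit => T1)) (sigma_gen xi))
  (Thalf_indep : independent P (sigma_gen (fun _ : unit => Thalf)) (sigma_gen xi))
  (gamma : q.-1.-tuple nat -> {RV P >-> R})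
  (gamma_iid : iid gamma (normal_prob 0 1))
  (gamma_indep :
    independent P (sigma_gen gamma) (sigma_gen (point_product xi Thalf)))
  (M : {RV P >-> q.-tuple R})
  (M_gaussian : jointly_gaussian P (fun (a : 'I_q) x => tnth (M x) a))
  (M_mean : forall a : 'I_q, ('E_P[fun x => tnth (M x) a] = 0)%E)
  (M_cov : forall a b : 'I_q,
    covariance P (fun x => tnth (M x) a) (fun x => tnth (M x) b) =
    (q%:R^-1 * ((a == b)%:R - q%:R^-1))%:E)
  (Y_real : {ae P, forall x,
    forall k : 'I_q.-1, complex.Im (point_product xi T1 k x) = 0}) :
  let Y := point_product xi T1 in
  let Yhalf := point_product xi Thalf in
  let charM (w : q.-1.-tuple R) : R[i] :=
    cintegral P (fun x => cexp (dot (behead_tuple (M x)) w)*i) in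
  let g_hat := ghat P Yhalf gamma in
  [/\ forall w : q.-1.-tuple R,
      [/\ forall l x, cintegrable (lebesgue_tuple q.-1)
            (fun m => cexp (dot w m)*i * g_term P Yhalf gamma l m x),
          {ae P, forall x, csummable (fun l => ghat_term P Yhalf gamma w l x)} &
          {ae P, forall x,
            let inner y := csum (series_term w (Yhalf^~ y) (gamma^~ x)) in
            [/\ {ae P, forall y,
                  csummable (series_term w (Yhalf^~ y) (gamma^~ x))},
                cintegrable P inner &
                g_hat w x = charM w * cintegral P inner]}],
      complex_gaussian_field P g_hat,
      forall w, cintegrable P (g_hat w) /\ cintegral P (g_hat w) = 0,
      forall w v : q.-1.-tuple R,
      [/\ cintegrable P (fun x => g_hat w x * conjc (g_hat v x)),
          ccovariance P (g_hat w) (g_hat v) =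
            cintegral P (fun x => g_hat w x * conjc (g_hat v x)) &
          cintegral P (fun x => g_hat w x * conjc (g_hat v x)) =
            charM w *
            cintegral P (fun x => cexp (- dot (behead_tuple (M x)) v)*i) *
            cintegral P (fun x => cexp ((q%:R ^+ 2)^-1 *
              \sum_(k < q.-1) Y k x *
                \sum_(a < q.-1) \sum_(b < q.-1)
                  (tnth w a)%:C * (tnth v b)%:C *
                  theta q k.+1 ^+ a.+1 * theta q k.+1 ^- b.+1))] &
      forall w : q.-1.-tuple R,
        charM w = (expR (- (2 * q%:R)^-1 *
          \sum_(a < q.-1) \sum_(b < q.-1)
            ((a == b)%:R - q%:R^-1) * tnth w a * tnth w b))%:C].
Proof.
move=> Y Yhalf charM g_hat.
(* Used with c = 1 and c = -1; the value depends on c only through its square, so both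
   characteristic functions equal [cfM]. *)
have cfE := fun (w : q.-1.-tuple R) (c : R) =>
  cf_behead_gaussian w c (ltnW q_ge2) M_gaussian M_mean M_cov.
have charME w : charM w = (cfM w)%:C.
  rewrite /charM -[RHS]/(expR _)%:C.
  have := cfE w 1; under eq_cintegral do rewrite mul1r.
  by move=> ->; rewrite expr1n mulN1r.
have charMNE w : cintegral P (fun x => cexp (- dot (behead_tuple (M x)) w)*i) = (cfM w)%:C.
  have := cfE w (-1); under eq_cintegral do rewrite mulN1r.
  by move=> ->; rewrite sqrrN expr1n mulN1r.
have ae_pp := ae_point_product mu_simplex xi_iid alpha01 T1_law T1_indep Y_real.
have mpp (N : {RV P >-> nat}) k : measurable_fun setT (point_product xi N k) by exact: measurable_point_product.
have mr (N : {RV P >-> nat}) k : measurable_fun setT (rprod xi N k) by exact: measurable_rprod.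
have half l := half_moment_sqr xi_iid l alpha01 T1_law Thalf_law T1_indep Thalf_indep.
have rle (N : {RV P >-> nat}) k x := rprod_le1 xi N k x.
have scoef w := csummable_field_coef (mpp Thalf) (mr Thalf) (rle Thalf) (ae_pp Thalf) w.
have cov := ghat_cov q_ge2 (mpp Thalf) (mpp T1) (mr Thalf) (mr T1) (rle Thalf) (rle T1)
  (ae_pp Thalf) (ae_pp T1) half gamma_iid.
have gE := ghatE q_ge2 Yhalf gamma.
have gm w : cintegrable P (g_hat w) /\ cintegral P (g_hat w) = 0.
  by rewrite /g_hat gE; have h := cgsum_mean gamma_iid (scoef w); exact h.
split.
- move=> w; split.
  + by move=> l x; have [] := ghat_termE q_ge2 Yhalf gamma w l x.
  + apply: filterS (ae_csummable_cgsum gamma_iid (scoef w)) => x.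
    by congr csummable; apply/funext => l; have [] := ghat_termE q_ge2 Yhalf gamma w l x.
  + rewrite charME.
    exact: (ghat_inner q_ge2 (mpp Thalf) (mr Thalf) (rle Thalf) (ae_pp Thalf) gamma_iid w).
- rewrite (_ : g_hat = fun w => cgsum gamma (field_coef P Yhalf w)); last exact/funext.
  exact: (complex_gaussian_cgsum gamma_iid scoef).
- exact: gm.
- move=> w v; have [c1 e1] := cov w v; split.
  + exact: c1.
  + exact: ccovariance_mean0 (gm w).2 (gm v).2.
  + by rewrite charME charMNE; exact: e1.
- exact: charME.
Qed.
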